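(* Let $H$ be a real separable Hilbert space and let $\phi=\phi_1+\phi_2:H\to(-\infty,\infty]$ have compact sublevels, where $\phi_1:H\to(-\infty,\infty]$ is convex, proper, lower semicontinuous with $\partial\phi_1$ single-valued, and $\phi_2\in C^{1,\alpha}_{\rm loc}(H)$ for some $\alpha\in(0,1]$. Let $T>0$ and let $\{0=t_0^n<t_1^n<\dots<t_{N^n}^n=T\}$, $n\in\mathbb{N}$, be a sequence of partitions with time steps $\tau_i^n=t_i^n-t_{i-1}^n$ and $\tau^n=\max_i\tau_i^n\to0$. Let $u_i^n\in D(\partial\phi)$, $i=0,\dots,N^n$, be such that $u_0^n=u_0$ and $$\sum_{i=1}^{N^n}G_i^n(u_i^n,u_{i-1}^n)^+\to0\quad\text{as }n\to\infty.$$ Then $\widehat u^n\to u$ strongly in $H^1(0,T;H)$, where $u$ solves the gradient-flow problem $$u'(t)+\partial\phi(u(t))=0\ \text{ for a.e. }t\in(0,T),\qquad u(0)=u_0.$$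
   Context: $H$ has scalar product $(\cdot,\cdot)$ and norm $\|\cdot\|$. The Fréchet subdifferential $\partial\phi(u)$ at $u$ with $\phi(u)<\infty$ is the set of $\xi\in H$ with $\liminf_{v\to u}\frac{\phi(v)-\phi(u)-(\xi,v-u)}{\|v-u\|}\ge0$; here $\partial\phi=\partial\phi_1+\mathrm{D}\phi_2$, where $\partial\phi_1$ is the subdifferential of convex analysis and $\mathrm{D}\phi_2$ the Fréchet gradient. $D(\partial\phi)=\{u\in H:\partial\phi(u)\ne\emptyset\}=D(\partial\phi_1)$. That $\partial\phi_1$ is single-valued means $\partial\phi_1(u)$ is a singleton for all $u\in D(\partial\phi_1)$; then $\partial\phi(u)$ is identified with its unique element. Compact sublevels means that the sets $\{u\in H:\phi(u)\le c\}$, $c\in\mathbb{R}$, are compact in the norm topology. $C^{1,\alpha}_{\rm loc}(H)$ is the set of $C^1$ functions on $H$ with locally $\alpha$-Hölder continuous gradient. For $u,v\in D(\partial\phi)$, $$G_i^n(u,v)=\phi(u)+\frac{\tau_i^n}{2}\left\|\frac{u-v}{\tau_i^n}\right\|^2+\frac{\tau_i^n}{2}\|\partial\phi(u)\|^2-\phi(v),$$ and $a^+=\max\{a,0\}$. The piecewise affine interpolant $\widehat u^n:[0,T]\to H$ is given by $\widehat u^n(0)=u_0^n$ and $\widehat u^n(t)=\ell_j^n(t)u_j^n+(1-\ell_j^n(t))u_{j-1}^n$ for $t\in(t_{j-1}^n,t_j^n]$, with $\ell_j^n(t)=(t-t_{j-1}^n)/\tau_j^n$.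
   Formalization: For α<1 solutions may be non-unique and the whole sequence may fail to converge; what is proved is strong H^1 convergence to a solution along a further subsequence of every subsequence, and of the whole sequence if α=1 or the solution is unique. *)

(* Defs.v *)
From HB Require Import structures.
From mathcomp Require Import all_boot all_order all_algebra sesquilinear.
From mathcomp Require Import all_classical all_reals all_analysis.

Set Implicit Arguments.
Unset Strict Implicit.
Unset Printing Implicit Defensive.

Import Order.TTheory GRing.Theory Num.Theory.
Import numFieldNormedType.Exports.

Local Open Scope classical_set_scope.
Local Open Scope ring_scope.

Definition separable (X : topologicalType) : Prop :=
  exists2 D : set X, countable D & dense D.

Section Functionals.
Context {R : realType} {H : completeNormedModType R}.
Variable dot : {dot H for idfun}.

(* With this, the complete normed space H is a Hilbert space. *)
Definition induces_norm : Prop := forall x : H, dot x x = `|x| ^+ 2.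

Local Open Scope ereal_scope.

Definition proper_ereal (phi : H -> \bar R) : Prop :=
  (forall u, -oo < phi u) /\ exists u, phi u < +oo.

Definition convex_ereal (phi : H -> \bar R) : Prop :=
  forall (u v : H) (s : R), (0 <= s <= 1)%R ->
    phi (s *: u + (1 - s) *: v)%R <= s%:E * phi u + (1 - s)%:E * phi v.

Definition compact_sublevels (phi : H -> \bar R) : Prop :=
  forall c : R, compact [set u | phi u <= c%:E].

Definition convex_subdiff (phi : H -> \bar R) (u : H) : set H :=
  [set xi | phi u < +oo /\
            forall v, phi u + (dot xi (v - u))%:E <= phi v].

Definition single_valued (S : H -> set H) : Prop :=
  forall u, S u !=set0 -> exists xi, S u = [set xi].

Definition frechet_subdiff (phi : H -> \bar R) (u : H) : set H :=
  [set xi | phi u < +oo /\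
    0 <= limf_einf (fun v => (phi v - phi u - (dot xi (v - u))%:E)
                             * (`|v - u|^-1)%:E) u^'].

Definition dom_subdiff (phi : H -> \bar R) : set H :=
  [set u | frechet_subdiff phi u !=set0].

(* The element of the Frechet subdifferential when it is a singleton;
   a dummy value outside [dom_subdiff phi]. *)
Definition subgrad (phi : H -> \bar R) (u : H) : H :=
  xget 0%R (frechet_subdiff phi u).

Local Open Scope ring_scope.

Definition is_gradient (f : H -> R) (g : H -> H) : Prop :=
  forall u, differentiable f u /\ forall h, 'd f u h = dot (g u) h.

Definition C1_holder_loc (alpha : R) (f : H -> R) : Prop :=
  exists2 g : H -> H, is_gradient f g &
    forall u, exists L : R, exists2 r : R, 0 < r &
      forall v w, ball u r v -> ball u r w ->
        `|g v - g w| <= L * `|v - w| `^ alpha.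

Definition residual (phi : H -> \bar R) (tau : R) (u v : H) : \bar R :=
  (phi u + (tau / 2 * `|tau^-1 *: (u - v)| ^+ 2)%:E
   + (tau / 2 * `|subgrad phi u| ^+ 2)%:E - phi v)%E.

End Functionals.

Section Partitions.
Context {R : realType} {H : completeNormedModType R}.

(* The nodes of a partition into N intervals are t 0, ..., t N;
   values of t beyond N are irrelevant. *)
Definition is_partition (T : R) (N : nat) (t : nat -> R) : Prop :=
  [/\ t 0%N = 0, t N = T & forall i, (i < N)%N -> t i < t i.+1].

Definition tstep (t : nat -> R) (i : nat) : R := t i - t i.-1.

Definition diameter (N : nat) (t : nat -> R) : R :=
  \big[Num.max/0]_(1 <= i < N.+1) tstep t i.

(* For 0 < s <= t N exactly one index j satisfies the condition in the sum. *)
Definition pw_affine (N : nat) (t : nat -> R) (u : nat -> H) (s : R) : H :=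
  if s == 0 then u 0%N else
  \sum_(1 <= j < N.+1 | t j.-1 < s <= t j)
    let l := (s - t j.-1) / tstep t j in l *: u j + (1 - l) *: u j.-1.

End Partitions.

Section Sobolev.
Context {R : realType} {H : completeNormedModType R}.
Let mu : set R -> \bar R := @lebesgue_measure R.

Definition abs_continuous (a b : R) (u : R -> H) : Prop :=
  forall e : R, 0 < e -> exists2 d : R, 0 < d &
    forall (n : nat) (x y : 'I_n -> R),
      (forall i, a <= x i <= y i /\ y i <= b) ->
      trivIset setT (fun i => `]x i, y i[%classic) ->
      \sum_(i < n) (y i - x i) < d ->
      \sum_(i < n) `|u (y i) - u (x i)| < e.

Definition normL2sq (T : R) (w : R -> H) : \bar R :=
  (\int[mu]_(t in `]0%R, T[) (`|w t| ^+ 2)%:E)%E.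

(* For separable H, Borel measurability coincides with the strong (Bochner)
   measurability, by Pettis' theorem. *)
Definition inL2 (T : R) (w : R -> H) : Prop :=
  exists g : R -> H,
    [/\ measurable_fun `]0, T[ (g : R -> g_sigma_algebraType (@open H)),
        {ae mu, forall t, t \in `]0, T[ -> w t = g t}
      & (normL2sq T g < +oo)%E].

(* H^1(0,T;H), through continuous representatives on [0,T]: the absolutely
   continuous functions that are differentiable a.e. with derivative in L^2.
   Values outside [0,T] are irrelevant. *)
Definition inH1 (T : R) (u : R -> H) : Prop :=
  [/\ abs_continuous 0 T u,
      {ae mu, forall t, t \in `]0, T[ -> derivable u t 1}
    & inL2 T (derive1 u)].

Definition normH1sq (T : R) (w : R -> H) : \bar R :=
  (normL2sq T w + normL2sq T (derive1 w))%E.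

Definition cvgH1 (T : R) (w : nat -> R -> H) (u : R -> H) : Prop :=
  [/\ forall n, inH1 T (w n), inH1 T u
    & normH1sq T (fun t => w n t - u t) @[n --> \oo] --> 0%E].

Definition gradient_flow (dot : {dot H for idfun}) (phi : H -> \bar R)
    (T : R) (u0 : H) (u : R -> H) : Prop :=
  [/\ inH1 T u,
      {ae mu, forall t, t \in `]0, T[ ->
        dom_subdiff dot phi (u t) /\ derive1 u t + subgrad dot phi (u t) = 0}
    & u 0 = u0].

End Sobolev.

(* Main.v *)
(* Summing the residuals bounds the discrete speeds in L2, so the piecewise
   constant interpolants live in a compact sublevel and are 1/2-Holder up to the
   mesh size; a Tychonoff argument gives a uniform cluster curve u.  The chain
   rule for phi is replaced by a discrete one.  Let D be the increment of an
   interpolant over a window of length h and xi its subgradient.  Almost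
   convexity of phi on compact sets bounds (xi, D) by the increment of the energy;
   averaged over all windows, these increments telescope, and the energy
   inequality shows that the integral of |xi + D/h|^2 is small, uniformly in the
   scheme.  The same averages and the parallelogram identity bound the L2 distance
   between the speeds of two schemes whose interpolants are uniformly close.  So
   along a fast subsequence the speeds converge in L2, a.e. xi tends to -u', and
   closedness of the subdifferential of phi1 identifies the limit.  For alpha = 1,
   monotonicity of the subdifferential of phi1 and the local Lipschitz bound on
   D phi2 give uniqueness by a Gronwall argument, and the whole sequence converges. *)

(* Strong L2 convergence of the speeds has to be extracted from information on positions. Averaging
   a speed over windows of length [h] cannot raise its kinetic energy by more than the mesh size
   accounts for, and the energy inequality shows that it loses at most a small amount. The averaged
   speeds are the quotients [D/h], which see positions only. So when two schemes are close in
   position, the sum of their speeds has nearly the largest possible kinetic energy, and the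
   parallelogram identity leaves little for the difference. Closeness of positions enters divided by
   [h^2]; therefore [h] is fixed before any two schemes are compared, and this dictates the order of
   all choices of constants. Windows start as early as [- h], with the curve frozen at its initial
   value before time 0, so that each node, the first ones included, is crossed by windows of the
   same total measure. The price is a term [h/2 |xi_0|^2], in which the slope at [u0] is a fixed
   vector because [u0] lies in the domain of the subdifferential. *)
Require Import Defs.
From mathcomp Require Import all_boot all_order all_algebra sesquilinear.
From mathcomp Require Import all_classical all_reals all_analysis.
From mathcomp Require Import measurable_realfun ring lra.
Import Order.TTheory GRing.Theory Num.Theory.
Import numFieldNormedType.Exports.
Local Open Scope classical_set_scope.
Local Open Scope ring_scope.

Set Implicit Arguments.
Unset Strict Implicit.
Unset Printing Implicit Defensive.

(** * Scalar products *)

Section InnerProduct.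
Context {R : realType} {H : completeNormedModType R}.
Variable dot : {dot H for idfun}.

Lemma dotC (x y : H) : dot x y = dot y x.
Proof. by have := hermC dot x y; rewrite expr0 mul1r. Qed.

Lemma dotDr (x y z : H) : dot x (y + z) = dot x y + dot x z.
Proof. by rewrite linearD. Qed.

Lemma dotNr (x y : H) : dot x (- y) = - dot x y.
Proof. by rewrite linearN. Qed.

Lemma dotZr (a : R) (x y : H) : dot x (a *: y) = a * dot x y.
Proof. by rewrite linearZ. Qed.

Lemma dotBr (x y z : H) : dot x (y - z) = dot x y - dot x z.
Proof. by rewrite dotDr dotNr. Qed.

Lemma dotDl (x y z : H) : dot (x + y) z = dot x z + dot y z.
Proof. by rewrite dotC dotDr !(dotC z). Qed.

Lemma dotNl (x y : H) : dot (- x) y = - dot x y.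
Proof. by rewrite dotC dotNr dotC. Qed.

Lemma dotBl (x y z : H) : dot (x - y) z = dot x z - dot y z.
Proof. by rewrite dotDl dotNl. Qed.

Lemma dotZl (a : R) (x y : H) : dot (a *: x) y = a * dot x y.
Proof. by rewrite dotC dotZr dotC. Qed.

Lemma dot0r (x : H) : dot x 0 = 0.
Proof. by rewrite linear0. Qed.

Hypothesis hdot : induces_norm dot.

Lemma sqr_normD (x y : H) : `|x + y| ^+ 2 = `|x| ^+ 2 + 2 * dot x y + `|y| ^+ 2.
Proof. rewrite -!hdot dotDl !dotDr (dotC y x); ring. Qed.

Lemma sqr_normB (x y : H) : `|x - y| ^+ 2 = `|x| ^+ 2 - 2 * dot x y + `|y| ^+ 2.
Proof. rewrite sqr_normD dotNr normrN; ring. Qed.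

Lemma sqr_normB_le (x y : H) : `|x - y| ^+ 2 <= 2 * `|x| ^+ 2 + 2 * `|y| ^+ 2.
Proof. by have := sqr_ge0 `|x + y|; rewrite sqr_normB sqr_normD; lra. Qed.

Lemma dot_le (x y : H) : dot x y <= `|x| * `|y|.
Proof.
have [->|y0] := eqVneq y 0; first by rewrite dot0r normr0 mulr0.
have [->|x0] := eqVneq x 0; first by rewrite dotC dot0r normr0 mul0r.
have yp : 0 < `|y| by rewrite normr_gt0.
have xp : 0 < `|x| by rewrite normr_gt0.
have := sqr_ge0 (`| `|y| *: x - `|x| *: y|).
rewrite sqr_normB !normrZ !normr_id dotZr dotZl !exprMn => h.
rewrite -(ler_pM2l (mulr_gt0 xp yp)); nra.
Qed.

Lemma ler_norm_dot (x y : H) : `|dot x y| <= `|x| * `|y|.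
Proof.
rewrite ler_norml dot_le andbT lerNl -dotNl (le_trans (dot_le _ _))//.
by rewrite normrN.
Qed.

Lemma continuous_dot (x : H) : continuous (dot x).
Proof.
move=> y; apply/cvgrPdist_le => e e0.
have k0 : 0 < `|x| + 1 by rewrite ltr_wpDl.
near=> z; rewrite -dotBr (le_trans (ler_norm_dot _ _))//.
apply: (@le_trans _ _ ((`|x| + 1) * `|y - z|)).
  by rewrite ler_wpM2r// lerDl.
rewrite mulrC -ler_pdivlMr//; near: z.
by apply: cvgr_dist_le => //; rewrite divr_gt0.
Unshelve. all: by end_near. Qed.

End InnerProduct.

(** * Vector-valued primitives *)

Section RealIntegrable.
Context d (X : measurableType d) (R : realType).
Variables (m : {measure set X -> \bar R}) (D : set X).
Hypothesis mD : measurable D.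
Implicit Types f g : X -> R.

Lemma integrable_rD f g : m.-integrable D (EFin \o f) ->
  m.-integrable D (EFin \o g) ->
  m.-integrable D (EFin \o (fun x => f x + g x)).
Proof. by move=> fi gi; have := integrableD mD fi gi; apply: eq_integrable. Qed.

Lemma integrable_rB f g : m.-integrable D (EFin \o f) ->
  m.-integrable D (EFin \o g) ->
  m.-integrable D (EFin \o (fun x => f x - g x)).
Proof. by move=> fi gi; have := integrableB mD fi gi; apply: eq_integrable. Qed.

Lemma integrable_rZ (k : R) f : m.-integrable D (EFin \o f) ->
  m.-integrable D (EFin \o (fun x => k * f x)).
Proof. by move=> fi; have := integrableZl mD k fi; apply: eq_integrable. Qed.

Lemma le_integrable_r f g : measurable_fun D f ->
  (forall x, D x -> `|f x| <= g x) -> m.-integrable D (EFin \o g) ->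
  m.-integrable D (EFin \o f).
Proof.
move=> mf fg; apply: le_integrable => //; first exact/measurable_EFinP.
move=> x Dx /=; rewrite lee_fin (le_trans (fg _ Dx))// ler_norm//.
Qed.

Lemma integrable_r_sum (I : Type) (s : seq I) (P : pred I) (F : I -> X -> R) :
  (forall i, m.-integrable D (EFin \o F i)) ->
  m.-integrable D (EFin \o (fun x => \sum_(i <- s | P i) F i x)).
Proof.
move=> Fi; elim: s => [|i s IH].
  under eq_fun do rewrite big_nil; exact: integrable0.
under eq_fun do rewrite big_cons; case: (P i) => //.
exact: integrable_rD.
Qed.

Lemma Rintegral_r_sum (I : Type) (s : seq I) (P : pred I) (F : I -> X -> R) :
  (forall i, m.-integrable D (EFin \o F i)) ->
  \int[m]_(x in D) (\sum_(i <- s | P i) F i x) =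
  \sum_(i <- s | P i) \int[m]_(x in D) F i x.
Proof.
move=> Fi; elim: s => [|i s IH].
  under eq_Rintegral do rewrite big_nil.
  by rewrite big_nil /Rintegral integral0.
under eq_Rintegral do rewrite big_cons; rewrite big_cons; case: (P i) => //.
by rewrite RintegralD// ?IH//; exact: integrable_r_sum.
Qed.

End RealIntegrable.

Section WeakPrimitive.
Context {R : realType} {H : completeNormedModType R}.
Variable dot : {dot H for idfun}.
Hypothesis hdot : induces_norm dot.
Local Notation mu := (@lebesgue_measure R).

(** Measurability through the distances to fixed vectors: it is stable under pointwise limits, gives
    the measurability of scalar products by polarization, and yields Borel measurability once the
    space is separable. *)
Definition scalar_measurable (g : R -> H) : Prop :=
  forall x, measurable_fun [set: R] (fun r => `|g r - x|).

Definition sq_integrable (T : R) (g : R -> H) : Prop :=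
  scalar_measurable g /\
  (\int[mu]_(r in `]0%R, T]) (`|g r| ^+ 2)%:E < +oo)%E.

Lemma scalar_measurable_norm (g : R -> H) : scalar_measurable g ->
  measurable_fun [set: R] (fun r => `|g r|).
Proof. by move=> /(_ 0); under eq_fun do rewrite subr0. Qed.

Lemma scalar_measurable_dot (g : R -> H) (e : H) : scalar_measurable g ->
  measurable_fun [set: R] (fun r => dot e (g r)).
Proof.
move=> mg.
rewrite (_ : (fun r => _) =
  (fun r => 2^-1 * (`|g r| ^+ 2 + `|e| ^+ 2 - `|g r - e| ^+ 2))); last first.
  by apply/funext => r; rewrite (sqr_normB hdot) (dotC _ (g r)); field.
apply: measurable_funM => //; apply: measurable_funB.
  apply: measurable_funD => //; apply: measurable_funX.
  exact: scalar_measurable_norm.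
exact: measurable_funX.
Qed.

Lemma mu_itvoc (a b : R) : a <= b -> mu `]a, b] = (b - a)%:E.
Proof.
move=> ab; rewrite lebesgue_measure_itv/= lte_fin.
case: ltP => [_|ba]; first by rewrite EFinB.
by have /eqP -> : b == a; rewrite ?subrr// eq_le ba ab.
Qed.

Lemma mu_itvoc_fin (a b : R) : (mu `]a, b] < +oo)%E.
Proof.
have [ab|/ltW ba] := leP a b; first by rewrite mu_itvoc// ltry.
by rewrite set_itv_ge ?measure0// bnd_simp -leNgt.
Qed.

Lemma integrable_cst_itvoc (a b c : R) :
  mu.-integrable `]a, b] (EFin \o (fun=> c)).
Proof.
apply: measurable_bounded_integrable => //; first exact: mu_itvoc_fin.
exact: bounded_cst.
Qed.

Lemma Rintegral_cst_itvoc (a b c : R) : a <= b ->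
  \int[mu]_(r in `]a, b]) c = c * (b - a).
Proof. by move=> ab; rewrite Rintegral_cst//= mu_itvoc. Qed.

Lemma sq_integrable_shift T g x : sq_integrable T g ->
  mu.-integrable `]0, T] (EFin \o (fun r => `|g r - x| ^+ 2)).
Proof.
move=> [mg gT].
have ig : mu.-integrable `]0, T] (EFin \o (fun r => `|g r| ^+ 2)).
  apply/integrableP; split.
    apply/measurable_EFinP/measurable_funTS; apply: measurable_funX.
    exact: scalar_measurable_norm.
  by under eq_integral do rewrite /= ger0_norm//.
apply: (@le_integrable_r _ _ R mu _ _ _ (fun r => 2 * `|g r| ^+ 2 + 2 * `|x| ^+ 2)) => //.
- by apply: measurable_funTS; apply: measurable_funX; exact: mg.
- move=> r _; rewrite ger0_norm ?sqr_ge0//.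
  exact: sqr_normB_le.
apply: integrable_rD => //; last exact: integrable_cst_itvoc.
exact: integrable_rZ.
Qed.

Lemma sq_integrable_norm T g x : sq_integrable T g ->
  mu.-integrable `]0, T] (EFin \o (fun r => `|g r - x|)).
Proof.
move=> hg.
apply: (@le_integrable_r _ _ R mu _ _ _ (fun r => `|g r - x| ^+ 2 + 1)) => //.
- by apply: measurable_funTS; case: hg => mg _; exact: mg.
- by move=> r _; rewrite normr_id; have := sqr_ge0 (`|g r - x| - 1); nra.
apply: integrable_rD => //; first exact: sq_integrable_shift.
exact: integrable_cst_itvoc.
Qed.

Lemma sq_integrable_dot T g e : sq_integrable T g ->
  mu.-integrable `]0, T] (EFin \o (fun r => dot e (g r))).
Proof.
move=> hg.
apply: (@le_integrable_r _ _ R mu _ _ _ (fun r => `|e| * `|g r - 0|)) => //.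
- by apply: measurable_funTS; apply: scalar_measurable_dot; case: hg.
- by move=> r _; rewrite subr0 (ler_norm_dot hdot).
exact/integrable_rZ/sq_integrable_norm.
Qed.

Lemma sub_itvoc (s t T : R) : 0 <= s -> t <= T -> `]s, t] `<=` `]0, T].
Proof.
move=> s0 tT r /=; rewrite !in_itv/= => /andP[sr rt].
by rewrite (le_lt_trans s0)// (le_trans rt).
Qed.

Lemma integrable_itvocS (s t T : R) (f : R -> \bar R) : 0 <= s -> t <= T ->
  mu.-integrable `]0, T] f -> mu.-integrable `]s, t] f.
Proof. by move=> s0 tT; apply: integrableS => //; exact: sub_itvoc. Qed.

Lemma Rintegral_itvocD (a b c : R) (f : R -> R) : a <= b -> b <= c ->
  mu.-integrable `]a, c] (EFin \o f) ->
  \int[mu]_(r in `]a, c]) f r =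
  \int[mu]_(r in `]a, b]) f r + \int[mu]_(r in `]b, c]) f r.
Proof.
move=> ab bc fi; rewrite -(@Rintegral_itvB _ f (BRight a) (BRight c) b)//.
by rewrite addrC subrK.
Qed.

(* Testing [u' = g] against vectors avoids a vector-valued integral. *)
Definition weak_primitive (T : R) (g u : R -> H) : Prop :=
  forall e s t, 0 <= s -> s <= t -> t <= T ->
    dot e (u t - u s) = \int[mu]_(r in `]s, t]) dot e (g r).

(** Testing with the vector [u t - u s - (t - s) x] itself and dividing by its norm gives the bound
    that a vector-valued integral would give. The free vector [x] prepares Lebesgue differentiation,
    where it approximates the value of [g] at a point. *)
Lemma weak_primitive_le T g u : sq_integrable T g -> weak_primitive T g u ->
  forall x s t, 0 <= s -> s <= t -> t <= T ->
    `|u t - u s - (t - s) *: x| <= \int[mu]_(r in `]s, t]) `|g r - x|.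
Proof.
move=> hg hu x s t s0 st tT.
set e := u t - u s - (t - s) *: x.
have idot := integrable_itvocS s0 tT (sq_integrable_dot e hg).
have inor := integrable_itvocS s0 tT (sq_integrable_norm x hg).
have [->|e0] := eqVneq e 0.
  by rewrite normr0; apply: Rintegral_ge0.
rewrite -(@ler_pM2l _ `|e|) ?normr_gt0// -expr2 -hdot {2}/e dotBr hu// dotZr.
rewrite mulrC -Rintegral_cst_itvoc// -RintegralB//; last first.
  exact: integrable_cst_itvoc.
rewrite -RintegralZl//; apply: le_Rintegral => //.
- by apply: integrable_rB => //; exact: integrable_cst_itvoc.
- exact: integrable_rZ.
by move=> r _; rewrite -dotBr (dot_le hdot).
Qed.

End WeakPrimitive.

Section DifferenceQuotient.
Context {R : realType} {V : normedModType R}.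

Lemma cvg_diff_quot_derivable (u : R -> V) (t : R) (v : V) :
  h^-1 *: (u (h + t) - u t) @[h --> 0^'] --> v ->
  derivable u t 1 /\ derive1 u t = v.
Proof.
move=> uv; split; last exact: cvg_lim.
apply/cvg_ex; exists v.
suff -> : (fun h : R => h^-1 *: ((u \o shift t) (h *: 1) - u t)) =
  (fun h => h^-1 *: (u (h + t) - u t)) by [].
by apply/funext => h /=; rewrite -[h *: 1]/(h * 1) mulr1.
Qed.

Lemma derivable_cvg_diff_quot (u : R -> V) (t : R) : derivable u t 1 ->
  h^-1 *: (u (h + t) - u t) @[h --> 0^'] --> derive1 u t.
Proof.
rewrite /derivable /derive1 => du.
suff <- : (fun h : R => h^-1 *: ((u \o shift t) (h *: 1) - u t)) =
  (fun h => h^-1 *: (u (h + t) - u t)) by [].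
by apply/funext => h /=; rewrite -[h *: 1]/(h * 1) mulr1.
Qed.

End DifferenceQuotient.

Lemma separable_dense_seq {R : realType} {V : normedModType R} : separable V ->
  exists x : nat -> V, forall y (e : R), 0 < e -> exists n, `|x n - y| < e.
Proof.
move=> [D /pcard_surjP[x xD] dD]; exists x => y e e0.
have [||z [yz Dz]] := dD (ball y e).
- by exists y; exact: ballxx.
- exact: ball_open.
have [n _ xz] := xD _ Dz.
by exists n; rewrite xz -normrN opprB; move: yz; rewrite /= -ball_normE.
Qed.

Section WeakPrimitiveRegularity.
Context {R : realType} {H : completeNormedModType R}.
Variable dot : {dot H for idfun}.
Hypothesis hdot : induces_norm dot.
Local Notation mu := (@lebesgue_measure R).
Variables (T : R) (g u : R -> H).
Hypotheses (hg : sq_integrable T g) (gu : weak_primitive dot T g u).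

Lemma weak_primitive_abs_continuous : abs_continuous 0 T u.
Proof.
move=> e e0.
have ig := sq_integrable_shift hdot 0 hg.
pose M := \int[mu]_(r in `]0, T]) `|g r - 0| ^+ 2.
have M0 : 0 <= M by apply: Rintegral_ge0.
(* Young's inequality [z <= l/2 z^2 + 1/(2l)] separates energy and length: this [l] keeps the energy
   part below [e/2], and total length below [e l] does the same for the other part. *)
pose l := e / (M + 1).
have M1 : 0 < M + 1 by rewrite ltr_wpDl.
have l0 : 0 < l by rewrite divr_gt0.
exists (e * l); first by rewrite mulr_gt0.
move=> n x y xy tI len.
have incr i : `|u (y i) - u (x i)| <=
    l / 2 * \int[mu]_(r in `]x i, y i]) `|g r - 0| ^+ 2 + (2 * l)^-1 * (y i - x i).
  have [/andP[x0 xy1] yT] := xy i.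
  have := weak_primitive_le hdot hg gu 0 x0 xy1 yT.
  rewrite scaler0 subr0 => /le_trans; apply.
  rewrite -(Rintegral_cst_itvoc _ xy1) -RintegralZl//; last exact: integrable_itvocS ig.
  rewrite -RintegralD//; last 2 first.
  - by apply: integrable_rZ => //; exact: integrable_itvocS ig.
  - exact: integrable_cst_itvoc.
  apply: le_Rintegral => //.
  - by apply: (integrable_itvocS x0 yT); exact: sq_integrable_norm.
  - apply: integrable_rD => //; last exact: integrable_cst_itvoc.
    by apply: integrable_rZ => //; exact: integrable_itvocS ig.
  move=> r _; set z := `|_|; rewrite -subr_ge0.
  have -> : l / 2 * z ^+ 2 + (2 * l)^-1 - z = (l * z - 1) ^+ 2 / (2 * l).
    by field; rewrite gt_eqF.
  by rewrite divr_ge0 ?sqr_ge0// mulr_ge0// ltW.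
apply: (le_lt_trans (ler_sum _ (fun i _ => incr i))).
rewrite big_split/= -!mulr_sumr.
have tI' : trivIset [set` enum 'I_n] (fun i => `]x i, y i[%classic).
  exact: sub_trivIset tI.
have mg2 : measurable_fun [set: R] (fun r => (`|g r - 0| ^+ 2)%:E).
  by apply/measurable_EFinP; apply: measurable_funX; case: hg => /(_ 0).
have sumM : \sum_(i < n) \int[mu]_(r in `]x i, y i]) `|g r - 0| ^+ 2 <= M.
  rewrite -lee_fin -sumEFin.
  have -> : (\sum_(i < n) (\int[mu]_(r in `](x i), (y i)]) `|g r - 0| ^+ 2)%:E =
     \sum_(i <- enum 'I_n) \int[mu]_(r in `](x i), (y i)[) (`|g r - 0| ^+ 2)%:E)%E.
    rewrite big_enum/=; apply: eq_bigr => i _.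
    have [/andP[x0 xy1] yT] := xy i.
    rewrite /Rintegral fineK; last first.
      by apply: integrable_fin_num => //; exact: integrable_itvocS ig.
    by rewrite -integral_itv_bndo_bndc//; exact: measurable_funTS.
  rewrite -ge0_integral_bigsetU//; [|exact: enum_uniq|exact: measurable_funTS].
  rewrite /M /Rintegral fineK; last exact: integrable_fin_num.
  apply: ge0_subset_integral => //.
  - by apply: bigsetU_measurable => i _.
  - exact: measurable_funTS.
  move=> r; rewrite -bigcup_seq => -[i _].
  have [/andP[x0 xy1] yT] := xy i.
  rewrite /= !in_itv/= => /andP[xr ry].
  by rewrite (le_lt_trans x0 xr) (le_trans (ltW ry) yT).
have S2 : (2 * l)^-1 * (\sum_(i < n) (y i - x i)) < e / 2.
  have -> : e / 2 = (2 * l)^-1 * (e * l) by field; rewrite gt_eqF.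
  by rewrite ltr_pM2l// invr_gt0 mulr_gt0.
have S1 : l / 2 * (\sum_(i < n) \int[mu]_(r in `]x i, y i]) `|g r - 0| ^+ 2) <= e / 2.
  apply: (@le_trans _ _ (l / 2 * (M + 1))).
    apply: ler_wpM2l; first by rewrite divr_ge0 ?(ltW l0).
    by rewrite (le_trans sumM)// lerDl.
  by rewrite /l mulrAC divfK ?gt_eqF.
by rewrite (splitr e) ler_ltD.
Qed.

(** Lebesgue differentiation for vector values, reduced to the countably many scalar functions
    [|g - x n|] with [x n] dense. At a point good for all of them, choose [x n] within [e/4] of
    [g t]: the difference quotients of [u] end up within [e/2] of [x n]. *)
Lemma weak_primitive_derivable (hsep : separable H) :
  {ae mu, forall t, t \in `]0, T[ -> derivable u t 1 /\ derive1 u t = g t}.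
Proof.
have [x xD] := separable_dense_seq hsep.
pose f n : R -> R := (fun r => `|g r - x n|) \_ `]0, T].
pose F n (y : R) := \int[mu]_(r in [set` `]-oo, y]]) f n r.
have fi n : mu.-integrable `]0, T] (EFin \o (fun r => `|g r - x n|)).
  exact: sq_integrable_norm.
have fiT n : mu.-integrable [set: R] (EFin \o f n).
  by rewrite -restrict_EFin; have := fi n; rewrite integrable_mkcond.
have : {ae mu, forall t, forall n, derivable (F n) t 1 /\ derive1 (F n) t = f n t}.
  apply: ae_foralln => n; apply: FTC1Ny.
    by move=> y; apply: integrableS (fiT n).
  exact: integrable_locally.
apply: filterS; first exact: (ae_filter_ringOfSetsType mu).
move=> t tn tT; apply: cvg_diff_quot_derivable.
apply/cvgrPdist_le => e e0.
have e4 : 0 < e / 4 by rewrite divr_gt0.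
have [n xg] := xD (g t) _ e4.
have [/derivable_cvg_diff_quot Fd Fn] := tn n.
have ft : f n t = `|g t - x n|.
  rewrite /f patchE mem_set//=; move: tT; rewrite !in_itv/= => /andP[-> /ltW ->] //.
have Fincr a b : 0 <= a -> a <= b -> b <= T ->
    F n b - F n a = \int[mu]_(r in `]a, b]) `|g r - x n|.
  move=> a0 ab bT; rewrite /F Rintegral_itvB//; last exact: integrableS (fiT n).
  by apply: eq_Rintegral => r; rewrite inE /f patchE => rab;
    rewrite mem_set//; exact: (sub_itvoc a0 bT).
have uF a b : 0 <= a -> a <= b -> b <= T ->
    `|u b - u a - (b - a) *: x n| <= F n b - F n a.
  by move=> a0 ab bT; rewrite Fincr//; exact: (weak_primitive_le hdot hg gu).
move: Fd; rewrite Fn ft => /cvgrPdist_le /(_ _ e4) Fe.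
move: tT; rewrite in_itv/= => /andP[t0 tT].
near=> h.
have h0 : h != 0 by near: h; exact: nbhs_dnbhs_neq.
have : `|h| < Num.min t (T - t).
  near: h; apply: dnbhs0_lt; rewrite lt_min t0 subr_gt0//.
rewrite lt_min => /andP[ht hT].
have Fe1 : `| `|g t - x n| - h^-1 * (F n (h + t) - F n t)| <= e / 4 by near: h; exact: Fe.
have uh : `|u (h + t) - u t - h *: x n| <= `|F n (h + t) - F n t|.
  have [hp|hn] := leP 0 h.
  - move: hT; rewrite (ger0_norm hp) => hT.
    have := @uF t (h + t) (ltW t0); rewrite lerDr hp addrK => /(_ isT).
    have -> : h + t <= T by lra.
    by move=> /(_ isT) /le_trans; apply; exact: ler_norm.
  - move: ht; rewrite (ltr0_norm hn) => ht.
    have := @uF (h + t) t; have -> : 0 <= h + t by lra.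
    have -> : h + t <= t by lra.
    rewrite (ltW tT) => /(_ isT isT isT).
    have -> : t - (h + t) = - h by ring.
    rewrite scaleNr opprK.
    have -> : u t - u (h + t) + h *: x n = - (u (h + t) - u t - h *: x n).
      by rewrite !opprB addrC.
    rewrite normrN => hu.
    by rewrite [leRHS]distrC (le_trans hu)// ler_norm.
have hx : `|h^-1 *: (u (h + t) - u t) - x n| <= `|g t - x n| + e / 4.
  have -> : h^-1 *: (u (h + t) - u t) - x n = h^-1 *: (u (h + t) - u t - h *: x n).
    by rewrite [in RHS]scalerBr scalerA mulVf// scale1r.
  rewrite normrZ (le_trans (ler_wpM2l _ uh))// -normrM.
  have := ler_normD (h^-1 * (F n (h + t) - F n t) - `|g t - x n|) `|g t - x n|.
  rewrite subrK normr_id => /le_trans; apply.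
  by rewrite addrC lerD2l distrC.
have := ler_normD (g t - x n) (x n - h^-1 *: (u (h + t) - u t)).
rewrite addrA subrK => /le_trans; apply.
rewrite [X in _ + X]distrC.
move: xg hx e0; rewrite [`|x n - _|]distrC; lra.
Unshelve. all: by end_near. Qed.

End WeakPrimitiveRegularity.

(** * Borel measurability, the L2 norm of the definitions, and membership in H1 *)

Section SobolevRegularity.
Context {R : realType} {H : completeNormedModType R}.
Local Notation mu := (@lebesgue_measure R).

(** In a separable space an open set is the union of the balls it contains with centre in a dense
    sequence and radius [1/(k+1)]: there are countably many, and their preimages are sublevels of
    distances. *)
Lemma scalar_measurable_borel (hsep : separable H) (g : R -> H) (D : set R) :
  scalar_measurable g -> measurable D ->
  measurable_fun D (g : R -> g_sigma_algebraType (@open H)).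
Proof.
move=> mg mD.
have mE : (@measurable _ (g_sigma_algebraType (@open H))) = <<s @open H >> by [].
refine (@measurability _ _ _ (g_sigma_algebraType (@open H)) D g (@open H) mE _).
move=> _ [U oU <-]; apply: measurableI => //.
have [x xD] := separable_dense_seq hsep.
have -> : g @^-1` U = \bigcup_n \bigcup_(k in [set k : nat |
      ball (x n) (k.+1%:R^-1 : R) `<=` U]) [set r | `|g r - x n| < k.+1%:R^-1].
  apply/seteqP; split=> [r /= Ur|r [n _ [k /= nU gx]]]; last first.
    by apply: nU; rewrite -ball_normE /= distrC.
  move: oU; rewrite openE => /(_ _ Ur); rewrite /interior -nbhs_ballE.
  move=> -[e /= e0 eU].
  have [k _ ke] := near_infty_natSinv_lt (PosNum (divr_gt0 e0 (ltr0n R 2))).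
  have /= {}ke := ke k (leqnn k).
  have [n xn] := xD (g r) k.+1%:R^-1 ltac:(by rewrite invr_gt0).
  exists n => //; exists k => /=; last by rewrite distrC.
  move=> y; rewrite -ball_normE /= => xy; apply: eU; rewrite -ball_normE /=.
  have := ler_normD (g r - x n) (x n - y); rewrite addrA subrK.
  by move=> /le_lt_trans; apply; rewrite (splitr e) ltrD// (lt_trans _ ke)// distrC.
apply: bigcupT_measurable => n; apply: bigcup_measurable => k _ /=.
have -> : [set r | `|g r - x n| < k.+1%:R^-1] =
    [set: R] `&` (fun r => `|g r - x n|) @^-1` `]-oo, k.+1%:R^-1[.
  by rewrite setTI; apply/seteqP; split => r /=; rewrite in_itv.
exact: mg.
Qed.

(* [normL2sq] integrates for the canonical Borel structure of [R], whereas
   [lebesgue_measure] lives on [measurableTypeR R]: the sigma-algebras agree but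
   the two structures are not interchangeable in [integral]. *)
Lemma ge0_integral_canonical (D : set R) (f : R -> \bar R) :
  measurable D -> measurable_fun D f -> (forall r, D r -> 0 <= f r)%E ->
  integral (mu : set R -> \bar R) D f = (\int[mu]_(r in D) f r)%E.
Proof.
move=> mD mf f0.
have mid : measurable_fun [set: measurableTypeR R] (id : measurableTypeR R -> R).
  by move=> _ A mA; rewrite setTI.
have := @ge0_integral_pushforward _ _ _ _ R _ mid mu D f mD mf.
by apply => r /[!inE]; exact: f0.
Qed.

(** Read off the definition of the integral as a supremum over simple functions. This form covers
    derivatives, which are only known to agree almost everywhere with a measurable function. *)
Let le_canonical (D : set R) (f g : R -> \bar R) :
  (forall r, D r -> 0 <= f r <= g r)%E ->
  (integral (mu : set R -> \bar R) D f <= integral (mu : set R -> \bar R) D g)%E.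
Proof.
move=> fg.
have g0 r : D r -> (0 <= g r)%E by move=> /fg /andP[/le_trans]; apply.
have f0 r : D r -> (0 <= f r)%E by move=> /fg /andP[].
rewrite /integral !funeneg_restrict !funepos_restrict.
have /eq_restrictP -> := ge0_funeposE f0; have /eq_restrictP -> := ge0_funenegE f0.
have /eq_restrictP -> := ge0_funeposE g0; have /eq_restrictP -> := ge0_funenegE g0.
apply: leeB => //; apply: le_ereal_sup => _ [h /= hf <-]; exists h => // r.
apply: (le_trans (hf r)); rewrite !patchE; case: ifP => // /set_mem Dr.
by have /andP[] := fg _ Dr.
Qed.

Lemma ge0_le_integral_canonical (D : set R) (f g : R -> \bar R) :
  measurable D -> measurable_fun D g -> (forall r, D r -> 0 <= f r <= g r)%E ->
  (integral (mu : set R -> \bar R) D f <= \int[mu]_(r in D) g r)%E.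
Proof.
move=> mD mg fg; rewrite -ge0_integral_canonical//; first exact: le_canonical.
by move=> r /fg /andP[/le_trans]; apply.
Qed.

Lemma normL2sq_ge0 (T : R) (z : R -> H) : (0 <= normL2sq T z)%E.
Proof.
have mD : measurable (`]0, T[%classic : set R) by exact: measurable_itv.
have z0 r : `]0, T[%classic r -> (0 <= (cst 0%E : R -> \bar R) r <= (`|z r| ^+ 2)%:E)%E.
  by move=> _; rewrite lexx lee_fin sqr_ge0.
have := le_canonical z0; apply: le_trans; rewrite ge0_integral_canonical//.
by rewrite integral0.
Qed.

Lemma normL2sq_ext (T : R) (z w : R -> H) :
  (forall s, 0 < s -> s < T -> z s = w s) -> normL2sq T z = normL2sq T w.
Proof.
move=> zw; apply/le_anti/andP; split; apply: le_canonical => r /=;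
  by rewrite in_itv /= => /andP[r0 rT]; rewrite zw// lexx lee_fin sqr_ge0.
Qed.

Lemma normL2sq_itvoc (T : R) (g : R -> H) : scalar_measurable g ->
  normL2sq T g = (\int[mu]_(r in `]0%R, T]) (`|g r| ^+ 2)%:E)%E.
Proof.
move=> mg.
have mg2 D : measurable_fun D (fun r => (`|g r| ^+ 2)%:E).
  apply: measurable_funTS; apply/measurable_EFinP; apply: measurable_funX.
  exact: scalar_measurable_norm.
rewrite -integral_itv_bndo_bndc//.
by apply: ge0_integral_canonical => // r _; rewrite lee_fin sqr_ge0.
Qed.

Lemma weak_primitive_inH1 (dot : {dot H for idfun}) (T : R) (g u : R -> H) :
  induces_norm dot -> separable H ->
  sq_integrable T g -> weak_primitive dot T g u -> inH1 T u.
Proof.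
move=> hdot hsep hg gu; have ae_u := weak_primitive_derivable hdot hg gu hsep.
split; first exact: (weak_primitive_abs_continuous hdot hg gu).
  move: ae_u; apply: filterS; first exact: (ae_filter_ringOfSetsType mu).
  by move=> t ut /ut[].
exists g; split.
- by apply: scalar_measurable_borel => //; case: hg.
- move: ae_u; apply: filterS; first exact: (ae_filter_ringOfSetsType mu).
  by move=> t ut /ut[].
- by case: hg => mg; rewrite normL2sq_itvoc.
Qed.

End SobolevRegularity.

(** * Fast convergence in L2 *)

Section SummableSquares.
Context d (X : measurableType d) (R : realType).
Variables (m : {measure set X -> \bar R}) (D : set X).
Hypothesis mD : measurable D.

(** The factor [4^-k] pays for the weights [4^k] of the majorant below; the factors [2^-(k+1)] sum
    to 1. *)
Definition summable_rate (k : nat) : R := (2 ^ k.+1)%:R^-1 / 4 ^+ k.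

Lemma summable_rate_gt0 k : 0 < summable_rate k.
Proof. by rewrite divr_gt0 ?invr_gt0 ?ltr0n ?expn_gt0// exprn_gt0. Qed.

(* The series [\sum_k 4 ^ k * a_k ^ 2] dominates every term, so that it controls
   the sequence [a_k] at all points where it converges. *)
Lemma summable_squares_majorant (a : nat -> X -> R) :
  (forall k, measurable_fun D (a k)) ->
  (forall k, \int[m]_(x in D) (a k x ^+ 2)%:E <= (summable_rate k)%:E)%E ->
  exists E : X -> \bar R,
    [/\ measurable_fun D E, (forall x, 0 <= E x)%E,
        (\int[m]_(x in D) E x <= 1%:E)%E
      & forall k x, ((4 ^+ k * a k x ^+ 2)%:E <= E x)%E].
Proof.
move=> ma inta.
pose f k x := (4 ^+ k * a k x ^+ 2)%:E.
have f0 k x : (0 <= f k x)%E by rewrite lee_fin mulr_ge0 ?sqr_ge0// exprn_ge0.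
have mf k : measurable_fun D (f k).
  by apply/measurable_EFinP; apply: measurable_funM => //; apply: measurable_funX.
exists (fun x => \sum_(k <oo) f k x)%E; split.
- by apply: ge0_emeasurable_sum.
- by move=> x; exact: nneseries_ge0.
- rewrite integral_nneseries//; apply: (@le_trans _ _
    (\sum_(k <oo) (1 / (2 ^ k.+1)%:R)%:E)%E); last exact: epsilon_trick0.
  apply: lee_nneseries => [k _ _|k _]; first exact: integral_ge0.
  rewrite /f; under eq_integral do rewrite EFinM.
  rewrite ge0_integralZl//; last 2 first.
  + by apply/measurable_EFinP; apply: measurable_funX.
  + by move=> x _; rewrite lee_fin sqr_ge0.
  apply: (@le_trans _ _ ((4 ^+ k)%:E * (summable_rate k)%:E)%E).
    by apply: lee_wpmul2l => //; rewrite lee_fin exprn_ge0.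
  by rewrite -EFinM lee_fin /summable_rate mulrCA mulfV ?mulr1 ?mul1r// expf_neq0.
- move=> k x; apply: (@le_trans _ _ (\sum_(0 <= i < k.+1) f i x)%E).
    by rewrite big_nat_recr//= leeDr// sume_ge0.
  by apply: nneseries_lim_ge => *; exact: f0.
Qed.

End SummableSquares.

Lemma geometric_cauchy_cvg {R : realType} {V : completeNormedModType R}
    (w : nat -> V) (S : R) :
  (forall k, `|w k.+1 - w k| <= S / 2 ^+ k) ->
  exists2 l, w k @[k --> \oo] --> l & forall k, `|w k - l| <= 2 * S / 2 ^+ k.
Proof.
move=> wS.
have S0 : 0 <= S by have := wS 0%N; rewrite expr0 divr1; apply: le_trans.
(* The subtracted remainder is what makes the induction on [j] close. *)
have wkj k j : `|w (k + j)%N - w k| <= 2 * S / 2 ^+ k - 2 * S / 2 ^+ (k + j).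
  elim: j => [|j IH]; first by rewrite addn0 !subrr normr0.
  rewrite addnS.
  have := ler_normD (w (k + j).+1 - w (k + j)%N) (w (k + j)%N - w k).
  rewrite addrA subrK => /le_trans; apply.
  apply: (le_trans (lerD (wS _) IH)).
  rewrite addrCA lerD2l exprS le_eqVlt; apply/orP; left; apply/eqP.
  by field; rewrite expf_neq0.
have wkm k m : (k <= m)%N -> `|w m - w k| <= 2 * S / 2 ^+ k.
  move=> km; have := wkj k (m - k)%N; rewrite subnKC// => /le_trans; apply.
  by rewrite gerBl divr_ge0 ?exprn_ge0// mulr_ge0.
have small e : 0 < e -> exists k, 2 * S / 2 ^+ k < e.
  move=> e0; have := @cvg_geometric R (2 * S) 2^-1.
  have h2 : `|2^-1 : R| < 1 by rewrite ger0_norm// invf_lt1// ltr1n.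
  move=> /(_ h2) /cvgrPdist_lt /(_ _ e0) [k _ /(_ k (leqnn k))] /=.
  rewrite sub0r normrN /geometric /= exprVn ger0_norm; first by exists k.
  by rewrite divr_ge0 ?exprn_ge0// mulr_ge0.
have cw : cauchy (w k @[k --> \oo]).
  apply: cauchy_exP => e e0; have [k ke] := small e e0; exists (w k).
  exists k => // m /= km; rewrite -ball_normE /= distrC.
  exact: le_lt_trans (wkm _ _ km) ke.
have /cauchy_cvgP/cvg_ex[l wl] := cw.
exists l => // k; apply/ler_addgt0Pr => e e0.
move/cvgrPdist_le : wl => /(_ _ e0) [m _ /(_ (maxn m k) (leq_maxl _ _))] /= lm.
have := ler_normD (w k - w (maxn m k)) (w (maxn m k) - l).
rewrite addrA subrK => /le_trans; apply; apply: lerD; last by rewrite distrC.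
by rewrite distrC wkm// leq_maxr.
Qed.

Section L2Limit.
Context {R : realType} {H : completeNormedModType R}.
Local Notation mu := (@lebesgue_measure R).

(** Where the majorant [E] is finite, consecutive terms differ by at most [sqrt E / 2^k]; so the
    limit exists there and [|w k - g|^2 <= 4 E / 4^k], and the integral of [E] is at most 1.
    Elsewhere, on a null part of []0, T]] and outside it, [g] is set to 0. *)
Lemma L2_fast_limit (T : R) (w : nat -> R -> H) :
  (forall k, scalar_measurable (w k)) ->
  (forall j k, measurable_fun [set: R] (fun r => `|w j r - w k r|)) ->
  (forall k, \int[mu]_(r in `]0%R, T]) (`|w k.+1 r - w k r| ^+ 2)%:E <=
             (summable_rate R k)%:E)%E ->
  exists g : R -> H,
    [/\ scalar_measurable g,
        {ae mu, forall r, r \in `]0, T] -> w k r @[k --> \oo] --> g r},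
        forall k, measurable_fun [set: R] (fun r => `|w k r - g r|)
      & forall k, (\int[mu]_(r in `]0%R, T]) (`|w k r - g r| ^+ 2)%:E <=
                   (4 / 4 ^+ k)%:E)%E].
Proof.
move=> mw mww wrate.
have mww1 k : measurable_fun `]0, T]%classic (fun r => `|w k.+1 r - w k r|).
  exact: measurable_funTS.
have [E [mE E0 E1 wE]] :=
  @summable_squares_majorant _ _ _ mu _ (measurable_itv `]0, T]) _ mww1 wrate.
pose A := `]0, T]%classic `&` [set r | (E r < +oo)%E].
have mA : measurable A by exact: emeasurable_fun_infty_o.
have mbA : measurable_fun [set: R] (fun r => r \in A).
  apply: (measurable_fun_bool true); rewrite setTI.
  by rewrite (_ : _ @^-1` _ = A)//; apply/seteqP; split => r /= => [/set_mem|/mem_set].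
have limA r : A r -> exists l, w k r @[k --> \oo] --> l /\
    forall k, `|w k r - l| <= 2 * Num.sqrt (fine (E r)) / 2 ^+ k.
  move=> [_ /= Er].
  have Efin : E r \is a fin_num by rewrite ge0_fin_numE.
  have [|l wl lw] := @geometric_cauchy_cvg _ _ (w ^~ r) (Num.sqrt (fine (E r))).
    move=> k; rewrite ler_pdivlMr ?exprn_gt0//.
    rewrite -[leLHS]ger0_norm ?mulr_ge0 ?exprn_ge0// -sqrtr_sqr ler_wsqrtr//.
    rewrite -lee_fin fineK// exprMn -exprM mulnC exprM mulrC.
    by rewrite (_ : 2 ^+ 2 = 4) ?wE// -natrX.
  by exists l; split.
pose g r := if r \in A then lim (w k r @[k --> \oo]) else 0.
have gA r : A r -> w k r @[k --> \oo] --> g r /\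
    forall k, `|w k r - g r| <= 2 * Num.sqrt (fine (E r)) / 2 ^+ k.
  move=> Ar; have [l [wl lw]] := limA r Ar.
  by rewrite /g mem_set// (cvg_lim _ wl).
have gN r : ~ A r -> g r = 0 by move=> nAr; rewrite /g memNset.
have wg r y : A r -> `|w k r - y| @[k --> \oo] --> `|g r - y|.
  move=> /gA[wl _]; apply: cvg_norm; apply: cvgB => //; exact: cvg_cst.
have mwg k : measurable_fun [set: R] (fun r => `|w k r - g r|).
  apply: (@measurable_fun_cvg _ _ _ _
    (fun j r => if r \in A then `|w k r - w j r| else `|w k r - 0|)).
    by move=> j; apply: measurable_fun_ifT => //; exact: mw.
  move=> r _; have [/set_mem Ar|/negP nAr] := boolP (r \in A).
    rewrite distrC; under eq_fun do rewrite distrC.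
    exact: wg.
  by rewrite gN; [exact: cvg_cst|move/mem_set].
exists g; split.
- move=> x; apply: (@measurable_fun_cvg _ _ _ _
    (fun k r => if r \in A then `|w k r - x| else `|0 - x|)).
    by move=> k; apply: measurable_fun_ifT => //; exact: mw.
  move=> r _; have [/set_mem Ar|/negP nAr] := boolP (r \in A).
    exact: wg.
  by rewrite gN; [exact: cvg_cst|move/mem_set].
- have iE : mu.-integrable `]0, T] E.
    apply/integrableP; split => //; rewrite (eq_integral E); last first.
      by move=> r _; rewrite gee0_abs.
    by rewrite (le_lt_trans E1)// ltry.
  have : {ae mu, forall r, r \in `]0, T] -> E r \is a fin_num}.
    exact: (@integrable_ae _ _ _ mu `]0, T]%classic (measurable_itv _) _ iE).
  apply: filterS; first exact: (ae_filter_ringOfSetsType mu).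
  move=> r Er rT; have [] // := gA r; split => //=.
  by have := Er rT; rewrite ge0_fin_numE.
- exact: mwg.
move=> k; apply: (@le_trans _ _
    (\int[mu]_(r in `]0%R, T]) ((4 / 4 ^+ k)%:E * E r))%E); last first.
  rewrite ge0_integralZl//.
  by rewrite -[leRHS]mule1 lee_wpmul2l// lee_fin divr_ge0 ?exprn_ge0.
have k4 : 0 < 4 / 4 ^+ k :> R by rewrite divr_gt0 ?exprn_gt0.
apply: ge0_le_integral => //.
- by apply/measurable_EFinP/measurable_funTS; apply: measurable_funX; exact: mwg.
- exact: measurable_funeM.
move=> r rT; have [Er|] := ltP (E r) +oo%E; last first.
  by rewrite leye_eq => /eqP ->; rewrite gt0_muley ?lte_fin// leey.
have [//|_ /(_ k) wgr] := gA r.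
have Efin : E r \is a fin_num by rewrite ge0_fin_numE.
rewrite -(fineK Efin) -EFinM lee_fin.
have E0r : 0 <= fine (E r) by rewrite fine_ge0.
apply: (@le_trans _ _ ((2 * Num.sqrt (fine (E r)) / 2 ^+ k) ^+ 2)).
  by rewrite ler_sqr ?nnegrE// divr_ge0 ?exprn_ge0// mulr_ge0// sqrtr_ge0.
rewrite !exprMn sqr_sqrtr// exprVn -exprM mulnC exprM.
rewrite (_ : 2 ^+ 2 = 4); last by rewrite -natrX.
by rewrite mulrAC.
Qed.
End L2Limit.

Lemma ler_add_sqr_div {R : realFieldType} (d x : R) :
  0 < d -> x <= d + d^-1 * x ^+ 2.
Proof.
move=> d0; rewrite -subr_ge0.
have -> : d + d^-1 * x ^+ 2 - x = ((d - x / 2) ^+ 2 + 3 / 4 * x ^+ 2) / d.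
  by field; rewrite gt_eqF.
by rewrite divr_ge0 ?(ltW d0)// addr_ge0 ?sqr_ge0// mulr_ge0 ?sqr_ge0.
Qed.

Section WeakPrimitiveLimit.
Context {R : realType} {H : completeNormedModType R}.
Variable dot : {dot H for idfun}.
Hypothesis hdot : induces_norm dot.
Local Notation mu := (@lebesgue_measure R).

Lemma integrable_sq_dist (T c : R) (f : R -> R) :
  measurable_fun [set: R] f ->
  (\int[mu]_(r in `]0%R, T]) (f r ^+ 2)%:E <= c%:E)%E ->
  mu.-integrable `]0, T] (EFin \o (fun r => f r ^+ 2)).
Proof.
move=> mf fc; apply/integrableP; split.
  by apply/measurable_EFinP/measurable_funTS; apply: measurable_funX.
under eq_integral do rewrite /= ger0_norm ?sqr_ge0//.
by rewrite (le_lt_trans fc)// ltry.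
Qed.

Lemma Rintegral_sq_le (T c : R) (f : R -> R) :
  measurable_fun [set: R] f ->
  (\int[mu]_(r in `]0%R, T]) (f r ^+ 2)%:E <= c%:E)%E ->
  \int[mu]_(r in `]0, T]) (f r ^+ 2) <= c.
Proof.
move=> mf fc; rewrite -lee_fin /Rintegral fineK//.
by apply: integrable_fin_num => //; exact: integrable_sq_dist fc.
Qed.

Lemma sq_integrable_near (T c : R) (w g : R -> H) :
  sq_integrable T w -> scalar_measurable g ->
  measurable_fun [set: R] (fun r => `|w r - g r|) ->
  (\int[mu]_(r in `]0%R, T]) (`|w r - g r| ^+ 2)%:E <= c%:E)%E ->
  sq_integrable T g.
Proof.
move=> hw mg mwg wgc; split => //.
have iw := sq_integrable_shift hdot 0 hw.
have iwg := integrable_sq_dist mwg wgc.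
have : mu.-integrable `]0, T] (EFin \o (fun r => `|g r| ^+ 2)).
  apply: (@le_integrable_r _ _ R mu _ _ _
    (fun r => 2 * `|w r - g r| ^+ 2 + 2 * `|w r - 0| ^+ 2)) => //.
  - apply: measurable_funTS; apply: measurable_funX.
    exact: scalar_measurable_norm.
  - move=> r _; rewrite ger0_norm ?sqr_ge0// subr0.
    have := sqr_normB_le hdot (w r) (w r - g r).
    by rewrite opprB addrCA subrr addr0 addrC.
  apply: integrable_rD => //; exact: integrable_rZ.
move=> /integrableP[_]; under eq_integral do rewrite /= ger0_norm ?sqr_ge0//.
by [].
Qed.

Lemma weak_primitive_limit (T : R) (w v : nat -> R -> H) (g u : R -> H)
    (c : nat -> R) :
  (forall k, sq_integrable T (w k)) -> sq_integrable T g ->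
  (forall k, measurable_fun [set: R] (fun r => `|w k r - g r|)) ->
  (forall k, \int[mu]_(r in `]0%R, T]) (`|w k r - g r| ^+ 2)%:E <= (c k)%:E)%E ->
  c k @[k --> \oo] --> 0 ->
  (forall k, weak_primitive dot T (w k) (v k)) ->
  (forall t, 0 <= t <= T -> v k t @[k --> \oo] --> u t) ->
  weak_primitive dot T g u.
Proof.
move=> hw hg mwg wgc c0 wv vu e s t s0 st tT.
have T0 : 0 <= T by rewrite (le_trans s0)// (le_trans st).
have T1 : 0 < T + 1 by rewrite ltr_wpDl.
have e1 : 0 < `|e| + 1 by rewrite ltr_wpDl.
have dvu : dot e (v k t - v k s) @[k --> \oo] --> dot e (u t - u s).
  apply: (@cvg_comp _ _ _ _ (dot e)); last exact: (continuous_dot hdot).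
  by apply: cvgB; apply: vu; rewrite ?s0 ?tT ?(le_trans s0 st) ?(le_trans st tT).
have igd k : mu.-integrable `]0, T] (EFin \o (fun r => dot e (w k r))).
  exact: sq_integrable_dot.
have ig := sq_integrable_dot hdot e hg.
suff : dot e (v k t - v k s) @[k --> \oo] --> \int[mu]_(r in `]s, t]) dot e (g r).
  by move=> /(cvg_unique (@Rhausdorff R) dvu).
apply/cvgrPdist_le => eps eps0.
(* By [ler_add_sqr_div], an L1 distance is at most [d] times the length plus [1/d] times the squared
   L2 distance. This [d] gives half of [eps] to the first term; the rate [c k] makes the second one
   small afterwards. *)
have [d dE] : exists d, d = eps / 2 / (`|e| + 1) / (T + 1) by eexists.
have d0 : 0 < d by rewrite dE !divr_gt0.
have cb0 : 0 < eps / 2 / (`|e| + 1) * d by rewrite mulr_gt0// !divr_gt0.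
move/cvgrPdist_le : c0 => /(_ _ cb0); apply: filterS => k ck.
rewrite (wv k) // -RintegralB//; [|exact: integrable_itvocS ig|exact: integrable_itvocS (igd k)].
have iwg := integrable_sq_dist (mwg k) (wgc k).
have ib : mu.-integrable `]0, T]
    (EFin \o (fun r => `|e| * (d + d^-1 * `|w k r - g r| ^+ 2))).
  apply: integrable_rZ => //; apply: integrable_rD => //.
    exact: integrable_cst_itvoc.
  exact: integrable_rZ.
apply: (le_trans (le_normr_Rintegral _ _)) => //.
  by apply: integrable_rB => //; [exact: integrable_itvocS ig|exact: integrable_itvocS (igd k)].
apply: (@le_trans _ _ (\int[mu]_(r in `]s, t]) (`|e| * (d + d^-1 * `|w k r - g r| ^+ 2)))).
  apply: le_Rintegral => //.
  - apply: integrable_norm; apply: integrable_rB => //.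
      exact: integrable_itvocS ig.
    exact: integrable_itvocS (igd k).
  - exact: integrable_itvocS ib.
  move=> r _; rewrite -dotBr (le_trans (ler_norm_dot hdot _ _))// ler_wpM2l//.
  by rewrite distrC; exact: ler_add_sqr_div.
apply: (@le_trans _ _ (\int[mu]_(r in `]0, T]) (`|e| * (d + d^-1 * `|w k r - g r| ^+ 2)))).
  rewrite -lee_fin /Rintegral !fineK; last 2 first.
  - by apply: integrable_fin_num.
  - by apply: integrable_fin_num => //; exact: integrable_itvocS ib.
  apply: ge0_subset_integral => //.
  - by case/integrableP : ib.
  - move=> r _; rewrite lee_fin mulr_ge0// addr_ge0 ?(ltW d0)// mulr_ge0 ?sqr_ge0//.
    by rewrite invr_ge0 ltW.
  - exact: sub_itvoc.
rewrite RintegralZl//; last first.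
  by apply: integrable_rD => //; [exact: integrable_cst_itvoc|exact: integrable_rZ].
rewrite RintegralD//; [|exact: integrable_cst_itvoc|exact: integrable_rZ].
rewrite RintegralZl// Rintegral_cst_itvoc// subr0.
have Ile := Rintegral_sq_le (mwg k) (wgc k).
move: ck; rewrite sub0r normrN => ck.
have {}Ile := le_trans Ile (le_trans (ler_norm _) ck).
have -> : eps = (`|e| + 1) * (eps / 2 / (`|e| + 1) + eps / 2 / (`|e| + 1)).
  by field; rewrite gt_eqF.
apply: ler_pM => //.
- rewrite addr_ge0// ?mulr_ge0// ?invr_ge0 ?(ltW d0)//.
  by apply: Rintegral_ge0 => r _; rewrite sqr_ge0.
- by rewrite lerDl.
apply: lerD.
  have : 0 < eps / 2 / (`|e| + 1) by rewrite !divr_gt0.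
  rewrite dE; move: (eps / 2 / _) => X X0.
  by rewrite -[X / _ * T]mulrA ler_piMr ?(ltW X0)// ler_pdivrMl// mulr1 lerDl.
by rewrite mulrC ler_pdivrMr.
Qed.

End WeakPrimitiveLimit.

(** * Partitions *)

Section CountablyValued.
Context {R : realType}.
Local Notation mu := (@lebesgue_measure R).

Lemma measurable_fun_nat_index (a : R -> nat) (f : nat -> R -> R) :
  measurable_fun [set: R] a -> (forall j, measurable_fun [set: R] (f j)) ->
  measurable_fun [set: R] (fun r => f (a r) r).
Proof.
move=> ma mf _ B mB; rewrite setTI.
have -> : (fun r => f (a r) r) @^-1` B =
    \bigcup_j (a @^-1` [set j] `&` (f j @^-1` B)).
  apply/seteqP; split => [r fr|r [j _ [/= <- //]]]; by exists (a r).
apply: bigcupT_measurable => j; apply: measurableI.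
  by have := ma measurableT [set j]; rewrite setTI; apply.
by have := mf j measurableT B mB; rewrite setTI.
Qed.

Lemma measurable_fun_nat_index2 (a b : R -> nat) (F : nat -> nat -> R) :
  measurable_fun [set: R] a -> measurable_fun [set: R] b ->
  measurable_fun [set: R] (fun r => F (a r) (b r)).
Proof.
move=> ma mb; apply: (measurable_fun_nat_index ma (f := fun j r => F j (b r))) => j.
by apply: (measurable_fun_nat_index mb (f := fun k _ => F j k)).
Qed.

Lemma integrable_nat_index2 (A B : nat) (a b : R -> nat) (F : nat -> nat -> R)
    (s t : R) :
  measurable_fun [set: R] a -> measurable_fun [set: R] b ->
  (forall r, (a r <= A)%N) -> (forall r, (b r <= B)%N) ->
  mu.-integrable `]s, t] (EFin \o (fun r => F (a r) (b r))).
Proof.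
move=> ma mb aA bB.
apply: (@le_integrable_r _ _ R mu _ _ _
  (fun=> \sum_(j < A.+1) \sum_(k < B.+1) `|F j k|)) => //.
- by apply: measurable_funTS; exact: measurable_fun_nat_index2.
- move=> r _.
  rewrite (bigD1 (inord (a r)))//= (bigD1 (inord (b r)))//=.
  rewrite !inordK ?ltnS// -addrA lerDl addr_ge0// sumr_ge0// => j _.
  exact: sumr_ge0.
exact: integrable_cst_itvoc.
Qed.

End CountablyValued.

Section PartitionCells.
Context {R : realType}.
Local Notation mu := (@lebesgue_measure R).
Variables (T : R) (N : nat) (t : nat -> R).
Hypothesis hpart : is_partition T N t.

Lemma partition_lt i j : (i < j)%N -> (j <= N)%N -> t i < t j.
Proof.
have [_ _ tS] := hpart.
elim: j => [//|j IH]; rewrite ltnS leq_eqVlt => /orP[/eqP -> jN|ij jN].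
  exact: tS.
exact: lt_trans (IH ij (ltnW jN)) (tS _ jN).
Qed.

Lemma partition_le i j : (i <= j)%N -> (j <= N)%N -> t i <= t j.
Proof.
by rewrite leq_eqVlt => /orP[/eqP -> //|ij jN]; exact/ltW/partition_lt.
Qed.

Lemma partition_ge0 i : (i <= N)%N -> 0 <= t i.
Proof. by have [<- _ _] := hpart => iN; exact: partition_le. Qed.

Lemma partition_leT i : (i <= N)%N -> t i <= T.
Proof. by have [_ <- _] := hpart => iN; exact: partition_le. Qed.

(* The index of the cell [t_(i-1), t_i] containing [s]: it is 0 for s <= 0 and
   N for s > T. *)
Definition cell (s : R) : nat := find (fun j => s <= t j) (iota 0 N).

Lemma cell_le s : (cell s <= N)%N.
Proof. by rewrite -[leqRHS](size_iota 0 N) find_size. Qed.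

Lemma ltn_cell i s : (i < N)%N -> (i < cell s)%N = (t i < s).
Proof.
move=> iN; apply/idP/idP => [/(before_find 0%N)|].
  by rewrite nth_iota// add0n => /negbT; rewrite -ltNge.
rewrite ltNge; apply: contraR; rewrite -leqNgt => ci.
have hs : has (fun j => s <= t j) (iota 0 N).
  by rewrite has_find size_iota (leq_ltn_trans ci).
have := nth_find 0%N hs; rewrite nth_iota ?add0n; last exact: leq_ltn_trans iN.
by move=> /le_trans; apply; apply: partition_le => //; exact: ltnW.
Qed.

Lemma leq_cell i s : (i < N)%N -> (cell s <= i)%N = (s <= t i).
Proof. by move=> iN; rewrite leqNgt ltn_cell// leNgt. Qed.

Lemma cell_homo a b : a <= b -> (cell a <= cell b)%N.
Proof.
move=> ab; rewrite leqNgt; apply/negP => ba.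
have bN : (cell b < N)%N := leq_trans ba (cell_le a).
move: ba; rewrite ltn_cell// => ba.
have : (cell b <= cell b)%N by [].
by rewrite leq_cell// leNgt (lt_le_trans ba).
Qed.

Lemma cellE i s : (i < N)%N -> t i < s -> s <= t i.+1 -> cell s = i.+1.
Proof.
move=> iN ts st; apply/eqP; rewrite eqn_leq ltn_cell// ts andbT.
have [iN'|] := ltnP i.+1 N; first by rewrite leq_cell.
by move=> Ni; exact: leq_trans (cell_le s) Ni.
Qed.

Lemma cell0 s : s <= 0 -> cell s = 0%N.
Proof.
move=> s0; have [N0|N0] := posnP N; first by move: (cell_le s); rewrite N0 leqn0 => /eqP.
by apply/eqP; rewrite -leqn0 leq_cell//; have [-> _ _] := hpart.
Qed.

Lemma cell_itv s : 0 < s -> s <= T ->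
  [/\ (0 < cell s)%N, t (cell s).-1 < s & s <= t (cell s)].
Proof.
move=> s0 sT; have [t0 tN _] := hpart.
have N0 : (0 < N)%N.
  by case: N tN => // tN; move: (lt_le_trans s0 sT); rewrite -tN t0 ltxx.
have c0 : (0 < cell s)%N by rewrite ltn_cell// t0.
split => //; first by rewrite -ltn_cell ?prednK// cell_le.
have [cN|] := ltnP (cell s) N; first by rewrite -leq_cell.
by move=> Nc; rewrite (_ : cell s = N) ?tN//; apply/eqP; rewrite eqn_leq cell_le.
Qed.

Lemma measurable_cell : measurable_fun [set: R] cell.
Proof.
have mlt j : measurable [set s : R | (j < cell s)%N].
  have [jN|Nj] := ltnP j N.
    rewrite (_ : [set _ | _] = `]t j, +oo[%classic); first exact: measurable_itv.
    by apply/seteqP; split => s /=; rewrite in_itv/= andbT ltn_cell.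
  rewrite (_ : [set _ | _] = set0)//; apply/seteqP; split => // s /=.
  by rewrite ltnNge (leq_trans (cell_le s)).
have mj j : measurable [set s : R | cell s = j].
  case: j => [|j].
    rewrite (_ : [set _ | _] = ~` [set s | (0 < cell s)%N]).
      exact: measurableC.
    apply/seteqP; split => s /=; first by move=> ->.
    by move=> /negP; rewrite -leqNgt leqn0 => /eqP.
  rewrite (_ : [set _ | _] = [set s | (j < cell s)%N] `\` [set s | (j.+1 < cell s)%N]).
    exact: measurableD.
  apply/seteqP; split => s /=; first by move=> ->; rewrite ltnn.
  by move=> [js /negP]; rewrite -leqNgt => sj; apply/eqP; rewrite eqn_leq sj.
move=> _ B _; rewrite setTI.
rewrite (_ : _ @^-1` _ = \bigcup_(j in B) [set s | cell s = j]).
  by apply: bigcup_measurable => j _.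
apply/seteqP; split => [s Bs|s [j Bj /= sj]]; last by rewrite /= sj.
by exists (cell s).
Qed.

(** [cell] passes from [i] to [i + 1] immediately after [t i], so the nodes crossed between [a] and
    [b] are those in [[a, b)]. Every increment over a window becomes a sum over crossed nodes, which
    [Rintegral_crossing] can average. *)
Lemma cell_increment (V : zmodType) (F : nat -> V) a b : a <= b ->
  F (cell b) - F (cell a) = \sum_(i < N | a <= t i < b) (F i.+1 - F i).
Proof.
move=> ab; rewrite -telescope_sumr ?cell_homo//.
rewrite big_geq_mkord (big_ord_widen_cond _ (fun i => (cell a <= i)%N)
  (fun i => F i.+1 - F i) (cell_le b)).
by apply: eq_bigl => i; rewrite ltn_cell// leq_cell.
Qed.

Lemma integrable_cell (F : nat -> R) (a b : R) :
  mu.-integrable `]a, b] (EFin \o (fun s => F (cell s))).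
Proof.
by apply: (@integrable_nat_index2 _ N N cell cell (fun j _ => F j)) => //;
  [exact: measurable_cell|exact: measurable_cell|exact: cell_le|exact: cell_le].
Qed.

Lemma Rintegral_cell (F : nat -> R) :
  \int[mu]_(s in `]0, T]) F (cell s) = \sum_(i < N) (t i.+1 - t i) * F i.+1.
Proof.
have [t0 tN _] := hpart.
suff : forall n, (n <= N)%N ->
    \int[mu]_(s in `]0, t n]) F (cell s) = \sum_(i < n) (t i.+1 - t i) * F i.+1.
  by move=> /(_ N (leqnn N)); rewrite tN.
elim=> [_|n IH nN]; first by rewrite big_ord0 t0 set_itvoc0 Rintegral_set0.
rewrite big_ord_recr/= -IH ?(ltnW nN)//.
have tn : t n <= t n.+1 by exact: partition_le.
rewrite (@Rintegral_itvocD _ 0 (t n))//; last exact: integrable_cell.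
  congr (_ + _); rewrite mulrC -Rintegral_cst_itvoc//; apply: eq_Rintegral => s.
  by rewrite inE/= in_itv/= => /andP[ts st]; rewrite (@cellE n).
exact: partition_ge0 (ltnW nN).
Qed.

(** Before time 0 the cell index is 0; this is where the initial value enters the averages. *)
Lemma Rintegral_cell_ext (h : R) (F : nat -> R) : 0 < h ->
  \int[mu]_(s in `]- h, T]) F (cell s) =
  h * F 0%N + \sum_(i < N) (t i.+1 - t i) * F i.+1.
Proof.
move=> h0; have T0 : 0 <= T by have [<- <- _] := hpart; exact: partition_le.
rewrite -Rintegral_cell (@Rintegral_itvocD _ _ 0)//; [|by rewrite oppr_le0 ltW|exact: integrable_cell].
congr (_ + _); have -> : h * F 0%N = F 0%N * (0 - - h) by rewrite sub0r opprK mulrC.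
rewrite -Rintegral_cst_itvoc ?oppr_le0 ?(ltW h0)//.
apply: eq_Rintegral => s; rewrite inE/= in_itv/= => /andP[_ s0].
by rewrite cell0.
Qed.

Lemma integrable_crossing1 (h x c a b : R) :
  mu.-integrable `]a, b] (EFin \o (fun s => if s <= x < s + h then c else 0)).
Proof.
apply: (@le_integrable_r _ _ R mu _ _ _ (fun=> `|c|)) => //; last first.
- exact: integrable_cst_itvoc.
- by move=> s _; case: ifP => // _; rewrite normr0.
apply: measurable_funTS; apply: measurable_fun_ifT => //.
apply: measurable_and; first exact: measurable_fun_ler.
by apply: measurable_fun_ltr => //; apply: measurable_funD.
Qed.

Lemma Rintegral_crossing1 (h x c : R) : 0 < h -> 0 <= x -> x <= T ->
  \int[mu]_(s in `]- h, T]) (if s <= x < s + h then c else 0) = h * c.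
Proof.
move=> h0 x0 xT.
rewrite (@Rintegral_itvocD _ _ (x - h))//; last 3 first.
- lra.
- lra.
- exact: integrable_crossing1.
rewrite (@Rintegral_itvocD _ (x - h) x T)//; last 2 first.
- lra.
- exact: integrable_crossing1.
have -> : \int[mu]_(s in `]- h, (x - h)]) (if s <= x < s + h then c else 0) = 0.
  rewrite -[RHS](mul0r (x - h - - h)) -Rintegral_cst_itvoc; last lra.
  apply: eq_Rintegral => s; rewrite inE/= in_itv/= => /andP[_ sx].
  by rewrite [X in _ && X]ltNge -lerBrDr sx andbF.
have -> : \int[mu]_(s in `]x, T]) (if s <= x < s + h then c else 0) = 0.
  rewrite -[RHS](mul0r (T - x)) -Rintegral_cst_itvoc//.
  apply: eq_Rintegral => s; rewrite inE/= in_itv/= => /andP[xs _].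
  by rewrite leNgt xs.
rewrite addr0 add0r.
have -> : h * c = c * (x - (x - h)) by ring.
rewrite -Rintegral_cst_itvoc; last by rewrite gerBl ltW.
apply: eq_Rintegral => s; rewrite inE/= in_itv/= => /andP[xs sx].
by rewrite sx -ltrBlDr xs.
Qed.

Lemma crossing_sumE (h : R) (A : nat -> R) :
  (fun s => \sum_(i < N | s <= t i < s + h) A i) =
  (fun s => \sum_(i < N) (if s <= t i < s + h then A i else 0)).
Proof. by apply/funext => s; rewrite big_mkcond. Qed.

Lemma integrable_crossing (h : R) (A : nat -> R) (a b : R) :
  mu.-integrable `]a, b] (EFin \o (fun s => \sum_(i < N | s <= t i < s + h) A i)).
Proof.
rewrite crossing_sumE.
apply: (@integrable_r_sum _ _ R mu _ (measurable_itv _) _ _ _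
  (fun (i : 'I_N) s => if s <= t i < s + h then A i else 0)) => i.
exact: integrable_crossing1.
Qed.

(* Each node is crossed by the window [[s, s + h)] for a set of [s] of length [h]. *)
Lemma Rintegral_crossing (h : R) (A : nat -> R) : 0 < h ->
  \int[mu]_(s in `]- h, T]) (\sum_(i < N | s <= t i < s + h) A i) =
  h * \sum_(i < N) A i.
Proof.
move=> h0; rewrite mulr_sumr crossing_sumE Rintegral_r_sum//; last first.
  by move=> i; exact: integrable_crossing1.
apply: eq_bigr => i _; rewrite Rintegral_crossing1//.
  exact: partition_ge0 (ltnW (ltn_ord i)).
exact: partition_leT (ltnW (ltn_ord i)).
Qed.

End PartitionCells.

(** * Discrete energy estimates *)

Lemma weighted_cauchy_schwarz {R : realFieldType} (I : Type) (s : seq I)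
    (P : pred I) (w a : I -> R) : (forall i, 0 <= w i) ->
  (\sum_(i <- s | P i) w i * a i) ^+ 2 <=
  (\sum_(i <- s | P i) w i) * (\sum_(i <- s | P i) w i * a i ^+ 2).
Proof.
move=> w0; elim: s => [|i s]; first by rewrite !big_nil expr0n mul0r.
rewrite !big_cons; case: (P i) => //.
have : 0 <= \sum_(j <- s | P j) w j by exact: sumr_ge0.
have : 0 <= \sum_(j <- s | P j) w j * a j ^+ 2.
  by apply: sumr_ge0 => j _; rewrite mulr_ge0// sqr_ge0.
move: (\sum_(j <- s | P j) w j) (\sum_(j <- s | P j) w j * a j ^+ 2)
  (\sum_(j <- s | P j) w j * a j) (w0 i) => A C B wi C0 A0 BAC.
(* By the induction hypothesis, [(2 B a)^2 <= 4 A C a^2 <= (A a^2 + C)^2]. *)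
have key : 2 * B * a i <= A * a i ^+ 2 + C.
  rewrite leNgt; apply/negP => lt.
  have p0 : 0 <= A * a i ^+ 2 + C by rewrite addr_ge0// mulr_ge0// sqr_ge0.
  have : (A * a i ^+ 2 + C) ^+ 2 < (2 * B * a i) ^+ 2 by rewrite ltr_sqr// nnegrE// (le_trans p0)// ltW.
  have := ler_wpM2l (sqr_ge0 (a i)) BAC.
  have := sqr_ge0 (A * a i ^+ 2 - C); nra.
have := ler_wpM2l wi key; nra.
Qed.

Section DiscreteEstimates.
Context {R : realType} {H : completeNormedModType R}.
Variable dot : {dot H for idfun}.
Hypothesis hdot : induces_norm dot.
Local Notation mu := (@lebesgue_measure R).

(** Indexed by the right end of the cell, as [cell] is; the value at index 0 is the zero vector. *)
Definition speed (t : nat -> R) (u : nat -> H) (j : nat) : H :=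
  (tstep t j)^-1 *: (u j - u j.-1).

(* What remains of the scheme for the limit passage: [f i] is the energy of
   [u i], [xi i] its subgradient, [e] the total residual; [r] and [e'] quantify
   the almost-convexity of the energy, [M] bounds the squared L2 norm of the
   speed. *)
Record discrete_flow (T r e e' M tm : R) (N : nat) (t : nat -> R)
    (u xi : nat -> H) (f : nat -> R) : Prop := DiscreteFlow {
  df_part : is_partition T N t ;
  df_mesh_ge0 : 0 <= tm ;
  df_step : forall i, (i < N)%N -> t i.+1 - t i <= tm ;
  df_energy : \sum_(i < N) (f i.+1 - f i
      + (t i.+1 - t i) / 2 * `|speed t u i.+1| ^+ 2
      + (t i.+1 - t i) / 2 * `|xi i.+1| ^+ 2) <= e ;
  df_subdiff : forall j k, (j <= N)%N -> (k <= N)%N -> `|u k - u j| < r ->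
    f j + dot (xi j) (u k - u j) - e' * `|u k - u j| <= f k ;
  df_speed : \sum_(i < N) (t i.+1 - t i) * `|speed t u i.+1| ^+ 2 <= M }.

Variables (T r e e' M tm : R) (N : nat) (t : nat -> R)
  (u xi : nat -> H) (f : nat -> R).
Hypothesis hf : discrete_flow T r e e' M tm N t u xi f.
Hypotheses (r0 : 0 < r) (e'0 : 0 <= e').

Let hpart : is_partition T N t. Proof. by case: hf. Qed.

Lemma tstep_gt0 i : (i < N)%N -> 0 < t i.+1 - t i.
Proof. by move=> iN; rewrite subr_gt0 (partition_lt hpart). Qed.

Lemma scale_speed i : (i < N)%N -> (t i.+1 - t i) *: speed t u i.+1 = u i.+1 - u i.
Proof.
by move=> iN; rewrite scalerA mulfV ?scale1r//= gt_eqF// tstep_gt0.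
Qed.

(** By the conventions on [cell], the curve is frozen at [u 0] before time 0 and at [u N] after
    [T]. *)
Definition step_increment (h s : R) : H := u (cell N t (s + h)) - u (cell N t s).

Lemma step_incrementE h s : 0 <= h -> step_increment h s =
  \sum_(i < N | s <= t i < s + h) (t i.+1 - t i) *: speed t u i.+1.
Proof.
move=> h0; rewrite /step_increment (cell_increment hpart) ?lerDl//.
by apply: eq_bigr => i _; rewrite scale_speed.
Qed.

(** A crossed cell starts inside the window, so only the last one can stick out, by at most one
    step. *)
Lemma crossing_length h s : 0 <= h ->
  \sum_(i < N | s <= t i < s + h) (t i.+1 - t i) <= h + tm.
Proof.
move=> h0; rewrite -(cell_increment hpart) ?lerDl//.
have tm0 := df_mesh_ge0 hf.
have /(cell_homo hpart) : s <= s + h by rewrite lerDl.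
rewrite leq_eqVlt => /orP[/eqP <-|]; first by rewrite subrr addr_ge0.
have cN := cell_le N t (s + h); case cE : (cell N t (s + h)) cN => [//|c] cN bc.
have tc : t c < s + h by rewrite -(ltn_cell hpart)// cE.
have tb : s <= t (cell N t s) by rewrite -(leq_cell hpart)// (leq_trans bc).
have := df_step hf cN; lra.
Qed.

Lemma step_increment_sqr h s : 0 <= h -> `|step_increment h s| ^+ 2 <=
  (h + tm) * \sum_(i < N | s <= t i < s + h)
               (t i.+1 - t i) * `|speed t u i.+1| ^+ 2.
Proof.
move=> h0; have tau0 (i : 'I_N) : 0 <= t i.+1 - t i by rewrite ltW// tstep_gt0.
apply: (@le_trans _ _ ((\sum_(i < N | s <= t i < s + h)
    (t i.+1 - t i) * `|speed t u i.+1|) ^+ 2)).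
  rewrite ler_sqr ?nnegrE//; last by apply: sumr_ge0 => i _; rewrite mulr_ge0.
  rewrite step_incrementE// (le_trans (ler_norm_sum _ _ _))// ler_sum// => i _.
  by rewrite normrZ ger0_norm.
apply: (le_trans (weighted_cauchy_schwarz _ _ _ tau0)).
rewrite ler_wpM2r ?crossing_length//.
by apply: sumr_ge0 => i _; rewrite mulr_ge0// sqr_ge0.
Qed.

Lemma step_increment_norm h s : 0 <= h -> `|step_increment h s| <=
  \sum_(i < N | s <= t i < s + h) (t i.+1 - t i) * `|speed t u i.+1|.
Proof.
move=> h0; rewrite step_incrementE// (le_trans (ler_norm_sum _ _ _))// ler_sum// => i _.
by rewrite normrZ ger0_norm// ltW// tstep_gt0.
Qed.

Lemma step_increment_sqrM h s : 0 <= h -> `|step_increment h s| ^+ 2 <= (h + tm) * M.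
Proof.
move=> h0; rewrite (le_trans (step_increment_sqr _ h0))//.
rewrite ler_wpM2l ?addr_ge0 ?(df_mesh_ge0 hf)// (le_trans _ (df_speed hf))//.
rewrite big_mkcond ler_sum// => i _; case: ifP => // _.
by rewrite mulr_ge0 ?sqr_ge0// ltW// tstep_gt0.
Qed.

Variable h : R.
Hypotheses (h0 : 0 < h) (hr : (h + tm) * M < r ^+ 2).

(** The reason for taking [h] small: almost-convexity of the energy is available only at distances
    below [r]. *)
Lemma step_increment_lt s : `|step_increment h s| < r.
Proof.
rewrite -ltr_sqr ?nnegrE ?(ltW r0)//.
exact: le_lt_trans (step_increment_sqrM _ (ltW h0)) hr.
Qed.

(** The discrete substitute for the chain rule. Almost-convexity compares the two ends of the
    window; the energy increment and the error [e' |D|] are then distributed over the crossed nodes,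
    so that they can be averaged node by node. *)
Lemma dot_step_increment s : dot (xi (cell N t s)) (step_increment h s) <=
  \sum_(i < N | s <= t i < s + h)
     (f i.+1 - f i + e' * ((t i.+1 - t i) * `|speed t u i.+1|)).
Proof.
rewrite big_split/= -mulr_sumr -(cell_increment hpart) ?lerDl ?(ltW h0)//.
have := df_subdiff hf (cell_le N t s) (cell_le N t (s + h)) (step_increment_lt s).
rewrite -/(step_increment h s) => sub.
have := ler_wpM2l e'0 (step_increment_norm s (ltW h0)); lra.
Qed.

(** The errors of the averaged energy balance: windows that start before time 0, total residual, and
    almost-convexity, where [(T + M) / 2] bounds the length of the polygonal curve. *)
Definition excess : R := h / 2 * `|xi 0%N| ^+ 2 + e + e' * ((T + M) / 2).

Lemma sum_speed_le : \sum_(i < N) (t i.+1 - t i) * `|speed t u i.+1| <= (T + M) / 2.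
Proof.
have [t0 tN _] := hpart.
have -> : T = \sum_(i < N) (t i.+1 - t i).
  by have := telescope_sumr t (leq0n N); rewrite tN t0 subr0 big_mkord => ->.
apply: (@le_trans _ _ ((\sum_(i < N) (t i.+1 - t i) +
    \sum_(i < N) (t i.+1 - t i) * `|speed t u i.+1| ^+ 2) / 2)); last first.
  by rewrite ler_wpM2r// lerD2l (df_speed hf).
rewrite -big_split/= mulr_suml; apply: ler_sum => i _.
have := tstep_gt0 (ltn_ord i); set tau := _ - _; set z := `|_| => tau0.
have := mulr_ge0 (ltW tau0) (sqr_ge0 (z - 1)); nra.
Qed.

(** Averaging turns the sums over crossed nodes into full sums, to which the energy inequality
    applies: the slopes cancel except at index 0, and the kinetic energy keeps the coefficient
    [c - 1/2]. The parameter is [(h + tm)/(2h)] where [|D/h|^2 / 2] must be absorbed and 0 where it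
    is kept. *)
Lemma integral_window_defect (c : R) : 0 <= c ->
  \int[mu]_(s in `]- h, T]) (2^-1 * `|xi (cell N t s)| ^+ 2
     + h^-1 * (\sum_(i < N | s <= t i < s + h)
        (f i.+1 - f i + e' * ((t i.+1 - t i) * `|speed t u i.+1|)
         + c * ((t i.+1 - t i) * `|speed t u i.+1| ^+ 2)))) <=
  excess + (c - 2^-1) * (\sum_(i < N) (t i.+1 - t i) * `|speed t u i.+1| ^+ 2).
Proof.
move=> c0.
have ixi : mu.-integrable `]- h, T] (EFin \o (fun s => 2^-1 * `|xi (cell N t s)| ^+ 2)).
  apply: integrable_rZ => //.
  exact: (integrable_cell hpart (fun j => `|xi j| ^+ 2)).
pose A i := f i.+1 - f i + e' * ((t i.+1 - t i) * `|speed t u i.+1|)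
         + c * ((t i.+1 - t i) * `|speed t u i.+1| ^+ 2).
have iA : mu.-integrable `]- h, T] (EFin \o (fun s => h^-1 *
    (\sum_(i < N | s <= t i < s + h) A i))).
  by apply: integrable_rZ => //; exact: integrable_crossing.
rewrite RintegralD// RintegralZl//; last first.
  exact: (integrable_cell hpart (fun j => `|xi j| ^+ 2)).
rewrite RintegralZl//; last exact: (@integrable_crossing _ _ _ h A).
rewrite (Rintegral_cell_ext hpart (fun j => `|xi j| ^+ 2))//.
rewrite (@Rintegral_crossing _ T N t hpart h A)// mulKf ?gt_eqF//.
rewrite /A !big_split/= -!mulr_sumr.
have := df_energy hf; rewrite !big_split/=.
have half (F : nat -> R) : \sum_(i < N) (t i.+1 - t i) / 2 * F i =
    2^-1 * \sum_(i < N) (t i.+1 - t i) * F i.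
  by rewrite mulr_sumr; apply: eq_bigr => i _; rewrite mulrAC mulrC.
rewrite (half (fun i => `|speed t u i.+1| ^+ 2)) (half (fun i => `|xi i.+1| ^+ 2)).
have := ler_wpM2l e'0 sum_speed_le; rewrite /excess; lra.
Qed.

(** Expand the square: the mixed term is bounded by the discrete chain rule, and [|D/h|^2 / 2] by
    Cauchy-Schwarz within the window, which costs [c = (h + tm)/(2h)]. The kinetic energy then
    survives only with the coefficient [c - 1/2 = tm/(2h)]. *)
Lemma integral_step_increment :
  2^-1 * \int[mu]_(s in `]- h, T])
    `|xi (cell N t s) + h^-1 *: step_increment h s| ^+ 2 <=
  excess + tm / (2 * h) * M.
Proof.
have h1 : 0 <= h^-1 by rewrite invr_ge0 ltW.
have [c cE] : exists c, c = (h + tm) / (2 * h) by eexists.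
have c0 : 0 <= c.
  by rewrite cE divr_ge0 ?mulr_ge0 ?addr_ge0 ?(ltW h0)// (df_mesh_ge0 hf).
apply: (@le_trans _ _ (excess + (c - 2^-1) *
    (\sum_(i < N) (t i.+1 - t i) * `|speed t u i.+1| ^+ 2))); last first.
  rewrite lerD2l; have -> : c - 2^-1 = tm / (2 * h) by rewrite cE; field; rewrite gt_eqF.
  by rewrite ler_wpM2l ?(df_speed hf)// divr_ge0 ?mulr_ge0 ?(ltW h0)// (df_mesh_ge0 hf).
apply: le_trans (integral_window_defect c0).
have mc := measurable_cell hpart.
have mch : measurable_fun [set: R] (fun s => cell N t (s + h)).
  apply: (measurableT_comp mc); exact: measurable_funD.
rewrite -RintegralZl//; last first.
  apply: (@integrable_nat_index2 _ N N (cell N t) (fun s => cell N t (s + h))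
    (fun j k => `|xi j + h^-1 *: (u k - u j)| ^+ 2)) => //.
    exact: cell_le.
  by move=> s; exact: cell_le.
apply: le_Rintegral => //.
- apply: integrable_rZ => //.
  apply: (@integrable_nat_index2 _ N N (cell N t) (fun s => cell N t (s + h))
    (fun j k => `|xi j + h^-1 *: (u k - u j)| ^+ 2)) => //.
    exact: cell_le.
  by move=> s; exact: cell_le.
- apply: integrable_rD => //; apply: integrable_rZ => //.
    exact: (integrable_cell hpart (fun j => `|xi j| ^+ 2)).
  apply: (@integrable_crossing _ _ _ h (fun i => f i.+1 - f i + e' * ((t i.+1 - t i) * `|speed t u i.+1|)
         + c * ((t i.+1 - t i) * `|speed t u i.+1| ^+ 2))).
move=> s _; rewrite (sqr_normD hdot) normrZ ger0_norm// dotZr exprMn.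
have := ler_wpM2l h1 (dot_step_increment s).
rewrite [X in _ -> _ <= _ + _ * X]big_split/= -[in X in _ -> _ <= X]mulr_sumr.
have := step_increment_sqr s (ltW h0).
set Q := \sum_(i < N | _) (t i.+1 - t i) * _ ^+ 2; set S := \sum_(i < N | _) _.
set D := `|step_increment h s| ^+ 2 => DQ SS.
have -> : c * Q = (h + tm) * Q / (2 * h) by rewrite cE; field; rewrite gt_eqF.
have : h^-1 ^+ 2 * D <= h^-1 ^+ 2 * ((h + tm) * Q) by rewrite ler_wpM2l// sqr_ge0.
have -> : h^-1 * (S + (h + tm) * Q / (2 * h)) =
    h^-1 * S + 2^-1 * (h^-1 ^+ 2 * ((h + tm) * Q)) by field; rewrite gt_eqF.
lra.
Qed.

(** Averaging over windows loses little kinetic energy. By the discrete chain rule the integrand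
    with [c = 0], plus [|D/h|^2 / 2], dominates [|xi + D/h|^2 / 2]; hence its integral is
    nonnegative, while [integral_window_defect] bounds the first part by [excess] minus half of the
    kinetic energy. *)
Lemma speed_le_step_increment :
  \sum_(i < N) (t i.+1 - t i) * `|speed t u i.+1| ^+ 2 <=
  \int[mu]_(s in `]- h, T]) `|h^-1 *: step_increment h s| ^+ 2 + 2 * excess.
Proof.
have h1 : 0 <= h^-1 by rewrite invr_ge0 ltW.
have mc := measurable_cell hpart.
have mch : measurable_fun [set: R] (fun s => cell N t (s + h)).
  apply: (measurableT_comp mc); exact: measurable_funD.
have iD : mu.-integrable `]- h, T]
    (EFin \o (fun s => `|h^-1 *: step_increment h s| ^+ 2)).
  apply: (@integrable_nat_index2 _ N N (cell N t) (fun s => cell N t (s + h))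
    (fun j k => `|h^-1 *: (u k - u j)| ^+ 2)) => //.
    exact: cell_le.
  by move=> s; exact: cell_le.
pose f1 (s : R) := 2^-1 * `|xi (cell N t s)| ^+ 2
     + h^-1 * (\sum_(i < N | s <= t i < s + h)
        (f i.+1 - f i + e' * ((t i.+1 - t i) * `|speed t u i.+1|)
         + 0 * ((t i.+1 - t i) * `|speed t u i.+1| ^+ 2))).
have le1 : \int[mu]_(s in `]- h, T]) f1 s <= _ := integral_window_defect (lexx 0).
have if1 : mu.-integrable `]- h, T] (EFin \o f1).
  apply: integrable_rD => //; apply: integrable_rZ => //.
    exact: (integrable_cell hpart (fun j => `|xi j| ^+ 2)).
  apply: (@integrable_crossing _ _ _ h (fun i => f i.+1 - f i + e' * ((t i.+1 - t i) * `|speed t u i.+1|)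
         + 0 * ((t i.+1 - t i) * `|speed t u i.+1| ^+ 2))).
have : 0 <= \int[mu]_(s in `]- h, T]) (f1 s + 2^-1 * `|h^-1 *: step_increment h s| ^+ 2).
  apply: Rintegral_ge0 => s _; rewrite /f1.
  have -> : \sum_(i < N | s <= t i < s + h)
      (f i.+1 - f i + e' * ((t i.+1 - t i) * `|speed t u i.+1|) +
       0 * ((t i.+1 - t i) * `|speed t u i.+1| ^+ 2)) =
    \sum_(i < N | s <= t i < s + h)
      (f i.+1 - f i + e' * ((t i.+1 - t i) * `|speed t u i.+1|)).
    by apply: eq_bigr => i _; rewrite mul0r addr0.
  have := ler_wpM2l h1 (dot_step_increment s).
  have := sqr_ge0 (`|xi (cell N t s) + h^-1 *: step_increment h s|).
  rewrite (sqr_normD hdot) dotZr; lra.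
rewrite RintegralD//; last exact: integrable_rZ.
rewrite RintegralZl//; lra.
Qed.

End DiscreteEstimates.

(** * Affine interpolants as primitives of their speeds *)

Section PiecewiseAffine.
Context {R : realType} {H : completeNormedModType R}.
Variable dot : {dot H for idfun}.
Hypothesis hdot : induces_norm dot.
Local Notation mu := (@lebesgue_measure R).
Variables (T : R) (N : nat) (t : nat -> R) (u : nat -> H).
Hypothesis hpart : is_partition T N t.

Lemma pw_affine_cell i s : (i < N)%N -> t i <= s -> s <= t i.+1 ->
  pw_affine N t u s = u i.+1 - (t i.+1 - s) *: speed t u i.+1.
Proof.
move=> iN ts st; have [t0 tN _] := hpart.
have tau0 j : (j < N)%N -> t j.+1 - t j != 0.
  by move=> jN; rewrite gt_eqF// subr_gt0 (partition_lt hpart).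
have formula j : (j < N)%N -> t j < s -> s <= t j.+1 ->
    pw_affine N t u s = u j.+1 - (t j.+1 - s) *: speed t u j.+1.
  move=> jN tjs stj; rewrite /pw_affine gt_eqF; last first.
    by rewrite (le_lt_trans _ tjs)// (partition_ge0 hpart)// ltnW.
  rewrite big_mkcond (bigD1_seq j.+1) ?iota_uniq ?mem_index_iota//= tjs stj /=.
  rewrite big_seq_cond big1 ?addr0; last first.
    move=> k /andP[]; rewrite mem_index_iota => /andP[k0 kN] kj.
    case: ifP => // /andP[tk kt]; case/negP: kj.
    case: k k0 kN tk kt => // k _ kN /= tk kt.
    by rewrite -(cellE hpart jN tjs stj) -(cellE hpart _ tk kt).
  rewrite /speed /tstep/= scalerA.
  have -> : (t j.+1 - s) * (t j.+1 - t j)^-1 = 1 - (s - t j) / (t j.+1 - t j).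
    by field; exact: tau0.
  move: (_ / _) => l.
  have -> : l *: u j.+1 = u j.+1 - (1 - l) *: u j.+1.
    by rewrite scalerBl scale1r subKr.
  by rewrite scalerBr opprB addrA addrAC.
have rhs : u i.+1 - (t i.+1 - t i) *: speed t u i.+1 = u i.
  by rewrite scalerA mulfV ?scale1r ?subKr//= tau0.
(* The left node belongs to the previous cell, or is time 0 with its separate clause; in both cases
   the interpolant takes the nodal value, so the formula extends to the closed cell. *)
move: ts; rewrite le_eqVlt => /orP[/eqP tis|]; last by move=> ts; exact: formula.
rewrite -tis rhs; case: i iN tis st rhs => [|i] iN tis st rhs.
  by rewrite /pw_affine t0 eqxx.
have := formula i (ltnW iN); rewrite -tis subrr scale0r subr0.
by apply => //; exact: (partition_lt hpart (ltnSn i) (ltnW iN)).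
Qed.

Lemma cell_ge0_mem s : 0 < s -> s <= T -> exists2 i, (i < N)%N & t i < s /\ s <= t i.+1.
Proof.
move=> s0 sT; have [c0 tc ct] := cell_itv hpart s0 sT.
have cN := cell_le N t s.
exists (cell N t s).-1; first by rewrite prednK.
by rewrite prednK.
Qed.

Lemma pw_affine0 : pw_affine N t u 0 = u 0%N.
Proof. by rewrite /pw_affine eqxx. Qed.

Lemma pw_affine_near rho s : (forall i, (i < N)%N -> `|u i.+1 - u i| <= rho) ->
  0 <= rho -> 0 <= s -> s <= T -> `|pw_affine N t u s - u (cell N t s)| <= rho.
Proof.
move=> hrho rho0; rewrite le_eqVlt => /orP[/eqP <- _|s0 sT].
  by rewrite pw_affine0 (cell0 hpart)// subrr normr0.
have [i iN [ts st]] := cell_ge0_mem s0 sT.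
rewrite (pw_affine_cell iN (ltW ts) st) (cellE hpart iN ts st) addrC addKr normrN.
rewrite (le_trans _ (hrho i iN))// /speed scalerA normrZ ler_piMl//=.
have tau0 : 0 < t i.+1 - t i by rewrite subr_gt0 (partition_lt hpart).
rewrite ger0_norm; last by rewrite divr_ge0 ?(ltW tau0)// subr_ge0.
by rewrite ler_pdivrMr// mul1r lerD2l lerN2 ltW.
Qed.

Definition pw_speed (s : R) : H := speed t u (cell N t s).

Lemma scalar_measurable_pw_speed : scalar_measurable pw_speed.
Proof.
move=> x; apply: (measurable_fun_nat_index (measurable_cell hpart)
  (f := fun j _ => `|speed t u j - x|)) => j; exact: measurable_cst.
Qed.

Lemma integral_pw_speed :
  (\int[mu]_(s in `]0%R, T]) (`|pw_speed s| ^+ 2)%:E =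
   (\sum_(i < N) (t i.+1 - t i) * `|speed t u i.+1| ^+ 2)%:E)%E.
Proof.
rewrite -(Rintegral_cell hpart (fun j => `|speed t u j| ^+ 2)) /Rintegral fineK//.
apply: integrable_fin_num => //.
exact: (integrable_cell hpart (fun j => `|speed t u j| ^+ 2)).
Qed.

Lemma sq_integrable_pw_speed : sq_integrable T pw_speed.
Proof.
split; first exact: scalar_measurable_pw_speed.
by rewrite integral_pw_speed ltry.
Qed.

Lemma weak_primitive_pw_affine : weak_primitive dot T pw_speed (pw_affine N t u).
Proof.
move=> e x y x0 xy yT; have [t0 tN _] := hpart.
have ispeed a b : mu.-integrable `]a, b] (EFin \o (fun s => dot e (pw_speed s))).
  exact: (integrable_cell hpart (fun j => dot e (speed t u j))).
suff : forall n, (n <= N)%N -> forall x y, 0 <= x -> x <= y -> y <= t n ->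
    dot e (pw_affine N t u y - pw_affine N t u x) =
    \int[mu]_(r in `]x, y]) dot e (pw_speed r).
  by move=> /(_ N (leqnn N)); apply => //; rewrite tN.
elim=> [_|n IH nN] {x0 xy yT} {}x {}y x0 xy yt.
  have yx : y = x by apply/eqP; rewrite eq_le xy (le_trans yt)// t0.
  by rewrite yx subrr dot0r set_itvoc0 Rintegral_set0.
have tn0 : 0 <= t n := partition_ge0 hpart (ltnW nN).
have local a b : t n <= a -> a <= b -> b <= t n.+1 ->
    dot e (pw_affine N t u b - pw_affine N t u a) =
    \int[mu]_(r in `]a, b]) dot e (pw_speed r).
  move=> ta ab bt.
  rewrite (pw_affine_cell nN ta (le_trans ab bt)) (pw_affine_cell nN (le_trans ta ab) bt).
  rewrite opprB addrC addrA subrK -scalerBl.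
  have -> : t n.+1 - a - (t n.+1 - b) = b - a by ring.
  rewrite dotZr mulrC -Rintegral_cst_itvoc//; apply: eq_Rintegral => s.
  rewrite inE/= in_itv/= => /andP[sa sb].
  by rewrite /pw_speed (cellE hpart nN (le_lt_trans ta sa) (le_trans sb bt)).
have [ytn|/ltW ytn] := leP y (t n); first exact: (IH (ltnW nN)).
have [xtn|/ltW xtn] := leP (t n) x; first exact: local.
rewrite (@Rintegral_itvocD _ x (t n) y)// -(local (t n) y)// -(IH (ltnW nN) x (t n))//.
by rewrite -dotDr [in RHS]addrC addrA subrK.
Qed.

End PiecewiseAffine.

(** * Window averages and the comparison of two schemes *)

Section WindowIntegral.
Context {R : realType}.
Local Notation mu := (@lebesgue_measure R).
Local Notation RR := (measurableTypeR R).
Variables (T h : R) (k : R -> R).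
Hypotheses (h0 : 0 < h) (mk : measurable_fun [set: R] k) (k0 : forall r, 0 <= k r).
Hypothesis ik : mu.-integrable `]0, T] (EFin \o k).

Definition window_integral (s : R) : R :=
  \int[mu]_(r in `]0, T]) (if s < r <= s + h then k r else 0).

Let f (z : RR * RR) : \bar R :=
  (if (0 < z.2 <= T) && (z.1 < z.2 <= z.1 + h) then k z.2 else 0)%:E.

Let f0 z : (0 <= f z)%E.
Proof. by rewrite lee_fin; case: ifP. Qed.

Let mf : measurable_fun [set: RR * RR] f.
Proof.
have m1 : measurable_fun [set: RR * RR] (fun z : RR * RR => z.1 : R) by exact: measurable_fst.
have m2 : measurable_fun [set: RR * RR] (fun z : RR * RR => z.2 : R) by exact: measurable_snd.
apply/measurable_EFinP; apply: measurable_fun_ifT => //; last first.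
  by apply: (measurableT_comp mk).
apply: measurable_and; apply: measurable_and.
- exact: measurable_fun_ltr.
- exact: measurable_fun_ler.
- exact: measurable_fun_ltr.
- by apply: measurable_fun_ler => //; apply: measurable_funD.
Qed.

Let mwin s : measurable_fun [set: R] (fun r => if s < r <= s + h then k r else 0).
Proof.
apply: measurable_fun_ifT => //; apply: measurable_and.
  exact: measurable_fun_ltr.
exact: measurable_fun_ler.
Qed.

Let iwin s : mu.-integrable `]0, T] (EFin \o (fun r => if s < r <= s + h then k r else 0)).
Proof.
apply: (@le_integrable_r _ _ R mu _ _ _ k) => //.
- by apply: measurable_funTS; exact: mwin.
- by move=> r _; case: ifP => _; rewrite ?normr0// ger0_norm.
Qed.

Let fubini_FE s : (\int[mu]_r f (s, r))%E = (window_integral s)%:E.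
Proof.
rewrite /window_integral /Rintegral fineK; last by apply: integrable_fin_num => //; exact: iwin.
rewrite [RHS]integral_mkcond; apply: eq_integral => r _.
rewrite patchE /f/= mem_setE in_itv/=.
by case: (0 < r <= T).
Qed.

Let kT (r : R) : \bar R := (if 0 < r <= T then k r else 0)%:E.

Let kTE : kT = (EFin \o k) \_ `]0, T].
Proof. by apply/funext => r; rewrite patchE mem_setE in_itv/= /kT; case: ifP. Qed.

Let fubini_GE r : (\int[mu]_s f (s, r))%E = (h%:E * kT r)%E.
Proof.
rewrite /f /kT /=; case: (0 < r <= T) => /=; last first.
  by rewrite mule0 integral0.
have -> : (fun s : RR => (if s < r <= s + h then k r else 0)%:E) =
    (cst (k r)%:E) \_ `[r - h, r[.
  apply/funext => s; rewrite patchE mem_setE in_itv/= lerBlDr andbC.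
  by case: ifP.
rewrite -integral_mkcond integral_cst//= lebesgue_measure_itv/= lte_fin.
by rewrite gtrBl h0 -EFinD opprB addrCA subrr addr0 muleC.
Qed.

(** Tonelli: a given [r] lies in []s, s + h]] for a set of [s] of length [h]. *)
Lemma window_integral_le :
  mu.-integrable `]- h, T] (EFin \o window_integral) /\
  \int[mu]_(s in `]- h, T]) window_integral s <= h * \int[mu]_(r in `]0, T]) k r.
Proof.
have mW : measurable_fun [set: R] (EFin \o window_integral).
  have := measurable_fun_fubini_tonelli_F (m2 := mu) f mf f0.
  rewrite /fubini_F; congr (measurable_fun _ _).
  by apply/funext => s; rewrite fubini_FE.
have W0 s : 0 <= window_integral s by apply: Rintegral_ge0 => r _; case: ifP.
have fin : (\int[mu]_(s in `](- h)%R, T]) (window_integral s)%:E <=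
    EFin (h * \int[mu]_(r in `]0, T]) k r)%R)%E.
  apply: (@le_trans _ _ (\int[mu]_s (window_integral s)%:E)%E).
    by apply: ge0_subset_integral => // s _; rewrite lee_fin.
  under eq_integral do rewrite -fubini_FE.
  rewrite (fubini_tonelli f mf f0).
  under eq_integral do rewrite fubini_GE kTE.
  have mkT : measurable_fun [set: RR] ((EFin \o k) \_ `]0, T]).
    by apply/(measurable_restrictT _ _).1 => //; case/integrableP : ik.
  rewrite ge0_integralZl//; last 2 first.
  - by move=> r _; apply: erestrict_ge0 => x _; rewrite lee_fin.
  - by rewrite lee_fin ltW.
  by rewrite -integral_mkcond EFinM /Rintegral fineK//; exact: integrable_fin_num.
have iW : mu.-integrable `]- h, T] (EFin \o window_integral).
  apply/integrableP; split; first exact: measurable_funTS.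
  rewrite (eq_integral (EFin \o (window_integral : RR -> R))); last first.
    by move=> s _; rewrite /= ger0_norm.
  by rewrite (le_lt_trans fin)// ltry.
split => //; rewrite -lee_fin; apply: le_trans fin.
by rewrite /Rintegral fineK//; exact: integrable_fin_num.
Qed.

End WindowIntegral.

Lemma subr_subACA (V : zmodType) (x y z t : V) :
  (x - y) - (z - t) = (x - z) - (y - t).
Proof. by rewrite !opprB addrACA [RHS]addrACA [- y + _]addrC. Qed.

Lemma le_Rintegral_subset {R : realType} (a b c d : R) (f : R -> R) :
  c <= a -> b <= d -> (forall r, 0 <= f r) ->
  (@lebesgue_measure R).-integrable `]c, d] (EFin \o f) ->
  \int[@lebesgue_measure R]_(r in `]a, b]) f r <=
  \int[@lebesgue_measure R]_(r in `]c, d]) f r.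
Proof.
move=> ca bd f0 fi.
have sub : `]a, b] `<=` `]c, d].
  by move=> r /=; rewrite !in_itv/= => /andP[/(le_lt_trans ca) -> /le_trans ->].
have fi' : (@lebesgue_measure R).-integrable `]a, b] (EFin \o f).
  exact: integrableS fi.
rewrite -lee_fin /Rintegral !fineK; last 2 first.
- exact: integrable_fin_num.
- exact: integrable_fin_num.
apply: ge0_subset_integral => //; first by case/integrableP : fi.
by move=> r _; rewrite lee_fin.
Qed.

(** Cauchy-Schwarz, from the integral of [(f - m/h)^2 >= 0] with [m] the integral of [f]. *)
Lemma sqr_Rintegral_le {R : realType} (a b h : R) (f : R -> R) :
  0 < h -> a <= b -> b - a <= h ->
  (@lebesgue_measure R).-integrable `]a, b] (EFin \o f) ->
  (@lebesgue_measure R).-integrable `]a, b] (EFin \o (fun r => f r ^+ 2)) ->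
  (\int[@lebesgue_measure R]_(r in `]a, b]) f r) ^+ 2 <=
  h * \int[@lebesgue_measure R]_(r in `]a, b]) (f r ^+ 2).
Proof.
move=> h0 ab bah fi f2i.
have [m mE] : exists m, m = \int[@lebesgue_measure R]_(r in `]a, b]) f r by eexists.
have [I2 I2E] : exists I2, I2 = \int[@lebesgue_measure R]_(r in `]a, b]) (f r ^+ 2).
  by eexists.
rewrite -mE -I2E.
have : 0 <= \int[@lebesgue_measure R]_(r in `]a, b])
    (f r ^+ 2 - (2 * (m / h) * f r - (m / h) ^+ 2)).
  apply: Rintegral_ge0 => r _.
  have -> : f r ^+ 2 - (2 * (m / h) * f r - (m / h) ^+ 2) = (f r - m / h) ^+ 2 by ring.
  exact: sqr_ge0.
rewrite RintegralB//; last first.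
  by apply: integrable_rB => //; [exact: integrable_rZ|exact: integrable_cst_itvoc].
rewrite RintegralB//; [|exact: integrable_rZ|exact: integrable_cst_itvoc].
rewrite RintegralZl// Rintegral_cst_itvoc// -mE -I2E => I20.
have : (m / h) ^+ 2 * (b - a) <= (m / h) ^+ 2 * h by rewrite ler_wpM2l ?sqr_ge0.
have -> : (m / h) ^+ 2 * h = m ^+ 2 / h by field; rewrite gt_eqF.
move: I20; have -> : 2 * (m / h) * m = 2 * (m ^+ 2 / h) by ring.
move=> I20 le2; rewrite mulrC -ler_pdivrMr//; lra.
Qed.

Section PairEstimate.
Context {R : realType} {H : completeNormedModType R}.
Variable dot : {dot H for idfun}.
Hypothesis hdot : induces_norm dot.
Local Notation mu := (@lebesgue_measure R).

(** [cell] is constant on either side of [[0, T]], whereas [pw_affine] vanishes there; clamped times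
    allow both to be compared over windows that stick out. *)
Lemma cell_clamp (T : R) (N : nat) (t : nat -> R) (s : R) :
  is_partition T N t -> cell N t (Num.max 0 (Num.min s T)) = cell N t s.
Proof.
move=> hpart; have T0 : 0 <= T by have [<- <- _] := hpart; exact: partition_le hpart _ _ _ _.
have [s0|s0] := leP s 0.
  have -> : Num.max 0 (Num.min s T) = 0.
    by apply/max_idPl; rewrite ge_min s0.
  by rewrite !(cell0 hpart).
have [sT|Ts] := leP s T; first by rewrite max_r// ltW.
rewrite max_r//; apply/eqP; rewrite eqn_leq (cell_homo hpart (ltW Ts))/=.
have [_ tN _] := hpart; have cN := cell_le N t s.
case: N hpart tN cN => [//|N'] hpart tN cN.
by rewrite (leq_trans cN)// (ltn_cell hpart)// -tN (partition_lt hpart).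
Qed.

Variables (T r e e' M tm : R).
Variables (N1 : nat) (t1 : nat -> R) (u1 xi1 : nat -> H) (f1 : nat -> R).
Variables (N2 : nat) (t2 : nat -> R) (u2 xi2 : nat -> H) (f2 : nat -> R).
Hypothesis hf1 : discrete_flow dot T r e e' M tm N1 t1 u1 xi1 f1.
Hypothesis hf2 : discrete_flow dot T r e e' M tm N2 t2 u2 xi2 f2.
Hypotheses (r0 : 0 < r) (e'0 : 0 <= e').
Variables (h rho B eta : R).
Hypotheses (h0 : 0 < h) (hr : (h + tm) * M < r ^+ 2).
Hypotheses (rho0 : 0 <= rho) (B0 : 0 <= B) (eta0 : 0 <= eta).
Hypotheses (hrho1 : forall i, (i < N1)%N -> `|u1 i.+1 - u1 i| <= rho)
  (hrho2 : forall i, (i < N2)%N -> `|u2 i.+1 - u2 i| <= rho)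
  (hB1 : forall i j, (i <= N1)%N -> (j <= N1)%N -> `|u1 i - u1 j| <= B)
  (hB2 : forall i j, (i <= N2)%N -> (j <= N2)%N -> `|u2 i - u2 j| <= B)
  (heta : forall s, 0 <= s -> s <= T ->
    `|u1 (cell N1 t1 s) - u2 (cell N2 t2 s)| <= eta).

Let hp1 := df_part hf1.
Let hp2 := df_part hf2.
Let G s := pw_speed N1 t1 u1 s + pw_speed N2 t2 u2 s.
Let w s := pw_affine N1 t1 u1 s + pw_affine N2 t2 u2 s.
Let k s := `|G s| ^+ 2.
Let clamp s := Num.max 0 (Num.min s T).
Let D1 := step_increment N1 t1 u1 h.
Let D2 := step_increment N2 t2 u2 h.

Let T0 : 0 <= T.
Proof. by have [<- <- _] := hp1; exact: partition_le hp1 _ _ _ _. Qed.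

Let mc1 := measurable_cell hp1.
Let mc2 := measurable_cell hp2.

Let integrable_pair (F : nat -> nat -> R) (a b : R) :
  mu.-integrable `]a, b] (EFin \o (fun s => F (cell N1 t1 s) (cell N2 t2 s))).
Proof.
by apply: (@integrable_nat_index2 _ N1 N2) => //; exact: cell_le.
Qed.

Let ik (a b : R) : mu.-integrable `]a, b] (EFin \o k).
Proof. exact: (integrable_pair (fun i j => `|speed t1 u1 i + speed t2 u2 j| ^+ 2)). Qed.

Let mk : measurable_fun [set: R] k.
Proof.
exact: (measurable_fun_nat_index2
  (fun i j => `|speed t1 u1 i + speed t2 u2 j| ^+ 2) mc1 mc2).
Qed.

Let sqG : sq_integrable T G.
Proof.
split.
  by move=> x; exact: (measurable_fun_nat_index2
    (fun i j => `|speed t1 u1 i + speed t2 u2 j - x|) mc1 mc2).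
case/integrableP : (ik 0 T) => _.
by under eq_integral do rewrite /= ger0_norm ?sqr_ge0//.
Qed.

Let wpG : weak_primitive dot T G w.
Proof.
move=> x s t s0 st tT.
have -> : w t - w s = (pw_affine N1 t1 u1 t - pw_affine N1 t1 u1 s) +
    (pw_affine N2 t2 u2 t - pw_affine N2 t2 u2 s).
  by rewrite /w opprD addrACA.
rewrite dotDr (weak_primitive_pw_affine dot u1 hp1)//.
rewrite (weak_primitive_pw_affine dot u2 hp2)// -RintegralD//; last 2 first.
- exact: (integrable_cell hp1 (fun j => dot x (speed t1 u1 j))).
- exact: (integrable_cell hp2 (fun j => dot x (speed t2 u2 j))).
by apply: eq_Rintegral => z _; rewrite -dotDr.
Qed.

Let clampP s : [/\ 0 <= clamp s & clamp s <= T].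
Proof. by rewrite /clamp le_max lexx ge_max T0 ge_min lexx orbT. Qed.

Let P s := w (clamp (s + h)) - w (clamp s).

(** Cauchy-Schwarz over the clamped window, which has length at most [h] and lies inside
    [[s, s + h]]. *)
Let P_le s : - h < s -> s <= T -> `|P s| ^+ 2 <= h * window_integral T h k s.
Proof.
move=> hs sT; set a := clamp s; set b := clamp (s + h).
have [a0 aT] := clampP s; have [b0 bT] := clampP (s + h).
have ab : a <= b.
  by rewrite /a /b /clamp ge_max le_max lexx/= le_max orbC le_min !ge_min lexx orbT lerDl (ltW h0).
have asb : s <= a by rewrite /a /clamp le_max le_min lexx sT orbT.
have bsh : b <= s + h.
  by rewrite /b /clamp ge_max ge_min lexx andbT -lerBlDr sub0r ltW.
have bah : b - a <= h by lra.
have := weak_primitive_le hdot sqG wpG 0 a0 ab bT.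
rewrite scaler0 subr0 -/(P s) => PG.
have nG : \int[mu]_(r in `]a, b]) `|G r - 0| = \int[mu]_(r in `]a, b]) `|G r|.
  by apply: eq_Rintegral => z _; rewrite subr0.
rewrite nG in PG.
have iG : mu.-integrable `]a, b] (EFin \o (fun r => `|G r|)).
  exact: (integrable_pair (fun i j => `|speed t1 u1 i + speed t2 u2 j|)).
apply: (@le_trans _ _ ((\int[mu]_(r in `]a, b]) `|G r|) ^+ 2)).
  by rewrite ler_sqr ?nnegrE// Rintegral_ge0.
apply: (le_trans (sqr_Rintegral_le h0 ab bah iG (ik a b))).
rewrite ler_wpM2l ?(ltW h0)// /window_integral.
apply: (@le_trans _ _ (\int[mu]_(r in `]a, b]) (if s < r <= s + h then k r else 0))).
  rewrite le_eqVlt; apply/orP; left; apply/eqP; apply: eq_Rintegral => z.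
  by rewrite inE/= in_itv/= => /andP[/(le_lt_trans asb) -> /le_trans -> ].
apply: le_Rintegral_subset => //; first by move=> z; case: ifP => // _; exact: sqr_ge0.
apply: (@le_integrable_r _ _ R mu _ _ _ k) => //.
- apply: measurable_funTS; apply: measurable_fun_ifT => //; apply: measurable_and.
    exact: measurable_fun_ltr.
  exact: measurable_fun_ler.
- move=> z _; have kz : 0 <= k z by exact: sqr_ge0.
  by case: ifP => _; rewrite ?normr0// ger0_norm.
Qed.

Let D_near (N : nat) (t : nat -> R) (u : nat -> H) : is_partition T N t ->
  (forall i, (i < N)%N -> `|u i.+1 - u i| <= rho) -> forall s,
  `|step_increment N t u h s -
    (pw_affine N t u (clamp (s + h)) - pw_affine N t u (clamp s))| <= 2 * rho.
Proof.
move=> hp hrho s; rewrite /step_increment -(cell_clamp s hp) -(cell_clamp (s + h) hp).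
rewrite -/(clamp s) -/(clamp (s + h)).
have [a0 aT] := clampP s; have [b0 bT] := clampP (s + h).
have nb := pw_affine_near hp hrho rho0 b0 bT.
have na := pw_affine_near hp hrho rho0 a0 aT.
move: na nb; set x := u _; set y := u _; set x' := pw_affine _ _ _ _.
set y' := pw_affine _ _ _ _ => na nb.
rewrite subr_subACA (le_trans (ler_normB _ _))// mulr2n mulrDl mul1r.
by rewrite [`|y - _|]distrC [`|x - _|]distrC lerD.
Qed.

Let D_le (N : nat) (t : nat -> R) (u : nat -> H) s :
  (forall i j, (i <= N)%N -> (j <= N)%N -> `|u i - u j| <= B) ->
  `|step_increment N t u h s| <= B.
Proof. by apply; exact: cell_le. Qed.

(** An upper bound for [(|P| + 4 rho)^2 - |P|^2] when [|P| <= 2 B + 4 rho]; four replacements of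
    nodal by affine values, each costing [rho], give the [4 rho]. *)
Let c1 := 16 * rho * B + 48 * rho ^+ 2.

(** The parallelogram identity for the increments. Their difference depends on positions only and is
    at most [2 eta]; their sum is close to the increment [P] of the summed interpolants, which the
    summed speeds control. *)
Let D_pointwise s : - h < s -> s <= T ->
  2 * `|D1 s| ^+ 2 + 2 * `|D2 s| ^+ 2 <=
  h * window_integral T h k s + (c1 + 4 * eta ^+ 2).
Proof.
move=> hs sT.
have parallelogram : 2 * `|D1 s| ^+ 2 + 2 * `|D2 s| ^+ 2 =
    `|D1 s + D2 s| ^+ 2 + `|D1 s - D2 s| ^+ 2.
  by rewrite (sqr_normD hdot) (sqr_normB hdot); ring.
rewrite parallelogram.
have dist : `|D1 s - D2 s| <= 2 * eta.
  have [a0 aT] := clampP s; have [b0 bT] := clampP (s + h).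
  have := heta a0 aT; have := heta b0 bT; rewrite /clamp !cell_clamp// => hb ha.
  rewrite /D1 /D2 /step_increment subr_subACA (le_trans (ler_normB _ _))//.
  by rewrite mulr2n mulrDl mul1r lerD.
have dist2 : `|D1 s - D2 s| ^+ 2 <= 4 * eta ^+ 2.
  have -> : 4 * eta ^+ 2 = (2 * eta) ^+ 2 by ring.
  by rewrite ler_sqr ?nnegrE// mulr_ge0.
have sumP : `|(D1 s + D2 s) - P s| <= 4 * rho.
  have := D_near hp1 hrho1 s; have := D_near hp2 hrho2 s.
  rewrite -/(D1 s) -/(D2 s) /P /w.
  move: (D1 s) (D2 s) (pw_affine N1 t1 u1 (clamp s)) (pw_affine N2 t2 u2 (clamp s))
    (pw_affine N1 t1 u1 (clamp (s + h))) (pw_affine N2 t2 u2 (clamp (s + h))) =>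
    x y a1 a2 b1 b2 d2 d1.
  have -> : x + y - (b1 + b2 - (a1 + a2)) = (x - (b1 - a1)) + (y - (b2 - a2)).
    by rewrite !opprB [RHS]addrACA [a1 - b1 + _]addrACA -opprD.
  by rewrite (le_trans (ler_normD _ _))//; lra.
have D12 : `|D1 s + D2 s| <= 2 * B.
  rewrite (le_trans (ler_normD _ _))// mulr2n mulrDl mul1r lerD//.
    exact: D_le.
  exact: D_le.
have := P_le hs sT; move: sumP D12 dist2.
have : `|D1 s + D2 s| <= `|(D1 s + D2 s) - P s| + `|P s|.
  by have := ler_normD (D1 s + D2 s - P s) (P s); rewrite subrK.
have : `|P s| <= `|(D1 s + D2 s) - P s| + `|D1 s + D2 s|.
  by have := ler_normD (P s - (D1 s + D2 s)) (D1 s + D2 s); rewrite subrK [`|P s - _|]distrC.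
rewrite /c1.
have : 0 <= `|P s| by [].
have : 0 <= `|D1 s + D2 s| by [].
move: (`|D1 s + D2 s|) (`|P s|) (`|_ - P s|) (`|D1 s - D2 s| ^+ 2)
  (h * window_integral T h k s) => x p d y W x0 p0 pd xd d4 x2 y4 pW.
have xp : x <= p + 4 * rho by lra.
have pB : p <= 2 * B + 4 * rho by lra.
have : x ^+ 2 <= (p + 4 * rho) ^+ 2 by rewrite ler_sqr ?nnegrE// addr_ge0// mulr_ge0.
have : rho * p <= rho * (2 * B + 4 * rho) by rewrite ler_wpM2l.
nra.
Qed.

(** The parallelogram identity for the speeds: twice both kinetic energies minus the integral of
    [|v1 + v2|^2]. Each kinetic energy is at most the averaged one plus twice its [excess], and by
    [D_pointwise] the averaged energies are at most the integral of [|v1 + v2|^2] plus errors, so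
    this integral cancels. *)
Lemma pair_estimate :
  (\int[mu]_(s in `]0%R, T]) (`|pw_speed N1 t1 u1 s - pw_speed N2 t2 u2 s| ^+ 2)%:E <=
  (4 * (excess T e e' M xi1 h + excess T e e' M xi2 h)
   + (T + h) * (16 * rho * B + 48 * rho ^+ 2 + 4 * eta ^+ 2) / h ^+ 2)%:E)%E.
Proof.
have [iW W_le] := window_integral_le h0 mk (fun s => sqr_ge0 _) (ik 0 T).
have mT : - h <= T by rewrite (le_trans _ T0)// oppr_le0 ltW.
have iD (N : nat) (t : nat -> R) (u : nat -> H) (c : R) : is_partition T N t ->
    mu.-integrable `]- h, T] (EFin \o (fun s => `|c *: step_increment N t u h s| ^+ 2)).
  move=> hp; have mc := measurable_cell hp.
  have mch : measurable_fun [set: R] (fun s => cell N t (s + h)).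
    by apply: (measurableT_comp mc); exact: measurable_funD.
  by apply: (@integrable_nat_index2 _ N N (cell N t) (fun s => cell N t (s + h))
    (fun i j => `|c *: (u j - u i)| ^+ 2)) => // s; exact: cell_le.
have S1 := speed_le_step_increment hdot hf1 r0 e'0 h0 hr.
have S2 := speed_le_step_increment hdot hf2 r0 e'0 h0 hr.
rewrite -/D1 -/D2 in S1 S2.
have sumD : 2 * \int[mu]_(s in `]- h, T]) `|h^-1 *: D1 s| ^+ 2 +
    2 * \int[mu]_(s in `]- h, T]) `|h^-1 *: D2 s| ^+ 2 <=
    \int[mu]_(s in `]0, T]) k s + (T + h) * (c1 + 4 * eta ^+ 2) / h ^+ 2.
  rewrite -!RintegralZl//; [|exact: iD|exact: iD].
  rewrite -RintegralD//; [|by apply: integrable_rZ => //; exact: iD..].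
  apply: (@le_trans _ _ (\int[mu]_(s in `]- h, T])
      (h^-1 * window_integral T h k s + (c1 + 4 * eta ^+ 2) / h ^+ 2))).
    apply: le_Rintegral => //.
    - by apply: integrable_rD => //; apply: integrable_rZ => //; exact: iD.
    - by apply: integrable_rD => //; [exact: integrable_rZ|exact: integrable_cst_itvoc].
    move=> s /=; rewrite in_itv/= => /andP[hs sT].
    have := D_pointwise hs sT.
    have h2 : 0 <= (h ^+ 2)^-1 by rewrite invr_ge0 sqr_ge0.
    move=> /(ler_wpM2l h2).
    rewrite !normrZ !exprMn ger0_norm ?invr_ge0 ?(ltW h0)// exprVn.
    have -> : h^-1 * window_integral T h k s =
      (h ^+ 2)^-1 * (h * window_integral T h k s) by field; rewrite gt_eqF.
    by lra.
  rewrite RintegralD//; [|exact: integrable_rZ|exact: integrable_cst_itvoc].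
  rewrite (Rintegral_cst_itvoc ((c1 + 4 * eta ^+ 2) / h ^+ 2) mT) opprK.
  rewrite RintegralZl// mulrAC [_ * (T + h)]mulrC lerD2r.
  by rewrite ler_pdivrMl.
have E1 := integral_pw_speed u1 hp1; have E2 := integral_pw_speed u2 hp2.
have i1 : mu.-integrable `]0, T] (EFin \o (fun s => `|pw_speed N1 t1 u1 s| ^+ 2)).
  exact: (integrable_cell hp1 (fun j => `|speed t1 u1 j| ^+ 2)).
have i2 : mu.-integrable `]0, T] (EFin \o (fun s => `|pw_speed N2 t2 u2 s| ^+ 2)).
  exact: (integrable_cell hp2 (fun j => `|speed t2 u2 j| ^+ 2)).
have i12 : mu.-integrable `]0, T] (EFin \o (fun s =>
    `|pw_speed N1 t1 u1 s - pw_speed N2 t2 u2 s| ^+ 2)).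
  exact: (integrable_pair (fun i j => `|speed t1 u1 i - speed t2 u2 j| ^+ 2)).
suff : \int[mu]_(s in `]0, T])
    `|pw_speed N1 t1 u1 s - pw_speed N2 t2 u2 s| ^+ 2 <=
    4 * (excess T e e' M xi1 h + excess T e e' M xi2 h)
   + (T + h) * (16 * rho * B + 48 * rho ^+ 2 + 4 * eta ^+ 2) / h ^+ 2.
  by rewrite -lee_fin {1}/Rintegral fineK//; apply: integrable_fin_num.
have -> : \int[mu]_(s in `]0, T])
    `|pw_speed N1 t1 u1 s - pw_speed N2 t2 u2 s| ^+ 2 =
    2 * (\sum_(i < N1) (t1 i.+1 - t1 i) * `|speed t1 u1 i.+1| ^+ 2) +
    2 * (\sum_(i < N2) (t2 i.+1 - t2 i) * `|speed t2 u2 i.+1| ^+ 2) -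
    \int[mu]_(s in `]0, T]) k s.
  rewrite -(Rintegral_cell hp1 (fun j => `|speed t1 u1 j| ^+ 2)).
  rewrite -(Rintegral_cell hp2 (fun j => `|speed t2 u2 j| ^+ 2)).
  rewrite -!RintegralZl// -RintegralD//; [|exact: integrable_rZ..].
  rewrite -RintegralB//; last by apply: integrable_rD => //; exact: integrable_rZ.
  apply: eq_Rintegral => s _; rewrite /k /G -/(pw_speed _ _ _ _) -/(pw_speed _ _ _ _).
  by rewrite (sqr_normB hdot) (sqr_normD hdot); ring.
rewrite -/c1; lra.
Qed.

End PairEstimate.

(** * Gradients and subdifferentials *)

Section Gradient.
Context {R : realType} {H : completeNormedModType R}.
Variable dot : {dot H for idfun}.
Hypothesis hdot : induces_norm dot.
Variables (f : H -> R) (g : H -> H).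
Hypothesis fg : is_gradient dot f g.

Lemma gradient_near (u : H) (e : R) : 0 < e ->
  \forall w \near u, `|f w - f u - dot (g u) (w - u)| <= e * `|w - u|.
Proof.
move=> e0; have [fu dfu] := fg u.
have /eqaddoP /(_ _ e0) := diff_locally fu.
move=> /nbhs_ballP[d /= d0 hd]; apply/nbhs_ballP; exists d => //= w.
rewrite -ball_normE /= => uw.
have := hd (w - u); rewrite -ball_normE /= sub0r normrN distrC => /(_ uw).
by rewrite !fctE /= subrK dfu opprD addrA.
Qed.

Lemma is_derive_along (v k : H) (s : R) :
  is_derive s 1 (fun s => f (v + s *: k)) (dot (g (v + s *: k)) k).
Proof.
set z := v + s *: k.
suff L : h^-1 *: (f (v + (h + s) *: k) - f z) @[h --> (0:R)^'] --> dot (g z) k.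
  have [df dE] := @cvg_diff_quot_derivable R R (fun s => f (v + s *: k)) s _ L.
  by apply: DeriveDef; rewrite // -derive1E.
apply/cvgrPdist_le => e e0.
have k1 : 0 < `|k| + 1 by rewrite ltr_wpDl.
have ek : 0 < e / (`|k| + 1) by rewrite divr_gt0.
have [d /= d0 hd] := iffLR (nbhs_ballP _ _) (gradient_near z ek).
have dk : 0 < d / (`|k| + 1) by rewrite divr_gt0.
near=> h.
have h0 : h != 0 by near: h; exact: nbhs_dnbhs_neq.
have hdk : `|h| < d / (`|k| + 1) by near: h; exact: dnbhs0_lt.
have hk : `|h *: k| <= `|h| * (`|k| + 1) by rewrite normrZ ler_wpM2l// lerDl.
have := hd (z + h *: k); rewrite -ball_normE /= opprD addNKr normrN.
have -> : `|h *: k| < d by rewrite (le_lt_trans hk)// -ltr_pdivlMr.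
move=> /(_ isT); rewrite [z + h *: k - z]addrC addKr dotZr.
have -> : v + (h + s) *: k = z + h *: k by rewrite scalerDl [h *: k + _]addrC addrA.
set F := f _ - f z => Fz.
have -> : dot (g z) k - h^-1 *: F = - (h^-1 * (F - h * dot (g z) k)).
  by rewrite -[h^-1 *: F]/(h^-1 * F); field.
rewrite normrN normrM normfV ler_pdivrMl ?normr_gt0//.
rewrite (le_trans Fz)// (le_trans (ler_wpM2l (ltW ek) hk))//.
by rewrite mulrCA divfK ?gt_eqF.
Unshelve. all: by end_near. Qed.

Lemma gradient_mean_value (v w : H) :
  exists2 s, 0 < s < 1 & f w - f v = dot (g (v + s *: (w - v))) (w - v).
Proof.
have [||s] := @MVT R (fun s => f (v + s *: (w - v)))
  (fun s => dot (g (v + s *: (w - v))) (w - v)) 0 1 ltr01.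
- by move=> s _; exact: is_derive_along.
- apply: derivable_within_continuous => s _.
  by have [] := is_derive_along v (w - v) s.
rewrite in_itv/= scale0r addr0 scale1r [v + (w - v)]addrC subrK subr0 mulr1 => s01 E.
by exists s.
Qed.

(** The mean value point lies on the segment, hence in the ball, and two gradients in the ball
    differ by at most [2 e]. *)
Lemma gradient_ball_bound (x : H) (r e : R) :
  (forall y, ball x r y -> `|g y - g x| <= e) ->
  forall v w, ball x r v -> ball x r w ->
    f v + dot (g v) (w - v) - 2 * e * `|w - v| <= f w.
Proof.
move=> ge v w xv xw; have [s /andP[s0 s1] E] := gradient_mean_value v w.
have xz : ball x r (v + s *: (w - v)).
  move: xv xw; rewrite -ball_normE /= => xv xw.
  have -> : x - (v + s *: (w - v)) = (1 - s) *: (x - v) + s *: (x - w).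
    rewrite [in RHS]scalerBl scale1r -addrA -[s *: (x - w)]opprK -opprD -scalerBr.
    by rewrite subr_subACA subrr sub0r opprB opprD addrA.
  rewrite (le_lt_trans (ler_normD _ _))// !normrZ !ger0_norm ?subr_ge0 ?(ltW s0) ?(ltW s1)//.
  nra.
have d1 : `|g (v + s *: (w - v)) - g v| <= 2 * e.
  have := ler_normD (g (v + s *: (w - v)) - g x) (g x - g v).
  rewrite addrA subrK => /le_trans; apply.
  by rewrite mulr2n mulrDl mul1r [`|g x - _|]distrC lerD// ge.
have := ler_norm_dot hdot (g (v + s *: (w - v)) - g v) (w - v).
rewrite dotBl -E ler_norml => /andP[lo _].
have := ler_wpM2r (normr_ge0 (w - v)) d1; lra.
Qed.

End Gradient.

Section DotContinuity.
Context {R : realType} {H : completeNormedModType R}.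
Variable dot : {dot H for idfun}.
Hypothesis hdot : induces_norm dot.

Lemma cvg_dot (x y : nat -> H) (a b : H) :
  x n @[n --> \oo] --> a -> y n @[n --> \oo] --> b ->
  dot (x n) (y n) @[n --> \oo] --> dot a b.
Proof.
move=> xa yb; apply/cvgrPdist_le => e e0.
have b1 : 0 < `|b| + 1 by rewrite ltr_wpDl.
have a1 : 0 < `|a| + 1 by rewrite ltr_wpDl.
have e2b : 0 < e / 2 / (`|b| + 1) by rewrite !divr_gt0.
have e2a : 0 < e / 2 / (`|a| + 1) by rewrite !divr_gt0.
near=> n.
have yn : `|y n| <= `|b| + 1.
  have := ler_normB b (b - y n); rewrite subKr => /le_trans; apply.
  by rewrite lerD2l; near: n; exact: cvgr_dist_le.
have -> : dot a b - dot (x n) (y n) = dot (a - x n) (y n) + dot a (b - y n).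
  by rewrite dotBl dotBr; ring.
rewrite (le_trans (ler_normD _ _))// (splitr e) lerD//.
  rewrite (le_trans (ler_norm_dot hdot _ _))//.
  rewrite (le_trans (ler_wpM2l (normr_ge0 _) yn))// -ler_pdivlMr//.
  by near: n; exact: cvgr_dist_le.
rewrite (le_trans (ler_norm_dot hdot _ _))//.
apply: (@le_trans _ _ ((`|a| + 1) * `|b - y n|)).
  by rewrite ler_wpM2r// lerDl.
rewrite mulrC -ler_pdivlMr//; near: n; exact: cvgr_dist_le.
Unshelve. all: by end_near. Qed.

End DotContinuity.

Section Subdifferentials.
Context {R : realType} {H : completeNormedModType R}.
Variable dot : {dot H for idfun}.
Hypothesis hdot : induces_norm dot.
Local Open Scope ereal_scope.

(** Clearing the denominator removes the punctured neighbourhood, because the inequality is trivial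
    at [u], and leaves a form that allows the value [+oo] at [v]. *)
Lemma frechet_subdiffP (phi : H -> \bar R) (u xi : H) :
  (forall v, -oo < phi v) ->
  frechet_subdiff dot phi u xi <->
  phi u < +oo /\ forall e : R, (0 < e)%R -> \forall v \near u,
    phi u + (dot xi (v - u)%R - e * `|v - u|%R)%R%:E <= phi v.
Proof.
move=> phiNy; split => [[uy inf0]|[uy near_le]].
  have ufin : phi u \is a fin_num by rewrite fin_numE gt_eqF ?phiNy//= lt_eqF.
  split => // e e0.
  move: inf0; rewrite limf_einfE => inf0.
  have : (- e)%R%:E < ereal_sup [set ereal_inf
      [set (phi v - phi u - (dot xi (v - u)%R)%:E) * (`|v - u|^-1)%:E | v in V]
      | V in u^'].
    by apply: lt_le_trans inf0; rewrite lte_fin oppr_lt0.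
  move=> /ereal_sup_gt[_ [V Vu <-]] infV.
  move: Vu; rewrite /dnbhs /within /=; apply: filterS => v Vv.
  have [->|vu] := eqVneq v u.
    by rewrite subrr dot0r normr0 mulr0 subr0 adde0.
  have vu0 : (0 < `|v - u|)%R by rewrite normr_gt0 subr_eq0.
  have : (- e)%R%:E <= (phi v - phi u - (dot xi (v - u)%R)%:E) * (`|v - u|^-1)%:E.
    apply: le_trans (ltW infV) _; apply: ereal_inf_lbound.
    by exists v => //; exact: Vv.
  move: (phiNy v); rewrite -(fineK ufin); case: (phi v) => [b| |] // _.
    rewrite -!EFinD -EFinM !lee_fin ler_pdivlMr//; lra.
  by rewrite leey.
have ufin : phi u \is a fin_num by rewrite fin_numE gt_eqF ?phiNy//= lt_eqF.
split => //; rewrite limf_einfE; apply/lee_addgt0Pr => e e0.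
rewrite -leeBlDr// sub0e -EFinN.
pose V := [set v : H | v != u /\
  phi u + (dot xi (v - u)%R - e * `|v - u|%R)%R%:E <= phi v].
apply: (@le_trans _ _ (ereal_inf
  [set (phi v - phi u - (dot xi (v - u)%R)%:E) * (`|v - u|^-1)%:E | v in V])).
  apply: le_ereal_inf_tmp => _ [v [vu phiv] <-].
  have vu0 : (0 < `|v - u|)%R by rewrite normr_gt0 subr_eq0.
  move: (phiNy v) phiv; rewrite -(fineK ufin); case: (phi v) => [b| |] // _.
    rewrite -!EFinD -EFinM !lee_fin ler_pdivlMr//; lra.
  by move=> _; rewrite /= !addye// gt0_mulye ?lte_fin ?invr_gt0// leey.
apply: ereal_sup_ubound; exists V => //.
have := near_le e e0; rewrite /dnbhs /within /=; apply: filterS => v phiv vu.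
by split => //; apply/eqP.
Qed.

Lemma convex_subdiff_monotone (phi : H -> \bar R) (u v xi eta : H) :
  (forall v, -oo < phi v) ->
  convex_subdiff dot phi u xi -> convex_subdiff dot phi v eta ->
  (0 <= dot (xi - eta) (u - v))%R.
Proof.
move=> phiNy [uy /(_ v) le1] [vy /(_ u) le2].
have ufin : phi u \is a fin_num by rewrite fin_numE gt_eqF ?phiNy//= lt_eqF.
have vfin : phi v \is a fin_num by rewrite fin_numE gt_eqF ?phiNy//= lt_eqF.
move: le1 le2; rewrite -(fineK ufin) -(fineK vfin) -!EFinD !lee_fin.
rewrite dotBl -(opprB u v) dotNr; lra.
Qed.

(** In the subgradient inequality the left side passes to the limit by lower semicontinuity and the
    scalar product by joint continuity. Finiteness at the limit point comes from testing with one
    point where [phi] is finite. *)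
Lemma convex_subdiff_closed (phi : H -> \bar R) (u eta : H) (un etan : nat -> H) :
  proper_ereal phi -> lower_semicontinuous phi ->
  (forall n, convex_subdiff dot phi (un n) (etan n)) ->
  un n @[n --> \oo] --> u -> etan n @[n --> \oo] --> eta ->
  convex_subdiff dot phi u eta.
Proof.
move=> [phiNy [u1 u1y]] lsc subn unu etanu.
have dotcvg v : (dot (etan n) (v - un n) @[n --> \oo] --> dot eta (v - u))%R.
  by apply: (cvg_dot hdot) => //; apply: cvgB => //; exact: cvg_cst.
have key v (b : R) : phi v = b%:E -> phi u + (dot eta (v - u)%R)%:E <= b%:E.
  move=> phiv; rewrite -leeBrDr// -EFinB; apply/lee_addgt0Pr => e e0.
  rewrite -EFinD leNgt; apply/negP => /lsc[V Vu hV].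
  have /cvgrPdist_lt /(_ e e0) [m1 _ hm1] := dotcvg v.
  have [m2 _ hm2] := unu _ Vu.
  have := hm1 (maxn m1 m2) (leq_maxl _ _); have := hV _ (hm2 (maxn m1 m2) (leq_maxr _ _)).
  have [uy /(_ v)] := subn (maxn m1 m2); move: uy (phiNy (un (maxn m1 m2))).
  rewrite phiv /=; case: (phi (un (maxn m1 m2))) => [a| |] // _ _.
  by rewrite -EFinD lee_fin lte_fin ltr_norml => ? ? /andP[]; lra.
have uy : phi u < +oo.
  have u1fin : phi u1 \is a fin_num by rewrite fin_numE gt_eqF ?phiNy//= lt_eqF.
  have := key u1 (fine (phi u1)); rewrite fineK// => /(_ erefl).
  move: (phiNy u); case: (phi u) => [a| |] // _.
  by rewrite addye// leye_eq => /eqP u1oo; move: u1y; rewrite u1oo ltxx.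
split => // v; move: (phiNy v); case E : (phi v) => [b| |] // _; last by rewrite leey.
exact: key.
Qed.

End Subdifferentials.

Lemma holder_gradient_continuous {R : realType} {H : completeNormedModType R}
    (alpha : R) (g : H -> H) : 0 < alpha ->
  (forall u, exists L : R, exists2 r : R, 0 < r &
      forall v w, ball u r v -> ball u r w ->
        `|g v - g w| <= L * `|v - w| `^ alpha) -> continuous g.
Proof.
move=> alpha0 hg u; have [L [r r0 gL]] := hg u.
apply/cvgrPdist_le => e e0.
have L1 : 0 < `|L| + 1 by rewrite ltr_wpDl.
pose d := (e / (`|L| + 1)) `^ alpha^-1.
have d0 : 0 < d by apply: powR_gt0; rewrite divr_gt0.
have dE : d `^ alpha = e / (`|L| + 1).
  by rewrite /d -powRrM mulVf ?gt_eqF// powRr1// divr_ge0// ltW.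
near=> v.
have uv : `|u - v| < r by near: v; exact: cvgr_dist_lt.
have ud : `|u - v| <= d by near: v; apply: cvgr_dist_le.
apply: (le_trans (gL u v (ballxx _ r0) _)); first by rewrite -ball_normE.
apply: (@le_trans _ _ ((`|L| + 1) * `|u - v| `^ alpha)).
  by rewrite ler_wpM2r ?powR_ge0// (le_trans (ler_norm _))// lerDl.
rewrite mulrC -ler_pdivlMr//.
by rewrite -dE; apply: (ge0_ler_powR (ltW alpha0) _ _ ud); rewrite nnegrE// ltW.
Unshelve. all: by end_near. Qed.

Section SumSubdifferential.
Context {R : realType} {H : completeNormedModType R}.
Variable dot : {dot H for idfun}.
Hypothesis hdot : induces_norm dot.
Variables (phi phi1 : H -> \bar R) (phi2 : H -> R) (g : H -> H).
Hypothesis hphi : forall v, phi v = (phi1 v + (phi2 v)%:E)%E.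
Hypothesis phi1Ny : forall v, (-oo < phi1 v)%E.
Hypothesis phi2g : is_gradient dot phi2 g.

Lemma sum_phiNy v : (-oo < phi v)%E.
Proof. by rewrite hphi; move: (phi1Ny v); case: (phi1 v) => // b _; rewrite ltNyr. Qed.

Lemma sum_phi_fin v : (phi v < +oo)%E -> phi1 v = (fine (phi v) - phi2 v)%:E.
Proof.
rewrite hphi; move: (phi1Ny v); case: (phi1 v) => [a| |] //= _ _.
by rewrite addrK.
Qed.

(** From local to global: the first-order inequality is used at a point [w = s v + (1 - s) u] so
    near to [u] that it holds, convexity of [phi1] carries it to [v], and dividing by [s] leaves an
    error at most [e]. *)
Lemma frechet_subdiff_convex u xi : convex_ereal phi1 ->
  frechet_subdiff dot phi u xi -> convex_subdiff dot phi1 u (xi - g u).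
Proof.
move=> hconv /(frechet_subdiffP _ _ _ sum_phiNy)[uy near_le].
have phi1u := sum_phi_fin uy.
have ufin : phi u \is a fin_num by rewrite fin_numE gt_eqF ?sum_phiNy//= lt_eqF.
split => [|v]; first by rewrite phi1u ltry.
move: (phi1Ny v); case phi1v : (phi1 v) => [b1| |] // _; last by rewrite leey.
rewrite phi1u -EFinD lee_fin; apply/ler_addgt0Pr => e e0.
have k1 : 0 < `|v - u| + 1 by rewrite ltr_wpDl.
have d0 : 0 < e / 2 / (`|v - u| + 1) by rewrite !divr_gt0.
set d := e / 2 / (`|v - u| + 1) in d0.
have near1 := near_le _ d0; have near2 := gradient_near phi2g u d0.
have [r /= r0 hr] := iffLR (nbhs_ballP _ _) (filterI near1 near2).
pose s := Num.min 1 (r / 2 / (`|v - u| + 1)).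
have s0 : 0 < s by rewrite lt_min ltr01 !divr_gt0.
have s1 : s <= 1 by rewrite ge_min lexx.
have sr : s * `|v - u| < r.
  apply: (@le_lt_trans _ _ (r / 2 / (`|v - u| + 1) * (`|v - u| + 1))).
    by rewrite ler_pM// ?(ltW s0)// ?ge_min ?lexx ?orbT// lerDl.
  by rewrite divfK ?gt_eqF// ltr_pdivrMr// ltr_pMr// ltr1n.
pose w := s *: v + (1 - s) *: u.
have wu : w - u = s *: (v - u).
  by rewrite /w scalerBl scale1r addrCA [u + _]addrC addrK scalerBr.
have [] : (phi u + (dot xi (w - u) - d * `|w - u|)%:E <= phi w)%E /\
    `|phi2 w - phi2 u - dot (g u) (w - u)| <= d * `|w - u|.
  by apply: hr; rewrite -ball_normE /= -normrN opprB wu normrZ ger0_norm// ltW.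
have := hconv v u s; rewrite (ltW s0) s1 -/w phi1v phi1u => /(_ isT).
rewrite [phi w]hphi -(fineK ufin); move: (phi1Ny w).
case: (phi1 w) => [c| |] // _; rewrite -!EFinM -!EFinD !lee_fin.
rewrite wu normrZ (gtr0_norm s0) !dotZr dotBl ler_norml => cle ule /andP[_ up].
have ds : d * `|v - u| <= e / 2.
  by rewrite /d -mulrA ler_piMr ?divr_ge0 ?(ltW e0)// ler_pdivrMl// mulr1 lerDl.
move: cle ule up (ler_wpM2l (ltW s0) ds) => /= cle ule up dse.
rewrite -(ler_pM2l s0); lra.
Qed.

Lemma convex_subdiff_frechet u eta :
  convex_subdiff dot phi1 u eta -> frechet_subdiff dot phi u (eta + g u).
Proof.
move=> [uy sub]; apply/(frechet_subdiffP _ _ _ sum_phiNy).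
have ufin : phi1 u \is a fin_num by rewrite fin_numE gt_eqF ?phi1Ny//= lt_eqF.
split; first by rewrite hphi -(fineK ufin) -EFinD ltry.
move=> e e0; have := gradient_near phi2g u e0; apply: filterS => v.
rewrite ler_norml => /andP[lo _].
have := sub v; rewrite !hphi -(fineK ufin); move: (phi1Ny v).
case: (phi1 v) => [b| |] // _; last by move=> _; rewrite [leRHS]addye// leey.
by rewrite -!EFinD !lee_fin dotDl; lra.
Qed.

Hypothesis hconv : convex_ereal phi1.
Hypothesis hsv : single_valued (convex_subdiff dot phi1).

Lemma subgrad_convex_subdiff u : dom_subdiff dot phi u ->
  convex_subdiff dot phi1 u (subgrad dot phi u - g u).
Proof.
move=> [xi uxi]; apply: (frechet_subdiff_convex hconv).
by rewrite /subgrad; case: xgetP => [_ -> //|/(_ xi)].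
Qed.

(** Single-valuedness identifies the element that [subgrad] chooses: after subtracting [g u] it lies
    in the same singleton as [eta]. *)
Lemma convex_subdiff_subgrad u eta : convex_subdiff dot phi1 u eta ->
  dom_subdiff dot phi u /\ subgrad dot phi u = eta + g u.
Proof.
move=> ueta; have domu : dom_subdiff dot phi u.
  by exists (eta + g u); exact: convex_subdiff_frechet.
split => //; have /hsv[xi uxi] : convex_subdiff dot phi1 u !=set0 by exists eta.
have := subgrad_convex_subdiff domu; move: ueta; rewrite uxi /= => -> E.
by rewrite -E subrK.
Qed.

Lemma dom_subdiff_fin u : dom_subdiff dot phi u -> phi u \is a fin_num.
Proof. by move=> [xi [uy _]]; rewrite fin_numE gt_eqF ?sum_phiNy//= lt_eqF. Qed.

Lemma energy_subdiff u v : dom_subdiff dot phi u -> dom_subdiff dot phi v ->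
  forall e, phi2 u + dot (g u) (v - u) - e * `|v - u| <= phi2 v ->
  fine (phi u) + dot (subgrad dot phi u) (v - u) - e * `|v - u| <= fine (phi v).
Proof.
move=> du dv e le2; have [uy /(_ v)] := subgrad_convex_subdiff du.
have uy' : (phi u < +oo)%E by case: du => xi [].
have vy' : (phi v < +oo)%E by case: dv => xi [].
rewrite (sum_phi_fin uy') (sum_phi_fin vy') -EFinD lee_fin dotBl; lra.
Qed.

End SumSubdifferential.

Section CompactBounds.
Context {R : realType} {H : completeNormedModType R}.
Variable dot : {dot H for idfun}.
Hypothesis hdot : induces_norm dot.
Variable K : set H.
Hypothesis cK : compact K.

Lemma compact_norm_bound : exists2 B, 0 <= B & forall v, K v -> `|v| <= B.
Proof.
have [B [Breal hB]] := compact_bounded cK.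
exists (`|B| + 1); first by rewrite addr_ge0.
by move=> v Kv; apply: (hB (`|B| + 1)) => //; rewrite (le_lt_trans (ler_norm _))// ltrDl.
Qed.

Variables (f : H -> R) (g : H -> H).
Hypotheses (fg : is_gradient dot f g) (cg : continuous g).

Lemma compact_gradient_lower_bound : exists m, forall v, K v -> m <= f v.
Proof.
have /compact_near_coveringP cov := cK.
have := cov R (+oo%R) (fun B v => `|f v| <= B) _.
case => [x Kx|B [Breal hB]].
  have fx : {for x, continuous f}.
    by apply: differentiable_continuous; case: (fg x).
  have /cvgrPdist_le /(_ 1 ltr01) fx1 := fx.
  near=> y B => /=.
  have fxy : `|f x - f y| <= 1 by near: y.
  have xB : `|f x| + 1 <= B by near: B; exact: nbhs_pinfty_ge.
  have := ler_normB (f x) (f x - f y); rewrite subKr => /le_trans; apply.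
  by rewrite (le_trans _ xB)// lerD2l.
exists (- (`|B| + 1)) => v Kv.
have /= := hB (`|B| + 1) _ v Kv; rewrite (le_lt_trans (ler_norm _)) ?ltrDl// => /(_ isT).
by rewrite ler_norml => /andP[].
Unshelve. all: by end_near. Qed.

(** Continuity of the gradient gives the inequality on a ball around each point, and compactness a
    common radius. Only [v] ranges over [K]; [w] is any nearby point. *)
Lemma compact_semiconvex (e : R) : 0 < e -> exists2 r, 0 < r &
  forall v w, K v -> `|w - v| < r -> f v + dot (g v) (w - v) - e * `|w - v| <= f w.
Proof.
move=> e0; have /compact_near_coveringP cov := cK.
have := cov R (0 : R)^'+ (fun r v => forall w, `|w - v| < r ->
  f v + dot (g v) (w - v) - e * `|w - v| <= f w) _.
case => [x Kx|d /= d0 hd].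
  have e2 : 0 < e / 2 by rewrite divr_gt0.
  have gx : \forall y \near x, `|g x - g y| <= e / 2.
    have gxc : {for x, continuous g} by exact: cg.
    by move/cvgrPdist_le : gxc => /(_ _ e2).
  have [r /= r0 hr] := iffLR (nbhs_ballP _ _) gx.
  have bound := gradient_ball_bound hdot fg (x := x) (r := r) (e := e / 2).
  have r2 : 0 < r / 2 by rewrite divr_gt0.
  near=> v d => /= w wv.
  have xv : `|x - v| < r / 2 by near: v; exact: cvgr_dist_lt.
  have dr : d < r / 2 by near: d; exact: nbhs_right_lt.
  have e22 : 2 * (e / 2) = e by field.
  have -> : e * `|w - v| = 2 * (e / 2) * `|w - v| by rewrite e22.
  apply: bound.
  - by move=> y /hr /=; rewrite distrC.
  - by rewrite -ball_normE /= (lt_trans xv)// gtr_pMr// invf_lt1// ltr1n.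
  - rewrite -ball_normE /=; have := ler_normD (x - v) (v - w).
    rewrite addrA subrK => /le_lt_trans; apply.
    by rewrite (splitr r) ltrD// distrC (lt_trans wv).
have d2 : 0 < d / 2 by rewrite divr_gt0.
exists (d / 2) => // v w Kv wv.
have := hd (d / 2); rewrite /= sub0r normrN gtr0_norm//.
rewrite gtr_pMr// invf_lt1// ltr1n => /(_ isT d2); exact.
Unshelve. all: by end_near. Qed.

End CompactBounds.

(** * Passage to the limit *)

Section ClusterCurve.
Context {R : realType} {V : normedModType R}.
Variables (K : set V) (v : nat -> R -> V) (M T : R) (tau : nat -> R).
Hypotheses (cK : compact K) (M0 : 0 <= M) (T0 : 0 < T).
Hypothesis tau0 : tau n @[n --> \oo] --> 0.
Hypothesis vK : \forall n \near \oo, forall s, K (v n s).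
Hypothesis v_equi : \forall n \near \oo, forall s s', s <= s' ->
  `|v n s' - v n s| ^+ 2 <= M * (s' - s + tau n).

(** Tychonoff in the product of copies of [K] over all times. A cluster point for pointwise
    convergence is approached on any finite set of times, by indices in any prescribed eventual set
    [P]. *)
Let cluster_on_finite_sets : exists u : R -> V,
  forall (L : seq R) (e : R) (P : set nat), 0 < e -> (\forall n \near \oo, P n) ->
    exists2 n, P n & forall s, s \in L -> `|v n s - u s| < e.
Proof.
have cprod := @tychonoff R (fun=> V) (fun=> K) (fun=> cK).
have [|u [_ cu]] := cprod (v n @[n --> \oo]) _ _.
  by apply: filterS vK => n vn s; exact: vn.
exists u => L e P e0 Pn.
have nbhsL : nbhs u [set f : R -> V | forall s, s \in L -> `|f s - u s| < e].
  elim: L => [|s L IH]; first by apply: filterS filterT => f _ s.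
  have us : nbhs u [set f : R -> V | `|f s - u s| < e].
    have : nbhs (u s) [set x | `|x - u s| < e].
      by apply/nbhs_ballP; exists e => //= x; rewrite -ball_normE /= distrC.
    exact: (@proj_continuous R (fun=> V) s u).
  apply: filterS2 us IH => f fs fL x; rewrite inE => /orP[/eqP -> //|]; exact: fL.
have FP : (v n @[n --> \oo]) [set f | exists2 n, P n & f = v n].
  by apply: filterS Pn => n Pn; exists n.
have [f [[n Pn' ->] fL]] := cu _ _ FP nbhsL.
by exists n.
Qed.

(** The modulus of continuity passes to [u], and with it closeness on a finite grid becomes uniform
    closeness. One index per tolerance is produced; a subsequence is selected later, once the
    tolerances are known. *)
Lemma cluster_curve : exists u : R -> V,
  (forall s s', s <= s' -> `|u s' - u s| ^+ 2 <= M * (s' - s)) /\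
  forall (e : R) (P : set nat), 0 < e -> (\forall n \near \oo, P n) ->
    exists2 n, P n & forall s, 0 <= s -> s <= T -> `|v n s - u s| <= e.
Proof.
have [u uL] := cluster_on_finite_sets.
have near_tau e : 0 < e -> \forall n \near \oo, M * tau n <= e.
  move=> e0; have M1 : 0 < M + 1 by rewrite ltr_wpDl.
  have eM : 0 < e / (M + 1) by rewrite divr_gt0.
  move/cvgrPdist_le : tau0 => /(_ _ eM); apply: filterS => n.
  rewrite sub0r normrN => taun.
  apply: (@le_trans _ _ ((M + 1) * `|tau n|)).
    by rewrite (le_trans (ler_norm _))// normrM ger0_norm// ler_wpM2r// lerDl.
  by rewrite mulrC -ler_pdivlMr.
have uH s s' : s <= s' -> `|u s' - u s| ^+ 2 <= M * (s' - s).
  move=> ss'; set c := M * (s' - s).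
  have c0 : 0 <= c by rewrite mulr_ge0// subr_ge0.
  apply/ler_addgt0Pr => d d0.
  (* With [b^2 <= c + e], [b <= c + 2] and [e <= 1], the square [(b + 2 e)^2] is at most
     [c + e (4 c + 13)]. *)
  pose e := Num.min 1 (d / (4 * c + 13)).
  have e0 : 0 < e.
    by rewrite lt_min ltr01 divr_gt0// ltr_wpDl// mulr_ge0.
  have e1 : e <= 1 by rewrite ge_min lexx.
  have ed : e * (4 * c + 13) <= d.
    by rewrite -ler_pdivlMr ?ge_min ?lexx ?orbT// ltr_wpDl// mulr_ge0.
  have [n [vn taun] vu] := uL [:: s; s'] e _ e0 (filterI v_equi (near_tau e e0)).
  have vs : `|v n s - u s| < e by apply: vu; rewrite inE eqxx.
  have vs' : `|v n s' - u s'| < e by apply: vu; rewrite !inE eqxx orbT.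
  have := vn _ _ ss'; rewrite mulrDr -/c => vv.
  have uv : `|u s' - u s| <= `|v n s' - v n s| + 2 * e.
    have -> : u s' - u s = (v n s' - v n s) - ((v n s' - u s') - (v n s - u s)).
      by rewrite subr_subACA !subKr.
    rewrite (le_trans (ler_normB _ _))// lerD2l (le_trans (ler_normB _ _))//.
    by rewrite mulr2n mulrDl mul1r lerD// ltW.
  move: vv uv; move: (`|v n s' - v n s|) (normr_ge0 (v n s' - v n s)) => b b0 bb uv.
  have bc : b ^+ 2 <= c + e by lra.
  have c20 : 0 <= c + 2 by rewrite addr_ge0.
  have bc2 : b <= c + 2.
    rewrite leNgt; apply/negP => cb; have : (c + 2) ^+ 2 < b ^+ 2.
      by rewrite ltr_sqr ?nnegrE.
    nra.
  have : `|u s' - u s| ^+ 2 <= (b + 2 * e) ^+ 2.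
    by rewrite ler_sqr ?nnegrE// addr_ge0// mulr_ge0// ltW.
  have : e * b <= e * (c + 2) by rewrite ler_wpM2l// ltW.
  have : e ^+ 2 <= e by rewrite expr2 ler_piMr// ltW.
  nra.
exists u; split => // e P e0 Pn.
have e3 : 0 < e / 3 by rewrite divr_gt0.
have e9 : 0 < (e / 3) ^+ 2 / 2 by rewrite divr_gt0// exprn_gt0.
have M1 : 0 < M + 1 by rewrite ltr_wpDl.
(* The grid spacing: over one spacing both [u] and [v n] move by at most [e/3], the mesh term of
   [v_equi] taking the other half of [(e/3)^2]. *)
pose d := (e / 3) ^+ 2 / 2 / (M + 1).
have d0 : 0 < d by rewrite divr_gt0.
have Md : M * d <= (e / 3) ^+ 2 / 2.
  apply: (@le_trans _ _ ((M + 1) * d)); first by rewrite ler_wpM2r ?lerDl// ltW.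
  by rewrite /d mulrC divfK// gt_eqF.
pose L := [seq j%:R * d | j <- iota 0 (Num.truncn (T / d)).+1].
have [n [[Pn' vn] taun] vu] :=
  uL L (e / 3) _ e3 (filterI (filterI Pn v_equi) (near_tau _ e9)).
exists n => // s s0 sT.
pose j := Num.truncn (s / d).
have sd0 : 0 <= s / d by rewrite divr_ge0// ltW.
have /andP[js sj] := truncn_itv sd0.
have jL : j%:R * d \in L.
  apply/mapP; exists j => //; rewrite mem_iota/= add0n ltnS.
  have Td0 : 0 <= T / d by rewrite divr_ge0// ltW.
  have /andP[_ TS] := truncn_itv Td0.
  by rewrite truncn_le_nat (le_lt_trans _ TS)// ler_wpM2r// invr_ge0 ltW.
have {}js : j%:R * d <= s by rewrite -ler_pdivlMr.
have {}sj : s - j%:R * d <= d.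
  by rewrite lerBlDr -[X in X + _]mul1r -mulrDl nat1r -ler_pdivrMr// ltW.
have sq x : 0 <= x -> x ^+ 2 <= (e / 3) ^+ 2 -> x <= e / 3.
  by move=> x0; rewrite ler_sqr// nnegrE// ltW.
have vj : `|v n s - v n (j%:R * d)| <= e / 3.
  apply: sq => //; apply: (le_trans (vn _ _ js)).
  have := ler_wpM2l M0 sj; rewrite mulrDr; lra.
have uj : `|u s - u (j%:R * d)| <= e / 3.
  apply: sq => //; apply: (le_trans (uH _ _ js)).
  have := ler_wpM2l M0 sj; lra.
have vuj := vu _ jL.
have -> : v n s - u s = (v n s - v n (j%:R * d)) +
    ((v n (j%:R * d) - u (j%:R * d)) - (u s - u (j%:R * d))).
  by rewrite subr_subACA subrr subr0 addrA subrK.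
rewrite (le_trans (ler_normD _ _))//.
have := ler_normB (v n (j%:R * d) - u (j%:R * d)) (u s - u (j%:R * d)).
lra.
Qed.

End ClusterCurve.

Lemma near_le_cvg0 {R : realType} (a : nat -> R) (c e : R) :
  a n @[n --> \oo] --> 0 -> 0 <= c -> 0 < e ->
  \forall n \near \oo, c * a n <= e.
Proof.
move=> a0 c0 e0; have c1 : 0 < c + 1 by rewrite ltr_wpDl.
have ec : 0 < e / (c + 1) by rewrite divr_gt0.
move/cvgrPdist_le : a0 => /(_ _ ec); apply: filterS => n.
rewrite sub0r normrN => an.
apply: (@le_trans _ _ ((c + 1) * `|a n|)).
  by rewrite (le_trans (ler_norm _))// normrM ger0_norm// ler_wpM2r// lerDl.
by rewrite mulrC -ler_pdivlMr.
Qed.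

(** * Energy bounds for the scheme *)

Section Scheme.
Context {R : realType} {H : completeNormedModType R}.
Variable dot : {dot H for idfun}.
Hypothesis hdot : induces_norm dot.
Variables (phi phi1 : H -> \bar R) (phi2 : H -> R) (g : H -> H) (T : R).
Hypothesis hphi : forall v, phi v = (phi1 v + (phi2 v)%:E)%E.
Hypothesis hcpt : compact_sublevels phi.
Hypotheses (hconv : convex_ereal phi1) (hprop : proper_ereal phi1).
Hypothesis hsv : single_valued (convex_subdiff dot phi1).
Hypotheses (phi2g : is_gradient dot phi2 g) (cg : continuous g).
Hypothesis hT : 0 < T.
Variables (N : nat -> nat) (t : nat -> nat -> R).
Hypothesis hpart : forall n, is_partition T (N n) (t n).
Hypothesis htau : diameter (N n) (t n) @[n --> \oo] --> 0.
Variables (u0 : H) (un : nat -> nat -> H).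
Hypothesis hdom : forall n i, (i <= N n)%N -> dom_subdiff dot phi (un n i).
Hypothesis hinit : forall n, un n 0%N = u0.
Hypothesis hres : (\sum_(1 <= i < (N n).+1)
    maxe (residual dot phi (tstep (t n) i) (un n i) (un n i.-1)) 0)%E
  @[n --> \oo] --> 0%E.

Local Notation mu := (@lebesgue_measure R).
Let phi1Ny : forall v, (-oo < phi1 v)%E. Proof. by case: hprop. Qed.
Let energy n i := fine (phi (un n i)).
Let slope n i := subgrad dot phi (un n i).
Let mesh n := diameter (N n) (t n).

Let energyE n i : (i <= N n)%N -> phi (un n i) = (energy n i)%:E.
Proof.
move=> iN; rewrite /energy fineK//.
exact: (dom_subdiff_fin hphi phi1Ny (hdom iN)).
Qed.

Let defect n i := energy n i.+1 - energy n i
  + (t n i.+1 - t n i) / 2 * `|speed (t n) (un n) i.+1| ^+ 2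
  + (t n i.+1 - t n i) / 2 * `|slope n i.+1| ^+ 2.

Let total_residual n := \sum_(i < N n) Num.max (defect n i) 0.

Let total_residual_cvg : total_residual n @[n --> \oo] --> 0.
Proof.
have E : (fun n => \sum_(1 <= i < (N n).+1)
    maxe (residual dot phi (tstep (t n) i) (un n i) (un n i.-1)) 0)%E =
    EFin \o total_residual.
  apply/funext => n /=; rewrite big_add1 big_mkord -sumEFin; apply: eq_bigr => i _.
  rewrite /residual /= (energyE (ltn_ord i)) (energyE (ltnW (ltn_ord i))).
  rewrite -!EFinD -EFin_max; congr (Num.max _ _)%:E.
  by rewrite /defect /speed /tstep /slope /=; ring.
by move: hres; rewrite E => /fine_cvgP[].
Qed.

Let mesh_step n i : (i < N n)%N -> t n i.+1 - t n i <= mesh n.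
Proof.
move=> iN; rewrite /mesh /diameter big_add1 /= big_mkord.
exact: (le_bigmax _ (fun i : 'I_(N n) => tstep (t n) i.+1) (Ordinal iN)).
Qed.

Let mesh_ge0 n : 0 <= mesh n.
Proof. by rewrite /mesh /diameter; apply: bigmax_ge_id. Qed.

Let E0 := energy 0%N 0%N.

Let energy0 n : energy n 0%N = E0.
Proof. by rewrite /E0 /energy !hinit. Qed.

Let tstep0 n i : (i < N n)%N -> 0 < t n i.+1 - t n i.
Proof. by move=> iN; rewrite subr_gt0 (partition_lt (hpart n)). Qed.

(** The positive parts control every partial sum, so the energy is bounded at every node and not
    only at the last one. *)
Let defect_sum n k : (k <= N n)%N ->
  \sum_(i < k) defect n i <= total_residual n.
Proof.
move=> kN; rewrite /total_residual -(big_mkord xpredT (fun i => Num.max (defect n i) 0)).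
rewrite (big_cat_nat (leq0n k) kN)/= big_mkord -[leLHS]addr0 lerD//.
  by apply: ler_sum => i _; rewrite le_max lexx.
by apply: sumr_ge0 => i _; rewrite le_max lexx orbT.
Qed.

Let energy_bound n k : (k <= N n)%N ->
  energy n k + 2^-1 * (\sum_(i < k) (t n i.+1 - t n i) * `|speed (t n) (un n) i.+1| ^+ 2)
  <= E0 + total_residual n.
Proof.
move=> kN; have := defect_sum kN; rewrite /defect !big_split/=.
have -> : \sum_(i < k) energy n i.+1 + \sum_(i < k) - energy n i = energy n k - E0.
  rewrite -big_split/= -(energy0 n) -(telescope_sumr (energy n) (leq0n k)).
  by rewrite big_mkord.
have : 0 <= \sum_(i < k) (t n i.+1 - t n i) / 2 * `|slope n i.+1| ^+ 2.
  apply: sumr_ge0 => i _; rewrite mulr_ge0 ?sqr_ge0// divr_ge0// ltW// tstep0//.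
  exact: leq_trans (ltn_ord i) kN.
have -> : \sum_(i < k) (t n i.+1 - t n i) / 2 * `|speed (t n) (un n) i.+1| ^+ 2 =
    2^-1 * \sum_(i < k) (t n i.+1 - t n i) * `|speed (t n) (un n) i.+1| ^+ 2.
  by rewrite mulr_sumr; apply: eq_bigr => i _; rewrite mulrAC mulrC.
lra.
Qed.

Let K := [set v | (phi v <= (E0 + 1)%:E)%E].

Let cK : compact K. Proof. exact: hcpt. Qed.

Let un_K : \forall n \near \oo, forall i, (i <= N n)%N -> K (un n i).
Proof.
have := near_le_cvg0 total_residual_cvg ler01 ltr01; apply: filterS => n.
rewrite mul1r => r1 i iN; rewrite /K /= (energyE iN) lee_fin.
have := energy_bound iN.
have : 0 <= \sum_(j < i) (t n j.+1 - t n j) * `|speed (t n) (un n) j.+1| ^+ 2.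
  apply: sumr_ge0 => j _; rewrite mulr_ge0 ?sqr_ge0// ltW// tstep0//.
  exact: leq_trans (ltn_ord j) iN.
lra.
Qed.

(** The subgradient of [phi1] at [u0] gives an affine minorant, bounded below on the bounded set
    [K]; [phi2] is bounded below on [K] because it is continuous. *)
Let energy_lower_bound : exists m, forall v, K v -> (m%:E <= phi v)%E.
Proof.
have [B B0 hB] := compact_norm_bound cK.
have [m hm] := compact_gradient_lower_bound cK phi2g.
have [_ /=] := subgrad_convex_subdiff hphi phi1Ny phi2g hconv (hdom (leq0n (N 0%N))).
rewrite hinit => sub.
have du0 : dom_subdiff dot phi u0 by rewrite -(hinit 0%N); exact: hdom.
have u0y : (phi u0 < +oo)%E by case: du0 => xi [].
set eta := subgrad dot phi u0 - g u0 in sub.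
exists (fine (phi u0) - phi2 u0 - `|eta| * (B + `|u0|) + m) => v Kv.
have := sub v; rewrite (sum_phi_fin hphi phi1Ny u0y) -EFinD => le1.
rewrite (hphi v) EFinD leeD// ?lee_fin ?hm//; apply: le_trans le1.
rewrite lee_fin lerD2l lerNl -dotNr (le_trans (dot_le hdot _ _))//.
by rewrite ler_wpM2l// normrN (le_trans (ler_normB _ _))// lerD2r hB.
Qed.

(** The order of quantifiers matters: [M] is fixed before [e'], so that [e' (T + M)] can be made
    small, and only the radius [r] and the starting index depend on [e']. *)
Lemma scheme_discrete_flow : exists (K : set H) (er : nat -> R) (M B : R),
  [/\ compact K, er n @[n --> \oo] --> 0, 0 <= M, 0 <= B &
  forall e' : R, 0 < e' -> exists2 r : R, 0 < r & \forall n \near \oo,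
    [/\ discrete_flow dot T r (er n) e' M (diameter (N n) (t n)) (N n) (t n)
          (un n) (fun i => subgrad dot phi (un n i)) (fun i => fine (phi (un n i))),
        forall i, (i <= N n)%N -> K (un n i)
      & forall i j, (i <= N n)%N -> (j <= N n)%N -> `|un n i - un n j| <= B]].
Proof.
have [m hm] := energy_lower_bound; have [B B0 hB] := compact_norm_bound cK.
have mE0 : m <= E0 + 1.
  have := hm u0; rewrite /K/= -(hinit 0%N) energyE// => h.
  have : ((energy 0%N 0%N)%:E <= (E0 + 1)%:E)%E by rewrite lee_fin lerDl.
  by move=> /h; rewrite lee_fin => /le_trans; apply; rewrite lerDl.
(* The squared L2 norm of the speed is at most twice the drop of the energy, from [E0 + 1] at most
   to [m] at least. *)
exists K, total_residual, (2 * (E0 + 1 - m)), (2 * B); split => //.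
- by rewrite mulr_ge0// subr_ge0.
- by rewrite mulr_ge0.
move=> e' e'0; have [r r0 hr] := compact_semiconvex hdot cK phi2g cg e'0.
exists r => //.
near=> n.
have Kn : forall i, (i <= N n)%N -> K (un n i) by near: n; exact: un_K.
have r1 : 1 * total_residual n <= 1.
  by near: n; exact: near_le_cvg0 total_residual_cvg ler01 ltr01.
split => //; last first.
  move=> i j iN jN; rewrite (le_trans (ler_normB _ _))// mulr2n mulrDl mul1r.
  by rewrite lerD// hB//; exact: Kn.
split.
- exact: hpart.
- exact: mesh_ge0.
- by move=> i; exact: mesh_step.
- exact: (defect_sum (leqnn _)).
- move=> j k jN kN ujk.
  apply: (energy_subdiff hphi phi1Ny phi2g hconv (hdom jN) (hdom kN)).
  exact: hr (Kn _ jN) ujk.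
have := energy_bound (leqnn (N n)); have := hm _ (Kn _ (leqnn _)).
rewrite energyE// lee_fin; lra.
Unshelve. all: by end_near. Qed.

End Scheme.

(** * Choice of the window length and of the tolerances *)

Section CauchyEstimate.
Context {R : realType} {H : completeNormedModType R}.
Variable dot : {dot H for idfun}.
Hypothesis hdot : induces_norm dot.
Local Notation mu := (@lebesgue_measure R).
Variables (T M B : R) (N : nat -> nat) (t : nat -> nat -> R)
  (u xi : nat -> nat -> H) (f : nat -> nat -> R) (er tm : nat -> R) (x0 : H).
Hypotheses (hT : 0 < T) (M0 : 0 <= M) (B0 : 0 <= B).
Hypothesis er0 : er n @[n --> \oo] --> 0.
Hypothesis tm0 : tm n @[n --> \oo] --> 0.
Hypothesis xi0 : forall n, xi n 0%N = x0.
Hypothesis flows : forall e' : R, 0 < e' -> exists2 r : R, 0 < r &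
  \forall n \near \oo,
    discrete_flow dot T r (er n) e' M (tm n) (N n) (t n) (u n) (xi n) (f n) /\
    forall i j, (i <= N n)%N -> (j <= N n)%N -> `|u n i - u n j| <= B.

Lemma discrete_step_le (r e e' a : R) n :
  discrete_flow dot T r e e' M a (N n) (t n) (u n) (xi n) (f n) ->
  forall i, (i < N n)%N -> `|u n i.+1 - u n i| ^+ 2 <= a * M.
Proof.
move=> hf i iN; have tau0 := tstep_gt0 hf iN.
rewrite -(scale_speed hf iN) normrZ gtr0_norm// exprMn.
apply: (@le_trans _ _ ((t n i.+1 - t n i) * M)).
  rewrite expr2 -mulrA ler_wpM2l ?(ltW tau0)//.
  apply: le_trans (df_speed hf); rewrite (bigD1 (Ordinal iN))//= lerDl.
  by apply: sumr_ge0 => j _; rewrite mulr_ge0 ?sqr_ge0// ltW// (tstep_gt0 hf).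
by rewrite ler_wpM2r// (df_step hf).
Qed.

(** Each constant depends only on the preceding ones: [e'] on [e], then [r], then [h], then [eta]
    and a bound [k] on single steps, both absorbing the division by [h^2], and last the index
    [n0]. *)
Lemma discrete_flow_cauchy (e : R) : 0 < e -> exists h eta : R,
  [/\ 0 < h, h <= e, 0 < eta & exists n0, forall n m, (n0 <= n)%N -> (n0 <= m)%N ->
   (forall s, 0 <= s -> s <= T ->
      `|u n (cell (N n) (t n) s) - u m (cell (N m) (t m) s)| <= eta) ->
   (\int[mu]_(s in `]0%R, T]) (`|pw_speed (N n) (t n) (u n) s
        - pw_speed (N m) (t m) (u m) s| ^+ 2)%:E <= e%:E)%E /\
   (\int[mu]_(s in `]0%R, T]) (`|xi n (cell (N n) (t n) s)
        + h^-1 *: step_increment (N n) (t n) (u n) h s| ^+ 2)%:E <= e%:E)%E].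
Proof.
move=> e0.
have TM : 0 < T + M by rewrite ltr_wpDr.
(* Each of the three terms of [excess] receives [e/48], so [excess <= e/16], and two schemes
   contribute [4 (e/16 + e/16) = e/2] to [pair_estimate]; the other half goes in equal parts to
   [eta] and [k]. *)
have [e' [e'0 e'E]] : exists e', 0 < e' /\ e' * ((T + M) / 2) = e / 48.
  exists (e / 24 / (T + M)); split; first by rewrite !divr_gt0.
  by field; rewrite gt_eqF.
have [r r0 near_flow] := flows e'0.
have x1 : 0 < `|x0| ^+ 2 + 1 by rewrite ltr_wpDl// sqr_ge0.
have M1 : 0 < M + 1 by rewrite ltr_wpDl.
have [h [h0 he hx hr]] : exists h, [/\ 0 < h, h <= e,
    h / 2 * `|x0| ^+ 2 <= e / 48 & 2 * h * M < r ^+ 2].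
  pose a := e / 24 / (`|x0| ^+ 2 + 1); pose b := r ^+ 2 / 2 / (M + 1).
  have a0 : 0 < a by rewrite !divr_gt0.
  have b0 : 0 < b by rewrite !divr_gt0// exprn_gt0.
  exists (Num.min e (Num.min a b)); set h := Num.min e _.
  have h0 : 0 < h by rewrite !lt_min e0 a0.
  have ha : h <= a by rewrite !ge_min lexx orbT.
  have hb : h <= b by rewrite !ge_min lexx !orbT.
  split => //; first by rewrite ge_min lexx.
    apply: (@le_trans _ _ (a / 2 * (`|x0| ^+ 2 + 1))).
      by rewrite ler_pM ?sqr_ge0 ?divr_ge0 ?(ltW h0) ?lerDl// ler_pM2r.
    by rewrite le_eqVlt; apply/orP; left; apply/eqP; rewrite /a; field; rewrite gt_eqF.
  apply: (@lt_le_trans _ _ (2 * b * (M + 1))).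
    apply: (@le_lt_trans _ _ (2 * b * M)); first by rewrite ler_wpM2r// ler_pM2l.
    have bb : 0 < 2 * b by rewrite mulr_gt0.
    by rewrite (ltr_pM2l bb) ltrDl.
  by rewrite le_eqVlt; apply/orP; left; apply/eqP; rewrite /b; field; rewrite gt_eqF.
have Th : 0 < T + h by rewrite addr_gt0.
have [eta [eta0 etaE]] : exists eta, 0 < eta /\ (T + h) * (4 * eta ^+ 2) / h ^+ 2 <= e / 4.
  pose b := e * h ^+ 2 / (16 * (T + h)).
  have b0 : 0 < b by rewrite divr_gt0// mulr_gt0// exprn_gt0.
  exists (Num.min 1 b); set x := Num.min 1 b.
  have x00 : 0 < x by rewrite lt_min ltr01.
  have xb : x <= b by rewrite ge_min lexx orbT.
  split => //; apply: (@le_trans _ _ ((T + h) * (4 * b) / h ^+ 2)); last first.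
    by rewrite le_eqVlt; apply/orP; left; apply/eqP; rewrite /b; field; rewrite !gt_eqF.
  rewrite ler_pM2r ?invr_gt0 ?exprn_gt0// ler_pM2l// ler_pM2l//.
  by rewrite (le_trans _ xb)// expr2 ler_piMl ?(ltW x00)// ge_min lexx.
(* [k] plays the role of [rho] in [pair_estimate]; since [k <= 1],
   [16 k B + 48 k^2 <= k (16 B + 48)]. *)
have [k [k0 k1 kE]] : exists k, [/\ 0 < k, k <= 1 &
    (T + h) * (k * (16 * B + 48)) / h ^+ 2 <= e / 4].
  have c0 : 0 < 16 * B + 48 by rewrite ltr_wpDl// mulr_ge0.
  pose b := e * h ^+ 2 / (4 * (T + h) * (16 * B + 48)).
  have b0 : 0 < b by rewrite divr_gt0 ?mulr_gt0// exprn_gt0.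
  exists (Num.min 1 b); set x := Num.min 1 b.
  have x00 : 0 < x by rewrite lt_min ltr01.
  have xb : x <= b by rewrite ge_min lexx orbT.
  split => //; first by rewrite ge_min lexx.
  apply: (@le_trans _ _ ((T + h) * (b * (16 * B + 48)) / h ^+ 2)); last first.
    by rewrite le_eqVlt; apply/orP; left; apply/eqP; rewrite /b; field; rewrite !gt_eqF.
  by rewrite ler_pM2r ?invr_gt0 ?exprn_gt0// ler_pM2l// ler_pM2r.
exists h, eta; split => //.
have e48 : 0 < e / 48 by rewrite divr_gt0.
have good : \forall n \near \oo, [/\
    discrete_flow dot T r (er n) e' M (tm n) (N n) (t n) (u n) (xi n) (f n),
    forall i j, (i <= N n)%N -> (j <= N n)%N -> `|u n i - u n j| <= B,
    er n <= e / 48, tm n <= h & M * tm n <= k ^+ 2 /\ M / h * tm n <= e / 2].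
  have near_er := near_le_cvg0 er0 ler01 e48.
  have near_h := near_le_cvg0 tm0 ler01 h0.
  have near_k := near_le_cvg0 tm0 M0 (exprn_gt0 2 k0).
  have Mh : 0 <= M / h by rewrite divr_ge0// ltW.
  have near_M := near_le_cvg0 tm0 Mh (divr_gt0 e0 (ltr0n R 2)).
  near=> n.
  have [] : discrete_flow dot T r (er n) e' M (tm n) (N n) (t n) (u n) (xi n) (f n) /\
    forall i j, (i <= N n)%N -> (j <= N n)%N -> `|u n i - u n j| <= B by near: n.
  move=> hf hB; split => //.
  - by rewrite -[leLHS]mul1r; near: n.
  - by rewrite -[leLHS]mul1r; near: n.
  - by split; near: n.
move: good => [n0 _ good]; exists n0 => n m n0n n0m close.
have [hfn hBn ern tmn [tmnk tmnM]] := good n n0n.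
have [hfm hBm erm tmm [tmmk _]] := good m n0m.
have hrn a : a <= h -> (h + a) * M < r ^+ 2.
  by move=> ah; apply: le_lt_trans hr; rewrite ler_wpM2r// mulr2n mulrDl mul1r lerD2l.
(* [pair_estimate] takes common bounds for the two schemes: the mesh bound is raised to [h], which
   explains [2 h M < r^2], and the residual to [e/48]. *)
have mesh_hf a a' n1 er1 : a <= a' ->
    discrete_flow dot T r er1 e' M a (N n1) (t n1) (u n1) (xi n1) (f n1) ->
    discrete_flow dot T r er1 e' M a' (N n1) (t n1) (u n1) (xi n1) (f n1).
  move=> aa' [? a0 ? ? ? ?]; split => //; first exact: le_trans aa'.
  by move=> i iN; apply: le_trans aa'; auto.
have res_hf er1 er2 n1 : er1 <= er2 ->
    discrete_flow dot T r er1 e' M h (N n1) (t n1) (u n1) (xi n1) (f n1) ->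
    discrete_flow dot T r er2 e' M h (N n1) (t n1) (u n1) (xi n1) (f n1).
  by move=> er12 [? a0 ? le1 ? ?]; split => //; exact: le_trans er12.
have fn := res_hf _ _ _ ern (mesh_hf _ _ _ _ tmn hfn).
have fm := res_hf _ _ _ erm (mesh_hf _ _ _ _ tmm hfm).
have exc n1 : excess T (e / 48) e' M (xi n1) h <= e / 16.
  by rewrite /excess xi0 e'E; lra.
have rho n1 : M * tm n1 <= k ^+ 2 ->
    discrete_flow dot T r (er n1) e' M (tm n1) (N n1) (t n1) (u n1) (xi n1) (f n1) ->
    forall i, (i < N n1)%N -> `|u n1 i.+1 - u n1 i| <= k.
  move=> Mk hf i iN; rewrite -ler_sqr ?nnegrE ?(ltW k0)//.
  by rewrite (le_trans (discrete_step_le hf iN))// mulrC.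
split.
  apply: le_trans (pair_estimate hdot fn fm r0 (ltW e'0) h0 (hrn _ (lexx h))
    (ltW k0) (ltW eta0) (rho _ tmnk hfn) (rho _ tmmk hfm) hBn hBm close) _.
  rewrite lee_fin.
  have kk : k ^+ 2 <= k by rewrite expr2 ler_piMl// ltW.
  have : (T + h) * (16 * k * B + 48 * k ^+ 2 + 4 * eta ^+ 2) / h ^+ 2 <= e / 2.
    apply: (@le_trans _ _ ((T + h) * (k * (16 * B + 48)) / h ^+ 2 +
      (T + h) * (4 * eta ^+ 2) / h ^+ 2)); last by lra.
    rewrite -mulrDl -mulrDr ler_pM2r ?invr_gt0 ?exprn_gt0// ler_pM2l//; nra.
  by have := exc n; have := exc m; lra.
(* Here the true mesh bound is kept, because the term [tm/(2h) M] has to be small. *)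
have le1 := integral_step_increment hdot (mesh_hf _ _ _ _ (lexx (tm n)) hfn)
  r0 (ltW e'0) h0 (hrn _ tmn).
have hp := df_part hfn.
have mc := measurable_cell hp.
have mch : measurable_fun [set: R] (fun s => cell (N n) (t n) (s + h)).
  by apply: (measurableT_comp mc); exact: measurable_funD.
have iF a b : mu.-integrable `]a, b] (EFin \o (fun s => `|xi n (cell (N n) (t n) s)
        + h^-1 *: step_increment (N n) (t n) (u n) h s| ^+ 2)).
  by apply: (@integrable_nat_index2 _ (N n) (N n) (cell (N n) (t n))
    (fun s => cell (N n) (t n) (s + h))
    (fun j k => `|xi n j + h^-1 *: (u n k - u n j)| ^+ 2)) => // s; exact: cell_le.
have sub : \int[mu]_(s in `]0, T]) `|xi n (cell (N n) (t n) s)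
        + h^-1 *: step_increment (N n) (t n) (u n) h s| ^+ 2 <=
  \int[mu]_(s in `]- h, T]) `|xi n (cell (N n) (t n) s)
        + h^-1 *: step_increment (N n) (t n) (u n) h s| ^+ 2.
  by apply: le_Rintegral_subset => //; rewrite oppr_le0 ltW.
have : \int[mu]_(s in `]0, T]) `|xi n (cell (N n) (t n) s)
        + h^-1 *: step_increment (N n) (t n) (u n) h s| ^+ 2 <= e.
  have : excess T (er n) e' M (xi n) h <= e / 16.
    by rewrite /excess xi0 e'E; lra.
  have : tm n / (2 * h) * M <= e / 4.
    have -> : tm n / (2 * h) * M = (M / h * tm n) / 2 by field; rewrite gt_eqF.
    lra.
  lra.
rewrite -lee_fin {1}/Rintegral fineK//.
by have := @integrable_fin_num _ _ _ mu _ (measurable_itv _) _ (iF 0 T).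
Unshelve. all: by end_near. Qed.

End CauchyEstimate.

Lemma increasing_selection (Q : nat -> nat -> Prop) :
  (forall k m, exists2 n, (m < n)%N & Q k n) ->
  exists rho : nat -> nat,
    {homo rho : m n / (m < n)%N} /\ forall k, Q k (rho k).
Proof.
move=> hQ; have /boolp.choice[f fP] : forall km : nat * nat, exists n,
    (km.2 < n)%N /\ Q km.1 n by move=> [k m]; have [n] := hQ k m; exists n.
pose rho := fix rho k := if k is j.+1 then f (j.+1, rho j) else f (0%N, 0%N).
exists rho; split.
  by apply: homo_ltn; [exact: ltn_trans|move=> k; have [] := fP (k.+1, rho k)].
by case=> [|k]; [have [] := fP (0%N, 0%N)|have [] := fP (k.+1, rho k)].
Qed.

Lemma cvg_half_pow {R : realType} (c : R) : c / 2 ^+ k @[k --> \oo] --> (0 : R).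
Proof.
rewrite (_ : (fun k => c / 2 ^+ k) = geometric c 2^-1).
  by apply: cvg_geometric; rewrite ger0_norm// invf_lt1// ltr1n.
by apply/funext => k; rewrite /geometric /= exprVn.
Qed.

Lemma cvg_quarter_pow {R : realType} (c : R) : c / 4 ^+ k @[k --> \oo] --> (0 : R).
Proof.
rewrite (_ : (fun k => c / 4 ^+ k) = geometric c 4^-1).
  by apply: cvg_geometric; rewrite ger0_norm// invf_lt1// ltr1n.
by apply/funext => k; rewrite /geometric /= exprVn.
Qed.

Lemma squeeze_norm_cvg0 {R : realType} {V : normedModType R} (c : nat -> R)
    (v : nat -> V) :
  c k @[k --> \oo] --> (0 : R) -> (\forall k \near \oo, `|v k| <= c k) ->
  v k @[k --> \oo] --> (0 : V).
Proof.
move=> c0 vc; apply/cvgrPdist_le => e e0.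
have := near_le_cvg0 c0 ler01 e0; apply: filterS2 vc => k vk.
by rewrite mul1r sub0r normrN; exact: le_trans.
Qed.

Lemma L2_fast_cvg0 {R : realType} (T : R) (a : nat -> R -> R) :
  (forall k, measurable_fun `]0, T] (a k)) ->
  (forall k, (\int[lebesgue_measure]_(x in `]0%R, T]) (a k x ^+ 2)%:E <=
     (summable_rate R k)%:E)%E) ->
  {ae (@lebesgue_measure R), forall x, x \in `]0, T] ->
     a k x @[k --> \oo] --> (0 : R)}.
Proof.
move=> ma inta; set mu := @lebesgue_measure R.
have [E [mE E0 E1 wE]] :=
  @summable_squares_majorant _ _ _ mu _ (measurable_itv `]0, T]) _ ma inta.
have iE : mu.-integrable `]0, T] E.
  apply/integrableP; split => //; rewrite (eq_integral E); last first.
    by move=> r _; rewrite gee0_abs.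
  by rewrite (le_lt_trans E1)// ltry.
have : {ae mu, forall r, r \in `]0, T] -> E r \is a fin_num}.
  exact: (@integrable_ae _ _ _ mu `]0, T]%classic (measurable_itv _) _ iE).
apply: filterS; first exact: (ae_filter_ringOfSetsType mu).
move=> r Er rT; have Efin := Er rT.
apply: (squeeze_norm_cvg0 (cvg_half_pow (Num.sqrt (fine (E r))))).
apply: nearW => k; rewrite ler_pdivlMr ?exprn_gt0//.
rewrite -[leLHS]ger0_norm ?mulr_ge0 ?exprn_ge0// -sqrtr_sqr ler_wsqrtr//.
rewrite -lee_fin fineK// exprMn -exprM mulnC exprM mulrC real_normK ?num_real//.
by rewrite (_ : 2 ^+ 2 = 4) ?wE// -natrX.
Qed.

(** * Convergence of speeds and slopes along a fast subsequence *)

Section DiscreteFlowLimit.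
Context {R : realType} {H : completeNormedModType R}.
Variable dot : {dot H for idfun}.
Hypotheses (hdot : induces_norm dot) (hsep : separable H).
Local Notation mu := (@lebesgue_measure R).
Variables (K : set H) (T M B : R) (N : nat -> nat) (t : nat -> nat -> R)
  (un xi : nat -> nat -> H) (f : nat -> nat -> R) (er tm : nat -> R) (x0 : H).
Hypotheses (cK : compact K) (hT : 0 < T) (M0 : 0 <= M) (B0 : 0 <= B).
Hypothesis er0 : er n @[n --> \oo] --> 0.
Hypothesis tm0 : tm n @[n --> \oo] --> 0.
Hypothesis xi0 : forall n, xi n 0%N = x0.
Hypothesis flows : forall e' : R, 0 < e' -> exists2 r : R, 0 < r &
  \forall n \near \oo, [/\
    discrete_flow dot T r (er n) e' M (tm n) (N n) (t n) (un n) (xi n) (f n),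
    forall i, (i <= N n)%N -> K (un n i)
  & forall i j, (i <= N n)%N -> (j <= N n)%N -> `|un n i - un n j| <= B].
Hypothesis hpart : forall n, is_partition T (N n) (t n).

(** Window lengths [h k] shrink to 0 with the tolerances, but each is fixed before the scheme
    [rho k] is selected, and [rho k] is then so close to [u] that the difference quotient of length
    [h k] may be taken on [u] instead. This links the slopes to the derivative of [u]. *)
Lemma discrete_flow_limit :
  exists (rho : nat -> nat) (u G : R -> H) (d : nat -> R),
  [/\ {homo rho : m n / (m < n)%N},
      d k @[k --> \oo] --> 0 /\ (forall k, 0 <= d k),
      forall k s, 0 <= s -> s <= T ->
        `|un (rho k) (cell (N (rho k)) (t (rho k)) s) - u s| <= d k /\
        `|pw_affine (N (rho k)) (t (rho k)) (un (rho k)) s - u s| <= 2 * d k,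
      (forall s s', s <= s' -> `|u s' - u s| ^+ 2 <= M * (s' - s)) /\
      [/\ sq_integrable T G, weak_primitive dot T G u,
        forall k, measurable_fun [set: R] (fun s =>
          `|pw_speed (N (rho k)) (t (rho k)) (un (rho k)) s - G s|)
      & forall k, (\int[mu]_(s in `]0%R, T])
         (`|pw_speed (N (rho k)) (t (rho k)) (un (rho k)) s - G s| ^+ 2)%:E
          <= (4 / 4 ^+ k)%:E)%E]
    & {ae mu, forall s, s \in `]0, T[ ->
        xi (rho k) (cell (N (rho k)) (t (rho k)) s) @[k --> \oo] --> - G s}].
Proof.
pose ubar n s := un n (cell (N n) (t n) s).
have flows2 e' : 0 < e' -> exists2 r : R, 0 < r & \forall n \near \oo,
    discrete_flow dot T r (er n) e' M (tm n) (N n) (t n) (un n) (xi n) (f n) /\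
    forall i j, (i <= N n)%N -> (j <= N n)%N -> `|un n i - un n j| <= B.
  by move=> /flows[r r0 hr]; exists r => //; apply: filterS hr => n [].
have cauchy k := discrete_flow_cauchy hdot hT M0 B0 er0 tm0 xi0 flows2
  (summable_rate_gt0 R k).
have [h hP] := boolp.choice cauchy.
have [eta etaP] := boolp.choice hP.
have /boolp.choice[n0 n0P] k : exists n1, forall n m, (n1 <= n)%N -> (n1 <= m)%N ->
   (forall s, 0 <= s -> s <= T -> `|ubar n s - ubar m s| <= eta k) ->
   (\int[mu]_(s in `]0%R, T]) (`|pw_speed (N n) (t n) (un n) s
        - pw_speed (N m) (t m) (un m) s| ^+ 2)%:E <= (summable_rate R k)%:E)%E /\
   (\int[mu]_(s in `]0%R, T]) (`|xi n (cell (N n) (t n) s)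
        + (h k)^-1 *: step_increment (N n) (t n) (un n) (h k) s| ^+ 2)%:E <=
      (summable_rate R k)%:E)%E by have [] := etaP k.
have h0 k : 0 < h k by have [] := etaP k.
have hle k : h k <= summable_rate R k by have [] := etaP k.
have eta0 k : 0 < eta k by have [] := etaP k.
have rate_le k : summable_rate R k <= 1 / 4 ^+ k.
  rewrite /summable_rate ler_pM2r ?invr_gt0 ?exprn_gt0// invf_le1 ?ltr0n ?expn_gt0//.
  by rewrite ler1n expn_gt0.
have h_cvg : h k @[k --> \oo] --> 0.
  apply: (squeeze_norm_cvg0 (cvg_quarter_pow 1)); apply: nearW => k.
  by rewrite gtr0_norm// (le_trans (hle k)).
(* Being below [eta j / 2] for all [j <= k] makes later schemes [eta j]-close to each other by way
   of [u]; being below [h k / 2^k] makes the passage from the interpolant to [u] harmless after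
   division by [h k]. *)
pose d k := \big[Num.min/1]_(j < k.+1) Num.min (eta j / 2) (h j / 2 ^+ j).
have d0 k : 0 < d k.
  by apply: lt_bigmin => // j _; rewrite lt_min !divr_gt0// exprn_gt0.
have d_le j k : (j <= k)%N -> d k <= Num.min (eta j / 2) (h j / 2 ^+ j).
  move=> jk; exact: (bigmin_le _ (Ordinal (jk : (j < k.+1)%N))
    (fun j : 'I_k.+1 => Num.min (eta j / 2) (h j / 2 ^+ j))).
have d_eta j k : (j <= k)%N -> d k <= eta j / 2.
  by move=> /d_le /le_trans; apply; rewrite ge_min lexx.
have d_h k : d k <= h k / 2 ^+ k.
  by apply: (le_trans (d_le k k (leqnn k))); rewrite ge_min lexx orbT.
have dcvg : d k @[k --> \oo] --> 0.
  apply: (squeeze_norm_cvg0 h_cvg); apply: nearW => k.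
  rewrite gtr0_norm// (le_trans (d_h k))// ler_pdivrMr ?exprn_gt0//.
  by rewrite ler_peMr ?(ltW (h0 k))// exprn_ege1// ler1n.
have [r r0 near_flow] := flows ltr01.
have [u [u_holder u_near]] : exists u : R -> H,
    (forall s s', s <= s' -> `|u s' - u s| ^+ 2 <= M * (s' - s)) /\
    forall (e : R) (P : set nat), 0 < e -> (\forall n \near \oo, P n) ->
      exists2 n, P n & forall s, 0 <= s -> s <= T -> `|ubar n s - u s| <= e.
  apply: (cluster_curve cK M0 hT tm0).
    by apply: filterS near_flow => n [_ unK _] s; apply: unK; exact: cell_le.
  apply: filterS near_flow => n [fn _ _] s s' ss'.
  have := step_increment_sqrM fn (h := s' - s) s; rewrite subr_ge0 => /(_ ss').
  by rewrite /step_increment [s + _]addrC subrK [_ * M]mulrC.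
pose m0 k := (\max_(j < k.+1) n0 j)%N.
pose Q k n := [/\ (m0 k <= n)%N,
  discrete_flow dot T r (er n) 1 M (tm n) (N n) (t n) (un n) (xi n) (f n),
  M * tm n <= d k ^+ 2 & forall s, 0 <= s -> s <= T -> `|ubar n s - u s| <= d k].
have [rho [rho_incr rhoQ]] : exists rho : nat -> nat,
    {homo rho : m n / (m < n)%N} /\ forall k, Q k (rho k).
  apply: increasing_selection => k m.
  have [|n [mn m0n fn tn] un_u] := u_near (d k) (fun n => [/\ (m < n)%N, (m0 k <= n)%N,
      discrete_flow dot T r (er n) 1 M (tm n) (N n) (t n) (un n) (xi n) (f n) &
      M * tm n <= d k ^+ 2]) (d0 k).
    have nt := near_le_cvg0 tm0 M0 (exprn_gt0 2 (d0 k)).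
    near=> n; split.
    - by near: n; exists m.+1.
    - by near: n; exists (m0 k).
    - have [] : [/\ discrete_flow dot T r (er n) 1 M (tm n) (N n) (t n) (un n) (xi n) (f n),
        forall i, (i <= N n)%N -> K (un n i) &
        forall i j, (i <= N n)%N -> (j <= N n)%N -> `|un n i - un n j| <= B] by near: n.
      by [].
    - by near: n.
  by exists n.
have n0_rho j k : (j <= k)%N -> (n0 j <= rho k)%N.
  move=> jk; have [m0k _ _ _] := rhoQ k; apply: leq_trans m0k.
  exact: (leq_bigmax (Ordinal (jk : (j < k.+1)%N))).
have near_u k s : 0 <= s -> s <= T -> `|ubar (rho k) s - u s| <= d k.
  by move=> s0 sT; have [_ _ _] := rhoQ k; apply.
have near_pair j k l s : (j <= k)%N -> (j <= l)%N -> 0 <= s -> s <= T ->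
    `|ubar (rho k) s - ubar (rho l) s| <= eta j.
  move=> jk jl s0 sT; have := ler_distD (u s) (ubar (rho k) s) (ubar (rho l) s).
  rewrite [`|u s - _|]distrC.
  by have := near_u k s s0 sT; have := near_u l s s0 sT;
    have := d_eta _ _ jk; have := d_eta _ _ jl; lra.
pose w k s := pw_speed (N (rho k)) (t (rho k)) (un (rho k)) s.
have mw k : scalar_measurable (w k) by exact: scalar_measurable_pw_speed.
have mww j k : measurable_fun [set: R] (fun s => `|w j s - w k s|).
  exact: (measurable_fun_nat_index2
    (fun a b => `|speed (t (rho j)) (un (rho j)) a - speed (t (rho k)) (un (rho k)) b|)
    (measurable_cell (hpart (rho j))) (measurable_cell (hpart (rho k)))).
have w_fast k : (\int[mu]_(s in `]0%R, T]) (`|w k.+1 s - w k s| ^+ 2)%:E <=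
    (summable_rate R k)%:E)%E.
  have [|//] := n0P k (rho k.+1) (rho k) (n0_rho _ _ (leqnSn k)) (n0_rho _ _ (leqnn k)).
  by move=> s; exact: near_pair.
have [G [mG _ mwG wG]] := L2_fast_limit mw mww w_fast.
have hG : sq_integrable T G.
  exact: (sq_integrable_near hdot (sq_integrable_pw_speed _ (hpart (rho 0%N))) mG (mwG 0%N) (wG 0%N)).
have near_aff k s : 0 <= s -> s <= T ->
    `|pw_affine (N (rho k)) (t (rho k)) (un (rho k)) s - u s| <= 2 * d k.
  move=> s0 sT; have [_ fk tk _] := rhoQ k.
  have step i : (i < N (rho k))%N -> `|un (rho k) i.+1 - un (rho k) i| <= d k.
    move=> iN; rewrite -ler_sqr ?nnegrE ?(ltW (d0 k))//.
    by rewrite (le_trans (discrete_step_le M0 fk iN))// mulrC.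
  have := pw_affine_near (hpart (rho k)) step (ltW (d0 k)) s0 sT.
  have := ler_distD (ubar (rho k) s) (pw_affine (N (rho k)) (t (rho k)) (un (rho k)) s) (u s).
  by have := near_u k s s0 sT; rewrite /ubar; lra.
have uG : weak_primitive dot T G u.
  apply: (weak_primitive_limit hdot (w := w) (c := fun k => 4 / 4 ^+ k)
    (v := fun k => pw_affine (N (rho k)) (t (rho k)) (un (rho k)))) => //.
  - by move=> k; exact: sq_integrable_pw_speed.
  - exact: cvg_quarter_pow.
  - by move=> k; exact: weak_primitive_pw_affine.
  move=> s /andP[s0 sT]; apply/subr_cvg0.
  apply: (squeeze_norm_cvg0 (c := fun k => 2 * d k)).
    by rewrite -[0 in X in _ --> X](mulr0 2); exact: cvgMr.
  by apply: nearW => k; exact: near_aff.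
exists rho, u, G, d; split => //.
- by split=> // k; exact: ltW.
- by move=> k s s0 sT; split; [exact: near_u|exact: near_aff].
pose b k s := `|xi (rho k) (cell (N (rho k)) (t (rho k)) s) + (h k)^-1 *:
  step_increment (N (rho k)) (t (rho k)) (un (rho k)) (h k) s|.
have ae_b : {ae mu, forall s, s \in `]0, T] -> b k s @[k --> \oo] --> (0 : R)}.
  apply: L2_fast_cvg0 => k.
    have mc := measurable_cell (hpart (rho k)).
    have mch : measurable_fun [set: R] (fun s => cell (N (rho k)) (t (rho k)) (s + h k)).
      by apply: (measurableT_comp mc); exact: measurable_funD.
    apply: measurable_funTS.
    exact: (measurable_fun_nat_index2
      (fun i j => `|xi (rho k) i + (h k)^-1 *: (un (rho k) j - un (rho k) i)|) mc mch).
  (* The scheme is paired with itself, since only the estimate on its slope is wanted. *)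
  have [|_] := n0P k (rho k) (rho k) (n0_rho _ _ (leqnn k)) (n0_rho _ _ (leqnn k)).
    by move=> s; exact: near_pair.
  by under eq_integral do rewrite -[_ ^+ 2]/(b k _ ^+ 2).
have ae_u := weak_primitive_derivable hdot hG uG hsep.
move: ae_b ae_u; apply: filterS2; first exact: (ae_filter_ringOfSetsType mu).
move=> s bs us sT; have [du us'] := us sT.
have [s0 sT'] : 0 < s /\ s < T by move: sT; rewrite in_itv /= => /andP.
have Db : (h k)^-1 *: (u (h k + s) - u s) @[k --> \oo] --> G s.
  rewrite -us'; apply: (@cvg_comp _ _ _ h (fun a => a^-1 *: (u (a + s) - u s)));
    last exact: derivable_cvg_diff_quot.
  move=> P /= [/= e e0 Pe].
  have := near_le_cvg0 h_cvg ler01 (divr_gt0 e0 (ltr0n R 2)).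
  apply: filterS => k; rewrite mul1r => hk; apply: Pe; last by rewrite gt_eqF.
  by rewrite /= sub0r normrN gtr0_norm// (le_lt_trans hk)// ltr_pdivrMr// ltr_pMr// ltr1n.
apply/subr_cvg0.
(* Three errors: slope against averaged speed, which tends to 0 by [ae_b]; averaged speed against
   the quotient of [u], at most [2 / 2^k]; and the quotient of [u] against its derivative [G s]. *)
have -> : (fun k => xi (rho k) (cell (N (rho k)) (t (rho k)) s) - - G s) =
  (fun k => (xi (rho k) (cell (N (rho k)) (t (rho k)) s) + (h k)^-1 *:
     step_increment (N (rho k)) (t (rho k)) (un (rho k)) (h k) s)
   - ((h k)^-1 *: (step_increment (N (rho k)) (t (rho k)) (un (rho k)) (h k) s
       - (u (h k + s) - u s)) + ((h k)^-1 *: (u (h k + s) - u s) - G s))).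
  by apply/funext => k; rewrite opprK; set U := u _ - u s;
    set S := step_increment _ _ _ _ _; rewrite (scalerBr _ S U) subrKA opprB addrACA subrr addr0.
rewrite -[0]subr0 -{2}[0]addr0; apply: cvgB; last apply: cvgD.
- by apply/norm_cvg0P; apply: bs; rewrite in_itv /= s0 ltW.
- apply: (squeeze_norm_cvg0 (cvg_half_pow 2)).
  have := near_le_cvg0 h_cvg ler01 (_ : 0 < T - s); rewrite subr_gt0 => /(_ sT').
  apply: filterS => k; rewrite mul1r => hk.
  have shT : s + h k <= T by rewrite addrC -lerBrDr.
  have n1 := near_u k (s + h k) (addr_ge0 (ltW s0) (ltW (h0 k))) shT.
  have n2 := near_u k s (ltW s0) (ltW sT').
  rewrite normrZ gtr0_norm ?invr_gt0// ler_pdivrMl//.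
  rewrite /step_increment [h k + s]addrC.
  rewrite (_ : _ - _ + _ = (ubar (rho k) (s + h k) - u (s + h k)) -
    (ubar (rho k) s - u s)); last exact: subr_subACA.
  rewrite (le_trans (ler_normB _ _))//.
  by rewrite mulrCA; have := d_h k; lra.
- exact/subr_cvg0.
Unshelve. all: by end_near. Qed.

End DiscreteFlowLimit.

(** * Limit curves together with their velocities *)

Section StrongFlow.
Context {R : realType} {H : completeNormedModType R}.
Variable dot : {dot H for idfun}.
Hypotheses (hdot : induces_norm dot) (hsep : separable H).
Local Notation mu := (@lebesgue_measure R).

Lemma normL2sq_le_sup (T c : R) (z : R -> H) :
  0 <= T -> (forall s, 0 <= s -> s <= T -> `|z s| <= c) ->
  (normL2sq T z <= (T * c ^+ 2)%:E)%E.
Proof.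
move=> T0 zc.
have c0 : 0 <= c by exact: le_trans (zc 0 (lexx 0) T0).
have mI : measurable (`]0, T[%classic : set R) by exact: measurable_itv.
have mc : measurable_fun (`]0, T[%classic : set R) (fun _ : R => (c ^+ 2)%:E).
  exact: measurable_cst.
have zcE r : `]0, T[%classic r -> (0 <= (`|z r| ^+ 2)%:E <= (c ^+ 2)%:E)%E.
  rewrite /= in_itv /= => /andP[r0 rT]; rewrite !lee_fin sqr_ge0/=.
  by rewrite ler_sqr ?nnegrE// zc// ltW.
apply: (le_trans (ge0_le_integral_canonical mI mc zcE)).
rewrite integral_cst//; apply: (@le_trans _ _ ((c ^+ 2)%:E * mu `]0%R, T])%E).
  apply: lee_pmul => //; first by rewrite lee_fin sqr_ge0.
  by apply: le_measure; rewrite ?inE//; apply: subset_itvl; rewrite bnd_simp.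
by rewrite mu_itvoc// subr0 -EFinM mulrC.
Qed.

Lemma normL2sq_le_ae (T : R) (z w : R -> H) :
  measurable_fun [set: R] (fun s => `|w s|) ->
  {ae mu, forall s, s \in `]0, T[ -> z s = w s} ->
  (normL2sq T z <= \int[mu]_(s in `]0%R, T]) (`|w s| ^+ 2)%:E)%E.
Proof.
move=> mw [A [mA A0 Asub]].
have mI : measurable (`]0, T[%classic : set R) by exact: measurable_itv.
have mw2 : measurable_fun [set: R] (fun s => (`|w s| ^+ 2)%:E).
  by apply/measurable_EFinP; apply: measurable_funX.
(* The value [+oo] on the null set turns the almost everywhere equality into a bound at every point
   by a measurable function with the same integral as [|w|^2]. *)
pose f s := if s \in A then +oo%E else (`|w s| ^+ 2)%:E.
have mf : measurable_fun [set: R] f.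
  apply: measurable_fun_ifT => //; apply: (measurable_fun_bool true).
  by rewrite setTI (_ : _ @^-1` _ = A)//; apply/seteqP; split => r /= => [/set_mem|/mem_set].
have zf r : `]0, T[%classic r -> (0 <= (`|z r| ^+ 2)%:E <= f r)%E.
  move=> rT; rewrite lee_fin sqr_ge0 /f /=.
  case: ifPn => [_|]; first exact: leey.
  rewrite notin_setE => rA; rewrite lee_fin (_ : z r = w r)//.
  by apply: contrapT => zw; apply: rA; apply: Asub => /(_ rT).
apply: (le_trans (ge0_le_integral_canonical mI (measurable_funTS mf) zf)).
have -> : (\int[mu]_(s in `]0%R, T[) f s)%E =
    (\int[mu]_(s in `]0%R, T[) (`|w s| ^+ 2)%:E)%E.
  apply: (@ae_eq_integral _ _ _ mu) => //.
  - exact: measurable_funTS.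
  - exact: measurable_funTS.
  exists A; split => // s /= /not_implyP[_]; rewrite /f; case: ifPn => // /set_mem.
  by move=> ? _; [].
apply: (@ge0_subset_integral _ _ _ mu) => //; first exact: measurable_funTS.
by apply: subset_itvl; rewrite bnd_simp.
Qed.

Variables (phi phi1 : H -> \bar R) (phi2 : H -> R) (g : H -> H) (T : R).
Hypothesis hphi : forall v, phi v = (phi1 v + (phi2 v)%:E)%E.
Hypothesis hcpt : compact_sublevels phi.
Hypotheses (hconv : convex_ereal phi1) (hprop : proper_ereal phi1).
Hypothesis hlsc : lower_semicontinuous phi1.
Hypothesis hsv : single_valued (convex_subdiff dot phi1).
Hypotheses (phi2g : is_gradient dot phi2 g) (cg : continuous g).
Hypothesis hT : 0 < T.
Variable u0 : H.

(* The velocity [G] is carried along with [u]: unlike [derive1 u], it is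
   scalarly measurable by construction. *)
Record strong_flow (u G : R -> H) : Prop := StrongFlow {
  sf_velocity : sq_integrable T G ;
  sf_primitive : weak_primitive dot T G u ;
  sf_subdiff : {ae mu, forall s, s \in `]0, T[ ->
    convex_subdiff dot phi1 (u s) (- G s - g (u s))} ;
  sf_init : u 0 = u0 ;
  sf_holder : exists2 M, 0 <= M &
    forall s s', s <= s' -> `|u s' - u s| ^+ 2 <= M * (s' - s) }.

Lemma strong_flow_inH1 u G : strong_flow u G -> inH1 T u.
Proof. by case=> hG uG _ _ _; exact: (weak_primitive_inH1 hdot hsep hG uG). Qed.

Lemma strong_flow_gradient_flow u G :
  strong_flow u G -> gradient_flow dot phi T u0 u.
Proof.
move=> uF; split; [exact: strong_flow_inH1 uF| |exact: sf_init uF].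
have ae_u := weak_primitive_derivable hdot (sf_velocity uF) (sf_primitive uF) hsep.
move: ae_u (sf_subdiff uF); apply: filterS2; first exact: (ae_filter_ringOfSetsType mu).
move=> s us sub sT; have [_ us'] := us sT.
have [du ->] := convex_subdiff_subgrad hphi hprop.1 phi2g hconv hsv (sub sT).
by split => //; rewrite us' subrK subrr.
Qed.

Variables (N : nat -> nat) (t : nat -> nat -> R) (un : nat -> nat -> H).
Hypothesis hpart : forall n, is_partition T (N n) (t n).
Hypothesis htau : diameter (N n) (t n) @[n --> \oo] --> 0.
Hypothesis hdom : forall n i, (i <= N n)%N -> dom_subdiff dot phi (un n i).
Hypothesis hinit : forall n, un n 0%N = u0.
Hypothesis hres : (\sum_(1 <= i < (N n).+1)
    maxe (residual dot phi (tstep (t n) i) (un n i) (un n i.-1)) 0)%E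
  @[n --> \oo] --> 0%E.

Let uhat n := pw_affine (N n) (t n) (un n).

(** At almost every time the vectors [subgrad - g] at the interpolants converge to [- G - g (u s)],
    so closedness of the subdifferential of [phi1] applies pointwise in time, without any weak
    limit. *)
Lemma scheme_strong_flow_limit : exists (rho : nat -> nat) (u G : R -> H),
  [/\ {homo rho : m n / (m < n)%N}, strong_flow u G
    & cvgH1 T (fun k => uhat (rho k)) u].
Proof.
have [K [er [M [B [cK er0 M0 B0 flows]]]]] := scheme_discrete_flow hdot hphi hcpt
  hconv hprop phi2g cg hpart hdom hinit hres.
have [rho [u [G [d [rho_incr [d0 dpos] close [u_holder [hG uG mwG wG]] xiG]]]]] :=
  discrete_flow_limit hdot hsep cK hT M0 B0 er0 htau
    (fun n => congr1 (subgrad dot phi) (hinit n)) flows hpart.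
have close_cvg s : 0 <= s -> s <= T ->
    un (rho k) (cell (N (rho k)) (t (rho k)) s) @[k --> \oo] --> u s.
  move=> s0 sT; apply/subr_cvg0; apply: (squeeze_norm_cvg0 d0).
  by apply: nearW => k; have [] := close k s s0 sT.
have uF : strong_flow u G.
  split => //; last by exists M.
  - move: xiG; apply: filterS; first exact: (ae_filter_ringOfSetsType mu).
    move=> s xis sT; have [s0 sT'] : 0 < s /\ s < T by move: sT; rewrite in_itv /= => /andP.
    have us := close_cvg s (ltW s0) (ltW sT').
    apply: (convex_subdiff_closed hdot hprop hlsc _ us (un := fun k =>
      un (rho k) (cell (N (rho k)) (t (rho k)) s)) (etan := fun k =>
      subgrad dot phi (un (rho k) (cell (N (rho k)) (t (rho k)) s)) -
      g (un (rho k) (cell (N (rho k)) (t (rho k)) s)))).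
      move=> k; apply: (subgrad_convex_subdiff hphi hprop.1 phi2g hconv).
      by apply: hdom; exact: cell_le.
    apply: cvgB; first exact: xis.
    apply: (@cvg_comp _ _ _ (fun k => un (rho k) (cell (N (rho k)) (t (rho k)) s)) g).
      exact: us.
    exact: cg.
  - have := close_cvg 0 (lexx 0) (ltW hT).
    under eq_fun do rewrite (cell0 (hpart _) (lexx 0)) hinit.
    by move=> /(cvg_lim (@norm_hausdorff _ _)) <-; rewrite lim_cst.
exists rho, u, G; split => //; split.
- move=> k; exact: (weak_primitive_inH1 hdot hsep (sq_integrable_pw_speed _ (hpart _))
    (weak_primitive_pw_affine _ _ (hpart _))).
- exact: strong_flow_inH1 uF.
pose c k := T * (2 * d k) ^+ 2 + 4 / 4 ^+ k.
have c0 : c k @[k --> \oo] --> 0.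
  have d2 : 2 * d k @[k --> \oo] --> 0.
    by rewrite -[0 in X in _ --> X](mulr0 2); exact: cvgMr.
  rewrite -[0 in X in _ --> X]addr0; apply: cvgD; last exact: cvg_quarter_pow.
  rewrite -[0 in X in _ --> X](mulr0 T); apply: cvgMr.
  rewrite -[0 in X in _ --> X](mulr0 0).
  by under eq_fun do rewrite expr2; exact: cvgM.
apply: (@squeeze_cvge _ _ _ _ (fun=> 0%E) _ (fun k => (c k)%:E)).
- apply: nearW => k; apply/andP; split.
    exact: (adde_ge0 (normL2sq_ge0 _ _) (normL2sq_ge0 _ _)).
  rewrite /c EFinD; apply: leeD.
    apply: normL2sq_le_sup; first exact: ltW.
    by move=> s s0 sT; have [] := close k s s0 sT.
  apply: (le_trans _ (wG k)); apply: normL2sq_le_ae; first exact: mwG.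
  have ae_u := weak_primitive_derivable hdot hG uG hsep.
  have ae_uhat := weak_primitive_derivable hdot (sq_integrable_pw_speed _ (hpart _))
    (weak_primitive_pw_affine dot (un (rho k)) (hpart (rho k))) hsep.
  move: ae_u ae_uhat; apply: filterS2; first exact: (ae_filter_ringOfSetsType mu).
  move=> s us uhats sT; have [du <-] := us sT; have [duhat <-] := uhats sT.
  by rewrite !derive1E deriveB.
- exact: cvg_cst.
- by apply: cvg_EFin c0; exact: nearW.
Qed.

End StrongFlow.

(** * Uniqueness for Lipschitz gradients *)

Lemma ae_le_Rintegral_itvoc {R : realType} (a b : R) (f1 f2 : R -> R) :
  (@lebesgue_measure R).-integrable `]a, b] (EFin \o f1) ->
  (@lebesgue_measure R).-integrable `]a, b] (EFin \o f2) ->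
  {ae (@lebesgue_measure R), forall r, r \in `]a, b[ -> f1 r <= f2 r} ->
  \int[@lebesgue_measure R]_(r in `]a, b]) f1 r <=
  \int[@lebesgue_measure R]_(r in `]a, b]) f2 r.
Proof.
move=> if1 if2 ae12; set mu := @lebesgue_measure R.
have nb : mu.-negligible [set b].
  by exists [set b]; split => //; exact: lebesgue_measure_set1.
have [B [mB B0 Bsub]] := negligibleU ae12 nb.
have mI : measurable (`]a, b]%classic : set R) by exact: measurable_itv.
have mD : measurable (`]a, b]%classic `\` B) by exact: measurableD.
have sub : `]a, b]%classic `\` B `<=` `]a, b]%classic by move=> r [].
rewrite /Rintegral (negligible_integral mB mI if1 B0) (negligible_integral mB mI if2 B0).
apply: (@le_Rintegral _ _ R mu) => //; [exact: integrableS if1|exact: integrableS if2|].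
move=> r [/= rab rB]; apply: contrapT => fr; apply: rB; apply: Bsub.
have [->|rb] := eqVneq r b; [by right|left => /= imp; apply: fr; apply: imp].
by move: rab; rewrite !in_itv/= => /andP[-> rb'] /=; rewrite lt_neqAle rb.
Qed.

Lemma nonincreasing_of_local {R : realType} (A B d : R) (psi : R -> R) : 0 < d ->
  (forall s s', A <= s -> s <= s' -> s' <= B -> s' <= s + d -> psi s' <= psi s) ->
  forall s, A <= s -> s <= B -> psi s <= psi A.
Proof.
move=> d0 loc.
have step n s : A <= s -> s <= B -> s <= A + d *+ n -> psi s <= psi A.
  elim: n s => [|n IH] s As sB sn.
    by have -> // : s = A; apply/le_anti; rewrite As; move: sn; rewrite mulr0n addr0 => ->.
  have [|nd] := leP s (A + d *+ n); first exact: IH.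
  have dn : A <= A + d *+ n by rewrite lerDl mulrn_wge0// ltW.
  apply: (@le_trans _ _ (psi (A + d *+ n))).
    by apply: loc => //; [exact: ltW|rewrite -addrA -mulrSr].
  by apply: IH => //; rewrite (le_trans _ sB)// ltW.
move=> s As sB; have [n sn] : exists n : nat, (s - A) / d <= n%:R.
  exists (Num.bound ((s - A) / d)); apply/ltW/archi_boundP.
  by rewrite divr_ge0 ?subr_ge0// ltW.
by apply: (step n) => //; rewrite -lerBlDl -mulr_natl -ler_pdivrMr.
Qed.

Section Uniqueness.
Context {R : realType} {H : completeNormedModType R}.
Variable dot : {dot H for idfun}.
Hypothesis hdot : induces_norm dot.
Local Notation mu := (@lebesgue_measure R).
Variables (phi1 : H -> \bar R) (g : H -> H) (T : R) (u0 : H).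
Hypotheses (phi1Ny : forall v, (-oo < phi1 v)%E) (hT : 0 < T).
Hypothesis g_lip : forall x, exists L : R, exists2 r : R, 0 < r &
  forall v w, ball x r v -> ball x r w -> `|g v - g w| <= L * `|v - w|.
Variables (u Gu v Gv : R -> H).
Hypotheses (uF : strong_flow dot phi1 g T u0 u Gu)
  (vF : strong_flow dot phi1 g T u0 v Gv).

Let z r := u r - v r.

Let z_holder : exists2 C, 0 < C &
  forall s s', s <= s' -> `|z s' - z s| ^+ 2 <= C * (s' - s).
Proof.
have [Mu Mu0 hu] := sf_holder uF; have [Mv Mv0 hv] := sf_holder vF.
exists (2 * (Mu + Mv) + 1) => [|s s' ss'].
  by rewrite ltr_wpDl// mulr_ge0// addr_ge0.
rewrite /z subr_subACA (le_trans (sqr_normB_le hdot _ _))//.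
have := hu _ _ ss'; have := hv _ _ ss'; have : 0 <= s' - s by rewrite subr_ge0.
nra.
Qed.

Let velocity_bound r := `|Gu r - 0| + `|Gv r - 0|.

Let velocity_integrable a b : 0 <= a -> b <= T ->
  mu.-integrable `]a, b] (EFin \o velocity_bound).
Proof.
move=> a0 bT; apply: (integrable_itvocS a0 bT).
by apply: integrable_rD => //; apply: (sq_integrable_norm hdot);
  [exact: sf_velocity uF|exact: sf_velocity vF].
Qed.

(** The increment of [|z|^2] is the scalar product of [z b + z a] with the increment of [z], that
    is, with an integral of velocities. Replacing [z b + z a] by [2 z r] costs the oscillation [w];
    then monotonicity trades the velocities for the gradients of [phi2], and the Lipschitz bound
    applies. No product rule is involved. *)
Let sqr_dist_increment (a b w S L : R) :
  0 <= a -> a <= b -> b <= T -> 0 <= L ->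
  (forall r, a <= r -> r <= b -> `|z r| ^+ 2 <= S) ->
  (forall r, a <= r -> r <= b -> `|z a - z r| <= w /\ `|z b - z r| <= w) ->
  (forall r, a <= r -> r <= b -> `|g (u r) - g (v r)| <= L * `|z r|) ->
  `|z b| ^+ 2 - `|z a| ^+ 2 <= 2 * L * S * (b - a) +
    2 * w * \int[mu]_(r in `]a, b]) velocity_bound r.
Proof.
move=> a0 ab bT L0 zS zw gz.
pose e := z b + z a.
have -> : `|z b| ^+ 2 - `|z a| ^+ 2 =
    \int[mu]_(r in `]a, b]) dot e (Gu r) - \int[mu]_(r in `]a, b]) dot e (Gv r).
  rewrite -(sf_primitive uF e a0 ab bT) -(sf_primitive vF e a0 ab bT) -dotBr.
  rewrite subr_subACA -/(z b) -/(z a) /e dotDl.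
  rewrite 2!(dotBr dot _ (z b) (z a)) -!hdot.
  by rewrite (dotC dot (z a) (z b)) subrKA.
have iGu : mu.-integrable `]a, b] (EFin \o (fun r => dot e (Gu r))).
  exact: integrable_itvocS a0 bT (sq_integrable_dot hdot e (sf_velocity uF)).
have iGv : mu.-integrable `]a, b] (EFin \o (fun r => dot e (Gv r))).
  exact: integrable_itvocS a0 bT (sq_integrable_dot hdot e (sf_velocity vF)).
have iV := velocity_integrable a0 bT.
rewrite -RintegralB// -(Rintegral_cst_itvoc _ ab) -RintegralZl//.
rewrite -RintegralD//; last 2 first.
- exact: integrable_cst_itvoc.
- exact: integrable_rZ.
apply: ae_le_Rintegral_itvoc.
- exact: integrable_rB.
- by apply: integrable_rD => //; [exact: integrable_cst_itvoc|exact: integrable_rZ].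
move: (sf_subdiff uF) (sf_subdiff vF).
apply: filterS2; first exact: (ae_filter_ringOfSetsType mu).
move=> r su sv rab.
have [ar rb] : a < r /\ r < b by move: rab; rewrite in_itv /= => /andP.
have rT : r \in `]0, T[ by rewrite in_itv /= (le_lt_trans a0)// (lt_le_trans rb).
have := convex_subdiff_monotone phi1Ny (su rT) (sv rT).
have -> : - Gu r - g (u r) - (- Gv r - g (v r)) =
    - (g (u r) - g (v r)) - (Gu r - Gv r).
  by rewrite subr_subACA opprK addrC; congr (_ + _); rewrite opprB addrC.
rewrite -/(z r) dotBl => mono.
have gdot : `|dot (- (g (u r) - g (v r))) (z r)| <= L * `|z r| ^+ 2.
  rewrite (le_trans (ler_norm_dot hdot _ _))// normrN expr2 mulrA ler_wpM2r//.
  by apply: gz; exact: ltW.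
have [za zb] := zw r (ltW ar) (ltW rb).
have edot : `|dot (e - (z r + z r)) (Gu r - Gv r)| <= 2 * w * velocity_bound r.
  rewrite (le_trans (ler_norm_dot hdot _ _))// ler_pM//.
    rewrite /e opprD addrACA (le_trans (ler_normD _ _))// mulr2n mulrDl mul1r.
    exact: lerD.
  by rewrite /velocity_bound !subr0 ler_normB.
have zr := zS r (ltW ar) (ltW rb).
rewrite -dotBr -[e](subrK (z r + z r)) dotDl dotDl (dotC dot (z r)).
have := ler_norm (dot (- (g (u r) - g (v r))) (z r)).
have := ler_norm (dot (e - (z r + z r)) (Gu r - Gv r)).
have := ler_wpM2l L0 zr.
lra.
Qed.

(** On pieces of length [d = w^2 / C] the Hölder bound keeps the oscillation of [z] below [w].
    Adding the pieces gives [2 L S (s - A) + 2 w V], where the first term is at most [S/2] and [w]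
    is as small as desired. *)
Let local_contraction (A B L S : R) : 0 <= A -> B <= T -> 0 <= L ->
  4 * L * (B - A) <= 1 -> 0 <= S -> z A = 0 ->
  (forall r, A <= r -> r <= B -> `|g (u r) - g (v r)| <= L * `|z r|) ->
  (forall r, A <= r -> r <= B -> `|z r| ^+ 2 <= S) ->
  forall s, A <= s -> s <= B -> `|z s| ^+ 2 <= S / 2.
Proof.
move=> A0 BT L0 LAB S0 zA gz zS s As sB.
have [C C0 hC] := z_holder.
pose V a b := \int[mu]_(r in `]a, b]) velocity_bound r.
have vb0 r : 0 <= velocity_bound r by rewrite addr_ge0.
have V0 a b : 0 <= V a b by apply: Rintegral_ge0.
apply/ler_addgt0Pr => e e0.
have V1 : 0 < V A s + 1 by rewrite ltr_wpDl.
pose w := e / 2 / (V A s + 1).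
have w0 : 0 < w by rewrite !divr_gt0.
pose d := w ^+ 2 / C.
have d0 : 0 < d by rewrite divr_gt0// exprn_gt0.
pose psi x := `|z x| ^+ 2 - 2 * L * S * (x - A) - 2 * w * V A x.
have : psi s <= psi A.
  apply: (nonincreasing_of_local d0 (B := s)) => // a b Aa ab bs bd.
  have a0 : 0 <= a := le_trans A0 Aa.
  have bT : b <= T by rewrite (le_trans bs)// (le_trans sB).
  have bB := le_trans bs sB.
  have osc x y : a <= x -> x <= y -> y <= b -> `|z y - z x| <= w.
    move=> ax xy yb; rewrite -ler_sqr ?nnegrE ?(ltW w0)//.
    rewrite (le_trans (hC _ _ xy))// mulrC -ler_pdivlMr//.
    by rewrite -/d lerBlDl (le_trans yb)// (le_trans bd)// lerD2r.
  have := sqr_dist_increment a0 ab bT L0 (S := S) (w := w)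
    (fun r ar rb => zS r (le_trans Aa ar) (le_trans rb bB)) _
    (fun r ar rb => gz r (le_trans Aa ar) (le_trans rb bB)).
  have VD : V A b = V A a + V a b.
    by apply: Rintegral_itvocD => //; exact: velocity_integrable.
  have zz r : a <= r -> r <= b -> `|z a - z r| <= w /\ `|z b - z r| <= w.
    by move=> ar rb; split; [rewrite distrC; exact: osc|exact: osc].
  move=> /(_ zz); rewrite -/(V a b) /psi VD; lra.
rewrite /psi subrr zA normr0 expr0n /=.
have -> : V A A = 0 by rewrite /V set_itvoc0 Rintegral_set0.
have : 2 * w * V A s <= e.
  rewrite (_ : e = 2 * w * (V A s + 1)); last first.
    by rewrite /w; field; rewrite gt_eqF.
  have w2 : 0 <= 2 * w := mulr_ge0 (ler0n R 2) (ltW w0).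
  by rewrite ler_wpM2l// lerDl.
have : 2 * L * S * (s - A) <= S / 2.
  have : 4 * L * (s - A) <= 1.
    by apply: le_trans LAB; rewrite ler_wpM2l ?mulr_ge0// lerD2r.
  by have : 0 <= s - A by [rewrite subr_ge0]; nra.
lra.
Qed.

(** Gronwall by iteration: the bound on [|z|^2], at first the one given by Hölder continuity from
    [z A = 0], is halved indefinitely. *)
Let local_uniqueness (A B L : R) : 0 <= A -> B <= T -> 0 <= L ->
  4 * L * (B - A) <= 1 -> z A = 0 ->
  (forall r, A <= r -> r <= B -> `|g (u r) - g (v r)| <= L * `|z r|) ->
  forall s, A <= s -> s <= B -> u s = v s.
Proof.
move=> A0 BT L0 LAB zA gz s As sB; have AB := le_trans As sB.
have [C C0 hC] := z_holder.
pose S0 := C * (B - A).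
have S00 : 0 <= S0 by rewrite mulr_ge0 ?subr_ge0 ?(ltW C0).
have bound k : forall r, A <= r -> r <= B -> `|z r| ^+ 2 <= S0 / 2 ^+ k.
  elim: k => [|k IH] r Ar rB.
    rewrite expr0 divr1; have := hC _ _ Ar; rewrite zA subr0 => /le_trans; apply.
    by rewrite ler_pM2l// lerD2r.
  rewrite [2 ^+ k.+1]exprSr invfM mulrA; apply: (local_contraction A0 BT L0 LAB) => //.
  by rewrite divr_ge0// exprn_ge0.
have : `|z s| ^+ 2 <= 0.
  apply/ler_addgt0Pr => e e0; rewrite add0r.
  have [k _ /(_ k (leqnn k))] := near_le_cvg0 (cvg_half_pow S0) ler01 e0.
  by rewrite /= mul1r; apply: le_trans; exact: bound.
by rewrite exprn_even_le0// normr_eq0 subr_eq0 => /eqP.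
Qed.

(** Continuation: agreement persists up to the supremum [tau] of the agreement times by continuity,
    and beyond it because both curves stay for a while in a ball where the gradient is Lipschitz. *)
Lemma strong_flow_unique : {in `[0, T], u =1 v}.
Proof.
have [C C0 hC] := z_holder.
pose E := [set tau | 0 <= tau <= T /\ forall s, 0 <= s -> s <= tau -> u s = v s].
have z0 : z 0 = 0 by rewrite /z (sf_init uF) (sf_init vF) subrr.
have E0 : E 0.
  split; first by rewrite lexx ltW.
  move=> s s0 s0'; have -> : s = 0 by apply/le_anti; rewrite s0 s0'.
  by apply/eqP; rewrite -subr_eq0; apply/eqP.
have hE : has_sup E by split; [exists 0|exists T => tau [/andP[]]].
have [tau [tau0 tauT tauE]] : exists tau, [/\ 0 <= tau, tau <= T & tau = sup E].
  exists (sup E); split => //; first exact: ub_le_sup hE.2 0 E0.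
  by apply: ge_sup; [exists 0|move=> x [/andP[]]].
have before s : 0 <= s -> s < tau -> u s = v s.
  move=> s0 st; have ts : 0 < tau - s by rewrite subr_gt0.
  have [x [_ xE] sx] := sup_adherent ts hE.
  by apply: xE => //; rewrite ltW// (le_lt_trans _ sx)// -tauE opprB addrC subrK.
have ztau : z tau = 0.
  have [tau1|] := ltP 0 tau; last by move=> tau1; have -> : tau = 0; [apply/le_anti; rewrite tau0 tau1|].
  have : `|z tau| ^+ 2 <= 0.
    apply/ler_addgt0Pr => e e0; rewrite add0r.
    pose s := Num.max 0 (tau - e / C).
    have s0 : 0 <= s by rewrite le_max lexx.
    have st : s < tau by rewrite gt_max tau1 ltrBlDr ltrDl divr_gt0.
    have := hC _ _ (ltW st); rewrite {2}/z (before s s0 st) subrr subr0.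
    move=> /le_trans; apply; rewrite mulrC -ler_pdivlMr// lerBlDr.
    by rewrite addrC -lerBlDr le_max lexx orbT.
  by rewrite exprn_even_le0// normr_eq0 => /eqP.
have upto s : 0 <= s -> s <= tau -> u s = v s.
  move=> s0; rewrite le_eqVlt => /orP[/eqP ->|]; last exact: before.
  by apply/eqP; rewrite -subr_eq0; apply/eqP.
suff tau_T : tau = T.
  by move=> s; rewrite in_itv /= => /andP[s0 sT]; apply: upto; rewrite ?tau_T.
apply: contrapT => /eqP tau_neq.
have tau_lt : tau < T by rewrite lt_neqAle tau_neq.
have [L [r r0 lip]] := g_lip (u tau).
have [Mu Mu0 hu] := sf_holder uF; have [Mv Mv0 hv] := sf_holder vF.
pose L1 := `|L|; have L10 : 0 <= L1 by exact: normr_ge0.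
(* The three bounds keep the interval inside [[0, T]], ensure the contraction condition
   [4 L1 c <= 1], and keep both Hölder curves within distance [r] of [u tau]. *)
pose c := Num.min (T - tau) (Num.min (1 / (4 * (L1 + 1))) (r ^+ 2 / (2 * (Mu + Mv + 1)))).
have L4 : 0 < 4 * (L1 + 1) by rewrite mulr_gt0// ltr_wpDl.
have M4 : 0 < 2 * (Mu + Mv + 1) by rewrite mulr_gt0// ltr_wpDl// addr_ge0.
have c0 : 0 < c by rewrite !lt_min subr_gt0 tau_lt !divr_gt0// exprn_gt0.
have cT : tau + c <= T by rewrite -lerBrDl ge_min lexx.
have cL : c * (4 * (L1 + 1)) <= 1 by rewrite -ler_pdivlMr// !ge_min lexx !orbT.
have cM : c * (2 * (Mu + Mv + 1)) <= r ^+ 2 by rewrite -ler_pdivlMr// !ge_min lexx !orbT.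
have in_ball (M : R) (x : R -> H) s : 0 <= M -> M <= Mu + Mv -> tau <= s -> s <= tau + c ->
    (forall s s', s <= s' -> `|x s' - x s| ^+ 2 <= M * (s' - s)) ->
    x tau = u tau -> ball (u tau) r (x s).
  move=> M0' MM ts sc hx xtau; rewrite -ball_normE /= -xtau distrC.
  rewrite -ltr_sqr ?nnegrE ?(ltW r0)//; apply: (le_lt_trans (hx _ _ ts)).
  have s1 : s - tau <= c by rewrite lerBlDl.
  have s2 : 0 <= s - tau by rewrite subr_ge0.
  by apply: lt_le_trans cM; nra.
have vtau : v tau = u tau by rewrite upto.
have after s : tau <= s -> s <= tau + c -> u s = v s.
  apply: (local_uniqueness tau0 cT L10) => //.
    by rewrite addrAC subrr add0r; nra.
  move=> x tx xc.
  apply: (@le_trans _ _ (L * `|u x - v x|)); last by rewrite ler_wpM2r// ler_norm.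
  by apply: lip; [apply: (in_ball Mu)|apply: (in_ball Mv)]; rewrite ?lerDr ?lerDl.
have : E (tau + c).
  split; first by rewrite cT andbT addr_ge0// ltW.
  by move=> s s0 sc; have [|/ltW] := leP s tau; [exact: upto|move=> ?; exact: after].
move=> /(ub_le_sup hE.2); rewrite -tauE gerDl leNgt c0 //.
Qed.

End Uniqueness.

(** * Convergence of the scheme *)

Lemma cvg_increasing (sigma : nat -> nat) :
  {homo sigma : m n / (m < n)%N} -> sigma n @[n --> \oo] --> \oo.
Proof.
move=> incr P [n0 _ Pn0]; exists n0 => // n /= n0n; apply: Pn0 => /=.
apply: (leq_trans n0n); elim: n {n0n} => // n IH.
exact: leq_ltn_trans IH (incr _ _ (ltnSn n)).
Qed.

Lemma cvg_sub_subsequences {X : topologicalType} (x : nat -> X) (l : X) :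
  (forall sigma, {homo sigma : m n / (m < n)%N} ->
     exists rho : nat -> nat, x (sigma (rho k)) @[k --> \oo] --> l) ->
  x n @[n --> \oo] --> l.
Proof.
move=> sub P lP; apply: contrapT => nP.
have [|sigma [incr sigmaN]] := @increasing_selection (fun _ n => ~ P (x n)).
  move=> _ m; apply: contrapT => hn; apply: nP; exists m.+1 => // n /= mn.
  by apply: contrapT => Pn; apply: hn; exists n.
have [rho /(_ P lP)[k _ /(_ k (leqnn k))]] := sub sigma incr.
exact: sigmaN.
Qed.

Section SchemeConvergence.
Context {R : realType} {H : completeNormedModType R}.

Lemma normH1sq_ext (T : R) (w u v : R -> H) : {in `[0, T], u =1 v} ->
  normH1sq T (fun s => w s - u s) = normH1sq T (fun s => w s - v s).
Proof.
move=> uv; have uv' s : 0 < s -> s < T -> u s = v s.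
  by move=> s0 sT; apply: uv; rewrite in_itv /= !ltW.
rewrite /normH1sq; congr (_ + _)%E; apply: normL2sq_ext => s s0 sT; first by rewrite uv'.
rewrite !derive1E; apply: near_eq_derive.
have : \forall a \near s, a \in `]0, T[ by apply: near_in_itvoo; rewrite in_itv /= s0.
by apply: filterS => a; rewrite in_itv /= => /andP[a0 aT]; rewrite uv'.
Qed.

End SchemeConvergence.

(** For [alpha < 1] the flow may branch. On the real line with [phi1 x = x^2] and
    [phi2 x = - |x|^(1+alpha) / (1+alpha)] several solutions start from 0, and sampling two of them
    alternately on finer and finer partitions gives vanishing residuals but no limit of the whole
    sequence. Hence the two conclusions: every subsequence has a further one converging strongly to
    a flow, and the whole sequence converges when the flow is unique, in particular for
    [alpha = 1]. *)
Theorem theorem4p2 (R : realType) (H : completeNormedModType R)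
    (dot : {dot H for idfun}) (hdot : induces_norm dot) (hsep : separable H)
    (phi phi1 : H -> \bar R) (phi2 : H -> R) (alpha T : R)
    (hphi : forall v, phi v = (phi1 v + (phi2 v)%:E)%E)
    (hcpt : compact_sublevels phi)
    (hconv : convex_ereal phi1) (hprop : proper_ereal phi1)
    (hlsc : lower_semicontinuous phi1)
    (hsv : single_valued (convex_subdiff dot phi1))
    (halpha : 0 < alpha <= 1) (hphi2 : C1_holder_loc dot alpha phi2)
    (hT : 0 < T)
    (N : nat -> nat) (t : nat -> nat -> R)
    (hpart : forall n, is_partition T (N n) (t n))
    (htau : diameter (N n) (t n) @[n --> \oo] --> 0)
    (u0 : H) (un : nat -> nat -> H)
    (hdom : forall n i, (i <= N n)%N -> dom_subdiff dot phi (un n i))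
    (hinit : forall n, un n 0%N = u0)
    (hres : (\sum_(1 <= i < (N n).+1)
        maxe (residual dot phi (tstep (t n) i) (un n i) (un n i.-1)) 0)%E
      @[n --> \oo] --> 0%E) :
  let flow := gradient_flow dot phi T u0 in
  let uhat := fun n => pw_affine (N n) (t n) (un n) in
  (forall sigma : nat -> nat, {homo sigma : m n / (m < n)%N} ->
     exists (rho : nat -> nat) (u : R -> H),
       [/\ {homo rho : m n / (m < n)%N}, flow u
         & cvgH1 T (fun k => uhat (sigma (rho k))) u]) /\
  ((alpha = 1 \/ forall u v, flow u -> flow v -> {in `[0, T], u =1 v}) ->
     exists u : R -> H, flow u /\ cvgH1 T uhat u).
Proof.
move=> flow uhat; have [g phi2g g_holder] := hphi2.
have /andP[alpha0 _] := halpha.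
have cg := holder_gradient_continuous alpha0 g_holder.
pose strong := strong_flow dot phi1 g T u0.
have limits (sigma : nat -> nat) : {homo sigma : m n / (m < n)%N} ->
    exists (rho : nat -> nat) (u G : R -> H), [/\ {homo rho : m n / (m < n)%N},
      strong u G & cvgH1 T (fun k => uhat (sigma (rho k))) u].
  move=> /cvg_increasing sigma_oo.
  apply: (scheme_strong_flow_limit hdot hsep hphi hcpt hconv hprop hlsc phi2g cg hT
    (N := N \o sigma) (t := t \o sigma) (un := un \o sigma)).
  - by move=> n; exact: hpart.
  - exact: (cvg_comp _ _ sigma_oo htau).
  - by move=> n; exact: hdom.
  - by move=> n; exact: hinit.
  - exact: (cvg_comp _ _ sigma_oo hres).
have strong_flow_flow u G : strong u G -> flow u.
  exact: (strong_flow_gradient_flow hdot hsep hphi hconv hprop hsv phi2g).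
split=> [sigma /limits[rho [u [G [rho_incr uG cvg_u]]]]|unique].
  by exists rho, u; split => //; exact: strong_flow_flow uG.
have strong_unique u Gu v Gv : strong u Gu -> strong v Gv -> {in `[0, T], u =1 v}.
  move=> uF vF; case: unique => [alpha1|]; last first.
    by apply; [exact: strong_flow_flow uF|exact: strong_flow_flow vF].
  apply: (strong_flow_unique hdot hprop.1 hT _ uF vF) => x.
  have [L [r r0 lip]] := g_holder x; exists L; exists r => // v1 w1 xv xw.
  by have := lip _ _ xv xw; rewrite alpha1 powRr1.
have [rho [u [G [_ uG [_ u_inH1 _]]]]] := limits id (fun _ _ => id).
exists u; split; first exact: strong_flow_flow uG.
split=> //.
  move=> n; exact: (weak_primitive_inH1 hdot hsep (sq_integrable_pw_speed _ (hpart n))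
    (weak_primitive_pw_affine _ _ (hpart n))).
(* The limit found along one subsequence is compared with the limit of a further subsequence of an
   arbitrary one; by uniqueness they agree on [[0, T]], where the norm is taken. *)
apply: cvg_sub_subsequences => sigma /limits[rho' [v [Gv [_ vG [_ _ cvg_v]]]]].
exists rho'; move: cvg_v; under eq_fun do rewrite (normH1sq_ext _ (strong_unique _ _ _ _ vG uG)).
by [].
Qed.
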